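(* Let $\hbar_0,\vartheta_0,B_0$ be real numbers with $\hbar_0\neq0$, $\vartheta_0\neq0$, $B_0\neq0$, $\hbar_0-\vartheta_0B_0\neq0$, let $e,B_{\mathrm{ext}}\in\mathbb R$, and let $(\varrho,r,s)\in\mathcal P_{\mathrm{gauge}}$. The formal minimally coupled Dirac operator $$D_\infty^\circ=D^{\prime\,r,s}-e\bigl(L_{A_x}\otimes\sigma_1+L_{A_y}\otimes\sigma_2\bigr),\qquad\operatorname{Dom}(D_\infty^\circ)=\mathcal S(\mathbb R^2)\otimes\mathbb C^2,$$ is essentially self-adjoint on $\mathcal S(\mathbb R^2)\otimes\mathbb C^2$ (as an operator in $L^2(\mathbb R^2)\otimes\mathbb C^2$).
   Context: **Dirac operator.** With $p_x=-i\hbar_0\partial_x$, $p_y=-i\hbar_0\partial_y$, put $\Pi^{r,s}_x=\tfrac{(1-r)\hbar_0B_0}{\hbar_0-r\vartheta_0B_0}\,y+\tfrac{(r+s-rs)\vartheta_0B_0-\hbar_0}{r\vartheta_0B_0-\hbar_0}\,p_x$, $\Pi^{r,s}_y=-rB_0\,x+[1+r(s-1)\tfrac{\vartheta_0B_0}{\hbar_0}]p_y$, $\widetilde\Pi^{r,s}_x=|\hbar_0B_0|^{-1/2}\Pi^{r,s}_x$, $\widetilde\Pi^{r,s}_y=\operatorname{sgn}(\hbar_0B_0)|\hbar_0B_0|^{-1/2}\Pi^{r,s}_y$, and let $D^{r,s}$ be the self-adjoint closure of $\frac1{\sqrt2}(\widetilde\Pi^{r,s}_x\otimes\sigma_1+\widetilde\Pi^{r,s}_y\otimes\sigma_2)$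 on $\mathcal S(\mathbb R^2)\otimes\mathbb C^2$, with Pauli matrices $\sigma_1=\begin{pmatrix}0&1\\1&0\end{pmatrix}$, $\sigma_2=\begin{pmatrix}0&-i\\i&0\end{pmatrix}$. Let $U_{r,s}$ be a (metaplectic) unitary on $L^2(\mathbb R^2)$ preserving $\mathcal S(\mathbb R^2)$ with $U_{r,s}\widetilde\Pi^{r,s}_xU_{r,s}^\dagger=X_+$, $U_{r,s}\widetilde\Pi^{r,s}_yU_{r,s}^\dagger=P_+$ on $\mathcal S(\mathbb R^2)$, where $X_+=\frac{X_1+X_2}{\sqrt2}$, $P_+=\frac{P_1+P_2}{\sqrt2}$, $X_j$ is multiplication by $x_j$, $P_j=-i\partial_{x_j}$, $(x_1,x_2)=(x,y)$. Then $D^{\prime\,r,s}=(U_{r,s}\otimes\mathbb I_{2\times2})D^{r,s}(U_{r,s}\otimes\mathbb I_{2\times2})^\dagger$. Thus $D^{\prime\,r,s}$ is the self-adjoint closure of $\frac1{\sqrt2}(X_+\otimes\sigma_1+P_+\otimes\sigma_2)$ on the core $\mathcal S(\mathbb R^2)\otimes\mathbb C^2$. **Gauge data.** $\vartheta_{\mathrm{eff}}=\vartheta_0/(1-\vartheta_0B_0/\hbar_0)$; $\Delta_\varrho^{\mathrm{gauge}}=\hbar_0^2-4\varrho(\varrho-1)e\hbar_0\vartheta_{\mathrm{eff}}B_{\mathrm{ext}}$; $\mathcal P_{\mathrm{gauge}}$ is the set of $(\varrho,r,s)\in\mathbb R\times(\mathbb R\setminus\{\hbar_0/(\vartheta_0B_0)\})\times\mathbb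 R$ with $\Delta_\varrho^{\mathrm{gauge}}\ge0$ and $\hbar_0+\sqrt{\Delta_\varrho^{\mathrm{gauge}}}\ne0$. For such triples $$A_x=\frac{-2(1-\varrho)\hbar_0B_{\mathrm{ext}}}{\hbar_0+\sqrt{\Delta_\varrho^{\mathrm{gauge}}}}\,y,\qquad A_y=\frac{2\varrho\hbar_0B_{\mathrm{ext}}}{\hbar_0+\sqrt{\Delta_\varrho^{\mathrm{gauge}}}}\,x.$$ For a linear function $b=\alpha x+\beta y$, $L_b=\alpha L_x+\beta L_y$ denotes left $\star_{\vartheta_{\mathrm{eff}},\varrho}$-multiplication on $\mathcal S(\mathbb R^2)$, for the product formally given by $f\star_{\vartheta_{\mathrm{eff}},\varrho}g=f\exp(-i(\varrho-1)\vartheta_{\mathrm{eff}}\overleftarrow{\partial_x}\overrightarrow{\partial_y}-i\varrho\vartheta_{\mathrm{eff}}\overleftarrow{\partial_y}\overrightarrow{\partial_x})g$; explicitly $$L_x\psi=x\psi+i(1-\varrho)\vartheta_{\mathrm{eff}}\,\partial_y\psi,\qquad L_y\psi=y\psi-i\varrho\vartheta_{\mathrm{eff}}\,\partial_x\psi,\qquad\psi\in\mathcal S(\mathbb R^2).$$ *)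

(* Defs.v *)
From HB Require Import structures.
From mathcomp Require Import all_boot all_order all_algebra.
From mathcomp Require Import complex.
From mathcomp Require Import all_classical all_reals all_analysis.

Set Implicit Arguments.
Unset Strict Implicit.
Unset Printing Implicit Defensive.

Import Order.TTheory GRing.Theory Num.Theory.
Import numFieldNormedType.Exports.

Local Open Scope classical_set_scope.
Local Open Scope ring_scope.
Local Open Scope complex_scope.

(* Vectors of L^2(R^2) and of L^2(R^2) (x) C^2 are handled through their
   representatives, functions R^2 -> C and pairs of such functions; equality
   in the Hilbert space is [eqL2], resp. [eqH] (almost-everywhere equality of
   square-integrable functions). *)
Notation wave R := (R * R -> R[i]).
Notation spinor R := ('I_2 -> wave R).

Definition mu2 (R : realType) :
    {measure set (measurableTypeR R * measurableTypeR R)%type -> \bar R} :=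
  (@lebesgue_measure R \x @lebesgue_measure R)%E.

Definition isL2 (R : realType) (f : wave R) : Prop :=
  ((@complex.Re R \o f) \in Lfun (mu2 R) 2%:E) /\
  ((@complex.Im R \o f) \in Lfun (mu2 R) 2%:E).

Definition eqL2 (R : realType) (f g : wave R) : Prop :=
  [/\ isL2 f, isL2 g & f = g %[ae mu2 R]].

(* Antilinear in the first argument. *)
Definition dotL2 (R : realType) (f g : wave R) : R[i] :=
  Rintegral (mu2 R) setT (fun p => complex.Re (conjc (f p) * g p)) +i*
  Rintegral (mu2 R) setT (fun p => complex.Im (conjc (f p) * g p)).

Definition isH (R : realType) (psi : spinor R) : Prop := forall j, isL2 (psi j).

Definition eqH (R : realType) (psi phi : spinor R) : Prop :=
  forall j, eqL2 (psi j) (phi j).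

Definition dotH (R : realType) (psi phi : spinor R) : R[i] :=
  \sum_(j < 2) dotL2 (psi j) (phi j).

Definition distH (R : realType) (psi phi : spinor R) : R :=
  let d : spinor R := fun j => psi j \- phi j in
  Num.sqrt (complex.Re (dotH d d)).

(* Unbounded operators in L^2(R^2) (x) C^2 are given by their graphs:
   [T psi phi] means that psi is in Dom T and phi = T psi. *)
Definition graph (R : realType) := spinor R -> spinor R -> Prop.

Definition dom (R : realType) (T : graph R) (psi : spinor R) : Prop :=
  exists phi, T psi phi.

(* The graph of a linear operator: well defined on classes, linear and
   single-valued. *)
Definition is_operator (R : realType) (T : graph R) : Prop :=
  [/\ forall psi phi, T psi phi -> isH psi /\ isH phi,
      forall psi psi' phi phi',
        T psi phi -> eqH psi psi' -> eqH phi phi' -> T psi' phi',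
      forall (a : R[i]) psi psi' phi phi', T psi phi -> T psi' phi' ->
        T (fun j => (a \*o psi j) \+ psi' j) (fun j => (a \*o phi j) \+ phi' j) &
      forall psi phi phi', T psi phi -> T psi phi' -> eqH phi phi'].

Definition densely_defined (R : realType) (T : graph R) : Prop :=
  forall psi, isH psi -> forall eps : R, 0 < eps ->
    exists2 u, dom T u & distH psi u < eps.

Definition op_closure (R : realType) (T : graph R) : graph R :=
  fun psi phi => [/\ isH psi, isH phi &
    forall eps : R, 0 < eps ->
      exists u v, [/\ T u v, distH psi u < eps & distH phi v < eps]].

(* For a densely defined T, the graph of its adjoint. *)
Definition op_adjoint (R : realType) (T : graph R) : graph R :=
  fun psi phi => [/\ isH psi, isH phi &
    forall u v, T u v -> dotH psi v = dotH phi u].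

Definition symmetric_op (R : realType) (T : graph R) : Prop :=
  forall psi phi u v, T psi phi -> T u v -> dotH psi v = dotH phi u.

Definition selfadjoint (R : realType) (T : graph R) : Prop :=
  [/\ is_operator T, densely_defined T &
      forall psi phi, T psi phi <-> op_adjoint T psi phi].

(* T is an operator whose domain is (the set of classes of elements of) E, and
   it is essentially self-adjoint. *)
Definition essentially_selfadjoint_on (R : realType)
    (E : spinor R -> Prop) (T : graph R) : Prop :=
  [/\ is_operator T,
      forall psi, dom T psi <-> exists2 u, E u & eqH psi u,
      densely_defined T,
      symmetric_op T &
      selfadjoint (op_closure T)].

(* The operator with domain E acting as A. *)
Definition op_on (R : realType) (E : spinor R -> Prop)
    (A : spinor R -> spinor R) : graph R :=
  fun psi phi => exists2 u, E u & eqH psi u /\ eqH phi (A u).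

(* The operator T - A, with domain E. *)
Definition op_sub_on (R : realType) (E : spinor R -> Prop) (T : graph R)
    (A : spinor R -> spinor R) : graph R :=
  fun psi phi => exists u v,
    [/\ E u, T u v, eqH psi u & eqH phi (fun j => v j \- A u j)].

(* U is a unitary operator on L^2(R^2), with adjoint Ud. *)
Definition unitary_with_adjoint (R : realType) (U Ud : wave R -> wave R) : Prop :=
  [/\ forall f g, eqL2 f g -> eqL2 (U f) (U g) /\ eqL2 (Ud f) (Ud g),
      forall (a : R[i]) f g, isL2 f -> isL2 g ->
        eqL2 (U ((a \*o f) \+ g)) ((a \*o U f) \+ U g),
      forall f g, isL2 f -> isL2 g -> dotL2 f (U g) = dotL2 (Ud f) g,
      forall f, isL2 f -> eqL2 (U (Ud f)) f &
      forall f, isL2 f -> eqL2 (Ud (U f)) f].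

(* (U (x) 1) T (U (x) 1)^dagger *)
Definition op_conj (R : realType) (U Ud : wave R -> wave R) (T : graph R) :
    graph R :=
  fun psi phi => isH psi /\
    exists2 v, T (fun j => Ud (psi j)) v & eqH phi (fun j => U (v j)).

Definition cderivable (R : realType) (h : R -> R[i]) (t : R) : Prop :=
  derivable (@complex.Re R \o h) t 1 /\ derivable (@complex.Im R \o h) t 1.

Definition cderive1 (R : realType) (h : R -> R[i]) (t : R) : R[i] :=
  derive1 (@complex.Re R \o h) t +i* derive1 (@complex.Im R \o h) t.

Definition partial_x (R : realType) (f : wave R) : wave R :=
  fun p => cderive1 (fun t => f (t, p.2)) p.1.

Definition partial_y (R : realType) (f : wave R) : wave R :=
  fun p => cderive1 (fun t => f (p.1, t)) p.2.

Definition partials (R : realType) (w : seq bool) (f : wave R) : wave R :=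
  foldr (fun b => if b then @partial_y R else @partial_x R) f w.

Definition smooth (R : realType) (f : wave R) : Prop :=
  forall w,
    [/\ continuous (@complex.Re R \o partials w f),
        continuous (@complex.Im R \o partials w f),
        forall p : R * R, cderivable (fun t => partials w f (t, p.2)) p.1 &
        forall p : R * R, cderivable (fun t => partials w f (p.1, t)) p.2].

Definition schwartz (R : realType) (f : wave R) : Prop :=
  smooth f /\
  forall w (a b : nat), exists C : R, forall p : R * R,
    `|(p.1 ^+ a * p.2 ^+ b)%:C * partials w f p| <= C%:C.

Definition schwartz2 (R : realType) (psi : spinor R) : Prop :=
  forall j, schwartz (psi j).

Definition mul_x (R : realType) (f : wave R) : wave R := fun p => p.1%:C * f p.
Definition mul_y (R : realType) (f : wave R) : wave R := fun p => p.2%:C * f p.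

(* - i hbar d/dx and - i hbar d/dy *)
Definition mom_x (R : realType) (hbar : R) (f : wave R) : wave R :=
  fun p => - 'i%C * hbar%:C * partial_x f p.
Definition mom_y (R : realType) (hbar : R) (f : wave R) : wave R :=
  fun p => - 'i%C * hbar%:C * partial_y f p.

Definition oplin (R : realType) (a : R) (A : wave R -> wave R)
    (b : R) (B : wave R -> wave R) : wave R -> wave R :=
  fun f => (a%:C \*o A f) \+ (b%:C \*o B f).

Definition Pi_x (R : realType) (h0 th0 B0 r s : R) : wave R -> wave R :=
  oplin ((1 - r) * h0 * B0 / (h0 - r * th0 * B0)) (@mul_y R)
        (((r + s - r * s) * th0 * B0 - h0) / (r * th0 * B0 - h0)) (mom_x h0).

Definition Pi_y (R : realType) (h0 th0 B0 r s : R) : wave R -> wave R :=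
  oplin (- r * B0) (@mul_x R)
        (1 + r * (s - 1) * (th0 * B0 / h0)) (mom_y h0).

Definition tPi_x (R : realType) (h0 th0 B0 r s : R) (f : wave R) : wave R :=
  ((Num.sqrt `|h0 * B0|)^-1)%:C \*o Pi_x h0 th0 B0 r s f.

Definition tPi_y (R : realType) (h0 th0 B0 r s : R) (f : wave R) : wave R :=
  (Num.sg (h0 * B0) * (Num.sqrt `|h0 * B0|)^-1)%:C \*o Pi_y h0 th0 B0 r s f.

Definition X_plus (R : realType) : wave R -> wave R :=
  oplin (Num.sqrt 2)^-1 (@mul_x R) (Num.sqrt 2)^-1 (@mul_y R).

Definition P_plus (R : realType) : wave R -> wave R :=
  oplin (Num.sqrt 2)^-1 (mom_x 1) (Num.sqrt 2)^-1 (mom_y 1).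

Definition mx22 (K : Type) (a b c d : K) : 'M[K]_2 :=
  \matrix_(i < 2, j < 2)
    if i == 0 :> nat then (if j == 0 :> nat then a else b)
    else (if j == 0 :> nat then c else d).

Definition sigma1 (R : realType) : 'M[R[i]]_2 := mx22 0 1 1 0.
Definition sigma2 (R : realType) : 'M[R[i]]_2 := mx22 0 (- 'i%C) 'i%C 0.

(* A (x) M *)
Definition tensor (R : realType) (A : wave R -> wave R) (M : 'M[R[i]]_2)
    (psi : spinor R) : spinor R :=
  fun j p => \sum_(k < 2) M j k * A (psi k) p.

(* c (A (x) sigma_1 + B (x) sigma_2) *)
Definition dirac (R : realType) (c : R) (A B : wave R -> wave R)
    (psi : spinor R) : spinor R :=
  fun j => c%:C \*o (tensor A (sigma1 R) psi j \+ tensor B (sigma2 R) psi j).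

Definition D_rs (R : realType) (h0 th0 B0 r s : R) : graph R :=
  op_closure (op_on (@schwartz2 R)
    (dirac (Num.sqrt 2)^-1 (tPi_x h0 th0 B0 r s) (tPi_y h0 th0 B0 r s))).

(* U A U^dagger = A' on the Schwartz space; g is the Schwartz representative of
   U^dagger f, to which the differential operator A is applied. *)
Definition intertwines (R : realType) (U Ud A A' : wave R -> wave R) : Prop :=
  forall f g, schwartz f -> schwartz g -> eqL2 g (Ud f) -> eqL2 (U (A g)) (A' f).

Definition preserves_schwartz (R : realType) (U Ud : wave R -> wave R) : Prop :=
  forall f, schwartz f ->
    (exists2 g, schwartz g & eqL2 (U f) g) /\
    (exists2 g, schwartz g & eqL2 (Ud f) g).

Definition theta_eff (R : realType) (h0 th0 B0 : R) : R :=
  th0 / (1 - th0 * B0 / h0).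

Definition Delta_gauge (R : realType) (h0 th0 B0 e Bext rho : R) : R :=
  h0 ^+ 2 - 4 * rho * (rho - 1) * e * h0 * theta_eff h0 th0 B0 * Bext.

Definition P_gauge (R : realType) (h0 th0 B0 e Bext rho r s : R) : Prop :=
  [/\ r <> h0 / (th0 * B0),
      0 <= Delta_gauge h0 th0 B0 e Bext rho &
      h0 + Num.sqrt (Delta_gauge h0 th0 B0 e Bext rho) <> 0].

Definition A_x (R : realType) (h0 th0 B0 e Bext rho : R) (p : R * R) : R :=
  - 2 * (1 - rho) * h0 * Bext /
    (h0 + Num.sqrt (Delta_gauge h0 th0 B0 e Bext rho)) * p.2.

Definition A_y (R : realType) (h0 th0 B0 e Bext rho : R) (p : R * R) : R :=
  2 * rho * h0 * Bext /
    (h0 + Num.sqrt (Delta_gauge h0 th0 B0 e Bext rho)) * p.1.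

(* Left multiplication by x and by y for the star-product with parameters
   (theta, rho). *)
Definition L_x (R : realType) (theta rho : R) (f : wave R) : wave R :=
  fun p => p.1%:C * f p + 'i%C * ((1 - rho) * theta)%:C * partial_y f p.
Definition L_y (R : realType) (theta rho : R) (f : wave R) : wave R :=
  fun p => p.2%:C * f p - 'i%C * (rho * theta)%:C * partial_x f p.

(* L_b for a linear function b (x, y) = alpha x + beta y, whose coefficients
   are alpha = b (1, 0) and beta = b (0, 1). *)
Definition L_lin (R : realType) (theta rho : R) (b : R * R -> R) :
    wave R -> wave R :=
  oplin (b (1, 0)) (L_x theta rho) (b (0, 1)) (L_y theta rho).

(* The operator D'^{r,s} - e (L_{A_x} (x) sigma_1 + L_{A_y} (x) sigma_2),
   D'^{r,s} being conjugated by U (x) 1. *)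
Definition D_infty (R : realType) (U Ud : wave R -> wave R)
    (h0 th0 B0 e Bext rho r s : R) : graph R :=
  let L := L_lin (theta_eff h0 th0 B0) rho in
  op_sub_on (@schwartz2 R) (op_conj U Ud (D_rs h0 th0 B0 r s))
    (dirac e (L (A_x h0 th0 B0 e Bext rho)) (L (A_y h0 th0 B0 e Bext rho))).

(* Main.v *)
(* After conjugation by U, the operator D_infty is a first-order matrix operator
   [D = A (x) sigma_1 + B (x) sigma_2] on Schwartz spinors, where A and B are
   real linear combinations of x, y, -i d/dx and -i d/dy; the precise values of
   the coefficients play no role. D is symmetric by integration by parts, and
   its closure is selfadjoint by a Friedrichs mollifier argument. Let
   [J_n f (p) = chi_n (p) * (f * rho_n) (p)], with rho_n a Gaussian of width
   about 1/n and unit mass, and chi_n a Gaussian of width about n. Then J_n maps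
   L^2 into the Schwartz space, J_n f tends to f in L^2, and the commutators of
   J_n with x, y, d/dx and d/dy have operator norm O(1/n) by Schur's test. If
   (psi, phi) is in the graph of the adjoint of D, testing against the kernel
   J_n (p, .) gives D (J_n psi) = J_n phi + O(1/n), so that (psi, phi) is in the
   graph of the closure. *)

From HB Require Import structures.
From mathcomp Require Import all_boot all_order all_algebra.
From mathcomp Require Import complex ring lra.
From mathcomp Require Import all_classical all_reals all_analysis.
From mathcomp Require Import measurable_realfun.
Require Import Defs.

Set Implicit Arguments.
Unset Strict Implicit.
Unset Printing Implicit Defensive.

Import Order.TTheory GRing.Theory Num.Theory.
Import numFieldNormedType.Exports.

Local Open Scope classical_set_scope.
Local Open Scope ring_scope.

(** * Real square-integrable functions *)

(** [D_rs] is a closure, known only through limits, so before any mollifying a Schwartz spinor must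
    be shown to have exactly one image under the conjugated operator. This comes from symmetry: the
    closure of a densely defined symmetric operator lies inside its adjoint, which is single-valued.

    Gaussians are chosen for algebra as much as for decay. Multiplied by monomials they form a
    family stable under coordinates and derivatives, so one induction on formal linear combinations
    shows that J_n f is a Schwartz function, and also that its kernel is an admissible test
    function. The commutators are kernels of the same family. That of x is (p.1 - q.1) J_n(p, q), of
    size b^(-1/2) if rho_n has rate b. That of d/dx is -2 a p.1 J_n(p, q), of size 2 a^(1/2) if
    chi_n has rate a: rho_n depends on q - p only, hence only chi_n is differentiated. All
    operations fall on the kernel, so that neither x f nor the derivatives of f have to exist.

    The estimates are made on real functions; the factor -i only exchanges real and imaginary
    parts. *)

Section L2.
Context d (T : measurableType d) (R : realType) (mu : {measure set T -> \bar R}).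
Implicit Types f g h : T -> R.

Definition integr f := mu.-integrable setT (EFin \o f).
Definition L2 f := measurable_fun setT f /\ integr (fun x => f x ^+ 2).
Definition ip f g : R := \int[mu]_x (f x * g x).

Lemma integr_measurable f : integr f -> measurable_fun setT f.
Proof. by move=> /measurable_int /measurable_EFinP. Qed.

Lemma integr_le f g : measurable_fun setT f -> integr g ->
  (forall x, `|f x| <= g x) -> integr f.
Proof.
move=> mf ig fg; apply: (le_integrable _ _ _ ig) => //; first exact/measurable_EFinP.
by move=> x _ /=; rewrite lee_fin (le_trans (fg x)) ?ler_norm.
Qed.

Lemma integrD f g : integr f -> integr g -> integr (fun x => f x + g x).
Proof. by move=> fi gi; apply: (integrableD _ fi gi). Qed.

Lemma integrZ a f : integr f -> integr (fun x => a * f x).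
Proof. by move=> fi; apply: (integrableZl _ a fi). Qed.

Lemma integrN f : integr f -> integr (fun x => - f x).
Proof. by move=> fi; under eq_fun do rewrite -mulN1r; exact: integrZ. Qed.

Lemma integrB f g : integr f -> integr g -> integr (fun x => f x - g x).
Proof. by move=> fi gi; apply: integrD => //; exact: integrN. Qed.

Lemma integr0 : integr (fun=> 0).
Proof. exact: integrable0. Qed.

Lemma integr_norm f : integr f -> integr (fun x => `|f x|).
Proof.
move=> fi; apply: (integr_le _ (g := fun x => `|f x|)) => //; last 2 first.
- exact: (integrable_norm fi).
- by move=> x; rewrite normr_id.
exact/measurableT_comp/integr_measurable.
Qed.

Lemma Rint_ge0_integr f : measurable_fun setT f -> (forall x, 0 <= f x) ->
  (\int[mu]_x (f x)%:E < +oo)%E -> integr f.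
Proof.
move=> mf f0 fi; apply/integrableP; split; first exact/measurable_EFinP.
by under eq_integral do rewrite /= ger0_norm//.
Qed.

Lemma integr_fin f : integr f -> (\int[mu]_x (f x)%:E)%E = (\int[mu]_x f x)%:E.
Proof. by move=> fi; rewrite /Rintegral fineK//; exact: integrable_fin_num. Qed.

Lemma integr_mul f g : L2 f -> L2 g -> integr (fun x => f x * g x).
Proof.
move=> [mf fi] [mg gi]; apply: (integr_le _ (integrD fi gi)) => [|x].
  exact: measurable_funM.
rewrite normrM -(real_normK (num_real (f x))) -(real_normK (num_real (g x))).
by have := sqr_ge0 (`|f x| - `|g x|); have := sqr_ge0 (`|f x| + `|g x|); nra.
Qed.

Lemma L2_le f g : measurable_fun setT f -> L2 g -> (forall x, `|f x| <= `|g x|) ->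
  L2 f.
Proof.
move=> mf [mg gi] fg; split => //; apply: (integr_le _ gi) => [|x].
  exact: measurable_funX.
by rewrite normrX -(real_normK (num_real (g x))) lerXn2r ?nnegrE ?fg.
Qed.

Lemma L2D f g : L2 f -> L2 g -> L2 (fun x => f x + g x).
Proof.
move=> lf lg; have [[mf fi] [mg gi]] := (lf, lg); split; first exact: measurable_funD.
have := integrD (integrD fi gi) (integrZ 2 (integr_mul lf lg)).
by congr integr; apply/funext => x; ring.
Qed.

Lemma L2Z a f : L2 f -> L2 (fun x => a * f x).
Proof.
move=> [mf fi]; split; first exact: measurable_funM.
by have := integrZ (a ^+ 2) fi; congr integr; apply/funext => x; ring.
Qed.

Lemma L2N f : L2 f -> L2 (fun x => - f x).
Proof. by move=> /(L2Z (-1)); congr L2; apply/funext => x; ring. Qed.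

Lemma L2B f g : L2 f -> L2 g -> L2 (fun x => f x - g x).
Proof. by move=> lf lg; apply: L2D => //; exact: L2N. Qed.

Lemma L2_0 : L2 (fun=> 0).
Proof. by split => //; under eq_fun do rewrite expr0n /=; exact: integr0. Qed.

Lemma L2_bounded f C : integr f -> (forall x, `|f x| <= C) -> L2 f.
Proof.
move=> fi fC; split; first exact: integr_measurable.
apply: (integr_le _ (integrZ C (integr_norm fi))) => [|x].
  exact/measurable_funX/integr_measurable.
by rewrite normrX expr2 ler_wpM2r.
Qed.

Lemma ipC f g : ip f g = ip g f.
Proof. by rewrite /ip; under eq_Rintegral do rewrite mulrC. Qed.

Lemma ipDl f g h : L2 f -> L2 g -> L2 h -> ip (fun x => f x + g x) h = ip f h + ip g h.
Proof.
move=> lf lg lh; rewrite /ip -RintegralD//; try exact: integr_mul.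
by under eq_Rintegral do rewrite mulrDl.
Qed.

Lemma ipZl a f h : L2 f -> L2 h -> ip (fun x => a * f x) h = a * ip f h.
Proof.
move=> lf lh; rewrite /ip -RintegralZl//; try exact: integr_mul.
by under eq_Rintegral do rewrite -mulrA.
Qed.

Lemma ipNl f h : L2 f -> L2 h -> ip (fun x => - f x) h = - ip f h.
Proof. by move=> lf lh; under eq_fun do rewrite -mulN1r; rewrite ipZl// mulN1r. Qed.

Lemma ipBl f g h : L2 f -> L2 g -> L2 h -> ip (fun x => f x - g x) h = ip f h - ip g h.
Proof. by move=> lf lg lh; rewrite ipDl ?ipNl//; exact: L2N. Qed.

Lemma ip_ge0 f : 0 <= ip f f.
Proof. by apply: Rintegral_ge0 => x _; rewrite -expr2 sqr_ge0. Qed.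

Lemma ip_fin f : L2 f -> (\int[mu]_x (f x ^+ 2)%:E)%E = (ip f f)%:E.
Proof. by move=> [_ fi]; rewrite integr_fin. Qed.

Lemma ip_eq0 f : L2 f -> ip f f = 0 -> f = cst 0 %[ae mu].
Proof.
move=> lf f0; have := ip_fin lf; rewrite f0 => fi0; case: (lf) => mf fi.
have h : (\int[mu]_x `|(f x ^+ 2)%:E| = 0)%E.
  by rewrite -[RHS]fi0; apply: eq_integral => x _; rewrite /= ger0_norm ?sqr_ge0.
have /(ae_eq_integral_abs mu measurableT) : measurable_fun setT (fun x => (f x ^+ 2)%:E).
  exact/measurable_EFinP/integr_measurable.
move=> [/(_ h) + _]; apply: filterS => x /= /(_ I) [] /eqP.
by rewrite sqrf_eq0 => /eqP.
Qed.

Lemma ip_ae f g h : L2 f -> L2 g -> L2 h -> f = g %[ae mu] -> ip f h = ip g h.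
Proof.
move=> lf lg lh fg; rewrite /ip /Rintegral; congr fine; apply: ae_eq_integral => //.
- exact/measurable_EFinP/integr_measurable/integr_mul.
- exact/measurable_EFinP/integr_measurable/integr_mul.
- by move: fg; apply: filterS => x /= ->.
Qed.

(** The form [ip (a f + b g) (a f + b g)] is nonnegative in [a] and [b]; when [ip g g] is positive
    it is evaluated at [ip g g] and [- ip f g]. *)
Lemma ip_CS f g : L2 f -> L2 g -> ip f g ^+ 2 <= ip f f * ip g g.
Proof.
move=> lf lg.
have H a b : 0 <= a ^+ 2 * ip f f + 2 * a * b * ip f g + b ^+ 2 * ip g g.
  have := ip_ge0 (fun x => a * f x + b * g x).
  have [la lb] : L2 (fun x => a * f x) /\ L2 (fun x => b * g x) by split; exact: L2Z.
  rewrite ipDl ?ipZl//; try exact: L2D.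
  rewrite (ipC f) (ipC g) !ipDl ?ipZl// (ipC g f) => /le_trans; apply.
  by rewrite le_eqVlt; apply/orP; left; apply/eqP; ring.
have [g0|g0] := eqVneq (ip g g) 0.
  (* For [ip g g = 0] the form at [a = 1] is affine in [b]; this [b] would give it the value -1 if
     [ip f g] were nonzero. *)
  have := H 1 (- (ip f f + 1) / (2 * ip f g)); rewrite g0 !mulr0.
  have [->|fg0] := eqVneq (ip f g) 0; first by rewrite expr0n.
  rewrite addr0 => h; exfalso; move: h; apply/negP; rewrite -ltNge.
  rewrite [ltLHS](_ : _ = -1) ?ltrN10//.
  by field.
have gp : 0 < ip g g by rewrite lt_def g0 ip_ge0.
have := H (ip g g) (- ip f g); rewrite [leRHS](_ : _ = ip g g * (ip f f * ip g g - ip f g ^+ 2)); last by ring.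
by rewrite pmulr_rge0// subr_ge0.
Qed.

(** Cauchy-Schwarz for the measure of density [w], through the factorisation of [w f] as sqrt w
    times (sqrt w f). *)
Lemma weighted_CS w f : measurable_fun setT f -> (forall x, 0 <= w x) ->
  integr w -> integr (fun x => w x * f x ^+ 2) ->
  integr (fun x => w x * f x) /\
  (\int[mu]_x (w x * f x)) ^+ 2 <= (\int[mu]_x w x) * \int[mu]_x (w x * f x ^+ 2).
Proof.
move=> mf w0 wi wfi.
have ms : measurable_fun setT (fun x => Num.sqrt (w x)).
  apply: (measurableT_comp _ (integr_measurable wi)).
  by apply: continuous_measurable_fun => x; exact: sqrt_continuous.
have ls : L2 (fun x => Num.sqrt (w x)).
  by split => //; under eq_fun do rewrite sqr_sqrtr//.
have lsf : L2 (fun x => Num.sqrt (w x) * f x).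
  split; first exact: measurable_funM.
  by under eq_fun do rewrite exprMn sqr_sqrtr//.
have E : (fun x => w x * f x) = (fun x => Num.sqrt (w x) * (Num.sqrt (w x) * f x)).
  by apply/funext => x; rewrite mulrA -expr2 sqr_sqrtr.
split; first by rewrite E; exact: integr_mul.
have := ip_CS ls lsf; rewrite /ip.
rewrite (_ : (fun x => w x * f x) = (fun x => Num.sqrt (w x) * (Num.sqrt (w x) * f x)))//.
under [X in _ <= X * _ -> _]eq_Rintegral do rewrite -expr2 sqr_sqrtr//.
under [X in _ <= _ * X -> _]eq_Rintegral do rewrite -expr2 exprMn sqr_sqrtr//.
by [].
Qed.

(** Expanding [0 <= ip (f - g) (f - g)] gives it. It stands in for the triangle inequality, so that
    norms stay squared throughout. *)
Lemma ip_sqrD f g : L2 f -> L2 g ->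
  ip (fun x => f x + g x) (fun x => f x + g x) <= 2 * ip f f + 2 * ip g g.
Proof.
move=> lf lg; have := ip_ge0 (fun x => f x - g x).
rewrite ipBl ?ipDl//; try (exact: L2D || exact: L2B).
rewrite ![ip f (fun _ => _)]ipC ![ip g (fun _ => _)]ipC !ipBl ?ipDl// (ipC g f); lra.
Qed.

End L2.

(** * Schur's test for kernels dominated by a kernel with constant marginals *)

Section Schur.
Context d (T : measurableType d) (R : realType) (mu : {sigma_finite_measure set T -> \bar R}).
Implicit Types (f : T -> R) (k G : T -> T -> R).

Lemma measurable_section k : measurable_fun setT (fun z : T * T => k z.1 z.2) ->
  forall p, measurable_fun setT (k p).
Proof.
by move=> mk p; exact: (measurableT_comp mk (measurable_pair1 p)).
Qed.

Lemma measurable_section2 k : measurable_fun setT (fun z : T * T => k z.1 z.2) ->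
  forall q, measurable_fun setT (k ^~ q).
Proof.
by move=> mk q; exact: (measurableT_comp mk (measurable_pair2 q)).
Qed.

Lemma measurable_Rint k : measurable_fun setT (fun z : T * T => k z.1 z.2) ->
  measurable_fun setT (fun p => \int[mu]_q k p q).
Proof.
move=> mk; apply: measurableT_comp => //.
under eq_fun do rewrite integralE.
have mE : measurable_fun setT (fun z : T * T => (k z.1 z.2)%:E) by exact/measurable_EFinP.
apply: emeasurable_funB.
  have H := @measurable_fun_fubini_tonelli_F _ _ _ _ _ mu _ (measurable_funepos mE).
  rewrite [X in measurable_fun _ X](_ : _ = fubini_F mu (fun z : T * T => (k z.1 z.2)%:E)^\+%E); last first.
    by apply/funext => p; apply: eq_integral => q _; rewrite !funeposE.
  by apply: H => z; exact: funepos_ge0.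
have H := @measurable_fun_fubini_tonelli_F _ _ _ _ _ mu _ (measurable_funeneg mE).
rewrite [X in measurable_fun _ X](_ : _ = fubini_F mu (fun z : T * T => (k z.1 z.2)%:E)^\-%E); last first.
  by apply/funext => p; apply: eq_integral => q _; rewrite !funenegE.
by apply: H => z; exact: funeneg_ge0.
Qed.

Context G (A C : R).
Hypothesis mG : measurable_fun setT (fun z : T * T => G z.1 z.2).
Hypothesis G0 : forall p q, 0 <= G p q.
Hypothesis GC : forall p q, G p q <= C.
Hypothesis GA : forall p, (\int[mu]_q (G p q)%:E = A%:E)%E.
Hypothesis GA' : forall q, (\int[mu]_p (G p q)%:E = A%:E)%E.

Lemma G_integr p : integr mu (G p).
Proof. by apply: Rint_ge0_integr => //; [exact: measurable_section|rewrite GA ltry]. Qed.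

Lemma GsqrE f : measurable_fun setT f ->
  (\int[mu]_p \int[mu]_q (G p q * f q ^+ 2)%:E = A%:E * \int[mu]_q (f q ^+ 2)%:E)%E.
Proof.
move=> mf; rewrite (fubini_tonelli (fun z : T * T => (G z.1 z.2 * f z.2 ^+ 2)%:E))/=; last 2 first.
- apply/measurable_EFinP/measurable_funM => //.
  by apply: measurable_funX; exact: measurableT_comp.
- by move=> z; rewrite lee_fin mulr_ge0// sqr_ge0.
have A0 : (0 <= A%:E)%E by rewrite -(GA point); apply: integral_ge0 => q _; rewrite lee_fin.
rewrite -ge0_integralZl//; last 2 first.
- by apply/measurable_EFinP/measurable_funX.
- by move=> x _; rewrite lee_fin sqr_ge0.
apply: eq_integral => q _; under eq_integral do rewrite EFinM muleC.
rewrite ge0_integralZl//= ?GA' 1?muleC//.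
- by apply/measurable_EFinP/measurable_section2.
- by move=> p _; rewrite lee_fin.
- by rewrite lee_fin sqr_ge0.
Qed.

(** The uniform bound [C] gives integrability for every [p], and not just for almost every [p]: the
    integral operators below are functions defined everywhere. *)
Lemma Gsqr_integr f p : L2 mu f -> integr mu (fun q => G p q * f q ^+ 2).
Proof.
move=> [mf fi]; apply: (integr_le _ (integrZ C fi)) => [|q].
  by apply: measurable_funM; [exact: measurable_section|exact: measurable_funX].
rewrite ger0_norm; first by apply: ler_wpM2r; rewrite ?sqr_ge0.
by rewrite mulr_ge0 ?sqr_ge0.
Qed.

Lemma G_CS f p : L2 mu f -> integr mu (fun q => G p q * `|f q|) /\
  (\int[mu]_q (G p q * `|f q|)) ^+ 2 <= A * \int[mu]_q (G p q * f q ^+ 2).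
Proof.
move=> lf.
have mf : measurable_fun setT (fun q => `|f q|) by case: lf => mf _; exact: measurableT_comp.
have E : (fun q => G p q * f q ^+ 2) = (fun q => G p q * `|f q| ^+ 2).
  by apply/funext => q; rewrite real_normK ?num_real.
have := Gsqr_integr p lf; rewrite E => h.
have [h1 h2] := weighted_CS mf (G0 p) (G_integr p) h.
by split => //; rewrite (le_trans h2)// {1}/Rintegral GA.
Qed.

(** Cauchy-Schwarz with weight [G p] bounds [K p ^+ 2] by [M ^+ 2 * A] times the integral of
    [G p q * f q ^+ 2]; integrating in [p] by Tonelli yields the second factor [A]. *)
Lemma schur k M f : measurable_fun setT (fun z : T * T => k z.1 z.2) ->
  (forall p q, `|k p q| <= M * G p q) -> L2 mu f ->
  let K p := \int[mu]_q (k p q * f q) in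
  [/\ forall p, integr mu (fun q => k p q * f q), L2 mu K &
    ip mu K K <= M ^+ 2 * A ^+ 2 * ip mu f f].
Proof.
move=> mk kG lf K; have [mf fi] := lf.
have mkf : measurable_fun setT (fun z : T * T => k z.1 z.2 * f z.2).
  by apply: measurable_funM => //; exact: measurableT_comp.
have Gf p : integr mu (fun q => M * (G p q * `|f q|)).
  by apply: integrZ; exact: (G_CS p lf).1.
have kfi p : integr mu (fun q => k p q * f q).
  apply: (integr_le _ (Gf p)) => [|q]; first exact: (measurable_section (k := fun p q => k p q * f q) mkf).
  by rewrite normrM mulrA ler_wpM2r.
have A0 : 0 <= A.
  by rewrite -lee_fin -(GA point); apply: integral_ge0 => q _; rewrite lee_fin.
have mK : measurable_fun setT K by exact: (measurable_Rint (k := fun p q => k p q * f q) mkf).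
have KE p : ((K p ^+ 2)%:E <= (M ^+ 2 * A)%:E * \int[mu]_q (G p q * f q ^+ 2)%:E)%E.
  rewrite (integr_fin (Gsqr_integr p lf)) -EFinM lee_fin.
  have Kle : `|K p| <= M * \int[mu]_q (G p q * `|f q|).
    rewrite -RintegralZl//; last exact: (G_CS p lf).1.
    apply: (le_trans (le_normr_Rintegral _ (kfi p))) => //.
    apply: le_Rintegral => //; first exact: integr_norm.
    - exact: Gf.
    - by move=> q _; rewrite normrM mulrA ler_wpM2r.
  rewrite -(real_normK (num_real (K p))) (le_trans (y := (M * \int[mu]_q (G p q * `|f q|)) ^+ 2))//.
    by rewrite lerXn2r ?nnegrE// (le_trans _ Kle).
  have := (G_CS p lf).2; move: (\int[mu]_q _) (\int[mu]_q _) => a b ab.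
  have := ler_wpM2l (sqr_ge0 M) ab. nra.
have mGf : measurable_fun setT (fun p => \int[mu]_q (G p q * f q ^+ 2)%:E)%E.
  apply: (measurable_fun_fubini_tonelli_F (fun z : T * T => (G z.1 z.2 * f z.2 ^+ 2)%:E)) => [|z].
    by apply/measurable_EFinP/measurable_funM => //; apply: measurable_funX; exact: measurableT_comp.
  by rewrite lee_fin mulr_ge0// sqr_ge0.
have S : (\int[mu]_p (K p ^+ 2)%:E <= (M ^+ 2 * A ^+ 2 * ip mu f f)%:E)%E.
  apply: (@le_trans _ _ (\int[mu]_p ((M ^+ 2 * A)%:E * \int[mu]_q (G p q * f q ^+ 2)%:E))%E).
    apply: ge0_le_integral => //.
    - by move=> p _; rewrite lee_fin sqr_ge0.
    - exact/measurable_EFinP/measurable_funX.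
    - exact: measurable_funeM.
  rewrite ge0_integralZl//; last 2 first.
  - by move=> p _; apply: integral_ge0 => q _; rewrite lee_fin mulr_ge0// sqr_ge0.
  - by rewrite lee_fin mulr_ge0// sqr_ge0.
  by rewrite GsqrE// ip_fin// -!EFinM lee_fin expr2 !mulrA.
have lK : L2 mu K.
  split => //; apply: Rint_ge0_integr => [|p|]; first exact: measurable_funX.
    exact: sqr_ge0.
  by rewrite (le_lt_trans S)// ltry.
by split => //; rewrite -lee_fin -ip_fin.
Qed.

End Schur.

(** * Dominated convergence in L2 *)

Section L2cvg.
Context d (T : measurableType d) (R : realType) (mu : {measure set T -> \bar R}).
Implicit Types f g h : T -> R.

(** The limit is dominated by [g] as well, so the squared differences are dominated by the
    integrable function [4 * g x ^+ 2] and tend to 0 pointwise. *)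
Lemma L2_dominated (f_ : nat -> T -> R) f g : (forall n, measurable_fun setT (f_ n)) ->
  L2 mu g -> (forall n x, `|f_ n x| <= `|g x|) -> (forall x, f_ n x @[n --> \oo] --> f x) ->
  L2 mu f /\ forall e : R, 0 < e -> \forall n \near \oo,
    ip mu (fun x => f_ n x - f x) (fun x => f_ n x - f x) < e.
Proof.
move=> mf_ lg fg cf.
have mf : measurable_fun setT f.
  by apply: (measurable_fun_cvg (h := f_)) => // x _; exact: cf.
have fg' x : `|f x| <= `|g x|.
  have h : `|f_ n x| @[n --> \oo] --> `|f x| by apply: cvg_norm; exact: cf.
  by apply: (cvgr_to_le h); apply: nearW.
have lf : L2 mu f by exact: (L2_le mf lg fg').
split => // e e0.
have lg4 : integr mu (fun x => 4 * g x ^+ 2) by apply: integrZ; case: lg.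
have dom n x : ((f_ n x - f x) ^+ 2) <= 4 * g x ^+ 2.
  rewrite -(real_normK (num_real (g x))) -(real_normK (num_real (f_ n x - f x))).
  rewrite (le_trans (y := (`|g x| + `|g x|) ^+ 2))//; last by rewrite le_eqVlt; apply/orP; left; apply/eqP; ring.
  rewrite lerXn2r ?nnegrE// ?addr_ge0// (le_trans (ler_normB _ _))//; exact: lerD.
have c0 x : (f_ n x - f x) ^+ 2 @[n --> \oo] --> (0 : R).
  rewrite (_ : 0 = (f x - f x) * (f x - f x)); last by rewrite subrr mul0r.
  under eq_fun do rewrite expr2.
  by apply: cvgM; (apply: cvgB; [exact: cf|exact: cvg_cst]).
have mh n : measurable_fun setT (fun x => ((f_ n x - f x) ^+ 2)%:E).
  by apply/measurable_EFinP/measurable_funX/measurable_funB.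
have := @dominated_convergence _ _ _ mu setT measurableT
  (fun n x => ((f_ n x - f x) ^+ 2)%:E) (fun=> 0%E) _ mh (measurable_cst _) _ lg4 _.
case.
- by apply: aeW => x _; apply: cvg_EFin; [exact: nearW|exact: c0].
- by apply: aeW => x n _ /=; rewrite lee_fin ger0_norm ?sqr_ge0.
move=> _ _; rewrite integral0 => /fine_cvgP[_] /cvgrPdist_lt /(_ _ e0).
apply: filterS => n; rewrite sub0r normrN /= => h.
by rewrite (le_lt_trans _ h)// /ip /Rintegral; under eq_integral do rewrite -expr2; exact: ler_norm.
Qed.

End L2cvg.

Import HBNNSimple.

(** * Convergence of averages *)

(* L^2 functions are shown to be continuous in the mean with respect to
   averaging kernels rho_n without using that continuous functions are dense:
   the mean-continuous functions are stable under linear combinations and L^2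
   limits, so by Dynkin's lemma it is enough that they contain the indicators of
   a pi-system generating the sigma-algebra, multiplied by a positive weight. *)
Section Energy.
Context d (T : measurableType d) (R : realType) (mu : {sigma_finite_measure set T -> \bar R}).
Context (rho : nat -> T -> T -> R) (C : nat -> R).
Hypothesis mrho : forall n, measurable_fun setT (fun z : T * T => rho n z.1 z.2).
Hypothesis rho0 : forall n p q, 0 <= rho n p q.
Hypothesis rhoC : forall n p q, rho n p q <= C n.
Hypothesis rho1 : forall n p, (\int[mu]_q (rho n p q)%:E = 1%:E)%E.
Hypothesis rho1' : forall n q, (\int[mu]_p (rho n p q)%:E = 1%:E)%E.
Implicit Types f g h : T -> R.

Definition vanish (u : nat -> \bar R) := forall e : R, 0 < e -> \forall n \near \oo, (u n <= e%:E)%E.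
(** By Cauchy-Schwarz it dominates the squared L2 distance from [f] to its average by [rho n].
    Unlike that distance it is an integral of a nonnegative function of (p, q), to which Tonelli
    applies directly. *)
Definition energy n f := (\int[mu]_p \int[mu]_q (rho n p q * (f q - f p) ^+ 2)%:E)%E.
Definition mean_cont f := L2 mu f /\ vanish (energy ^~ f).

Lemma measurable_integrand n f : measurable_fun setT f ->
  measurable_fun setT (fun z : T * T => (rho n z.1 z.2 * (f z.2 - f z.1) ^+ 2)%:E).
Proof.
move=> mf; apply/measurable_EFinP/measurable_funM => //.
by apply/measurable_funX/measurable_funB; exact: measurableT_comp.
Qed.

Lemma integrand_ge0 n f (z : T * T) : (0 <= (rho n z.1 z.2 * (f z.2 - f z.1) ^+ 2)%:E)%E.
Proof. by rewrite lee_fin mulr_ge0 ?sqr_ge0. Qed.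

Lemma energyE n f : measurable_fun setT f ->
  (energy n f = \int[mu \x mu]_z (rho n z.1 z.2 * (f z.2 - f z.1) ^+ 2)%:E)%E.
Proof.
move=> mf; rewrite fubini_tonelli1//; first exact: measurable_integrand.
exact: integrand_ge0.
Qed.

Lemma energy_comb n f g h (a b : R) : measurable_fun setT f -> measurable_fun setT g ->
  measurable_fun setT h -> 0 <= a -> 0 <= b ->
  (forall p q, (f q - f p) ^+ 2 <= a * (g q - g p) ^+ 2 + b * (h q - h p) ^+ 2) ->
  (energy n f <= a%:E * energy n g + b%:E * energy n h)%E.
Proof.
move=> mf mg mh a0 b0 fgh; rewrite !energyE//.
have mZ (c : R) (k : T -> R) : 0 <= c -> measurable_fun setT k ->
  measurable_fun setT (fun z : T * T => c%:E * (rho n z.1 z.2 * (k z.2 - k z.1) ^+ 2)%:E)%E.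
  by move=> c0 mk; apply: measurable_funeM; exact: measurable_integrand.
rewrite -ge0_integralZl//; [|exact: measurable_integrand|by move=> z _; exact: integrand_ge0].
rewrite -ge0_integralZl//; [|exact: measurable_integrand|by move=> z _; exact: integrand_ge0].
rewrite -ge0_integralD//; [|by move=> z _; apply: mule_ge0 => //; exact: integrand_ge0|exact: mZ
  |by move=> z _; apply: mule_ge0 => //; exact: integrand_ge0|exact: mZ].
apply: ge0_le_integral => //.
- by move=> z _; exact: integrand_ge0.
- exact: measurable_integrand.
- by apply: emeasurable_funD; exact: mZ.
- move=> z _; rewrite -!EFinM -EFinD lee_fin.
  have := ler_wpM2l (rho0 n z.1 z.2) (fgh z.1 z.2); move/le_trans; apply.
  by rewrite le_eqVlt; apply/orP; left; apply/eqP; ring.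
Qed.

(** A squared increment is at most 2 f(q)^2 + 2 f(p)^2, and both marginals of [rho n] are 1. The
    bound is uniform in [n], which is what carries mean continuity over to L2 limits. *)
Lemma energy_le n f : L2 mu f -> (energy n f <= (4 * ip mu f f)%:E)%E.
Proof.
move=> lf; have [mf fi] := lf.
have m1 : measurable_fun setT (fun z : T * T => (rho n z.1 z.2 * f z.2 ^+ 2)%:E).
  by apply/measurable_EFinP/measurable_funM => //; apply/measurable_funX; exact: measurableT_comp.
have m2 : measurable_fun setT (fun z : T * T => (rho n z.1 z.2 * f z.1 ^+ 2)%:E).
  by apply/measurable_EFinP/measurable_funM => //; apply/measurable_funX; exact: measurableT_comp.
have p1 (z : T * T) : (0 <= (rho n z.1 z.2 * f z.2 ^+ 2)%:E)%E by rewrite lee_fin mulr_ge0 ?sqr_ge0.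
have p2 (z : T * T) : (0 <= (rho n z.1 z.2 * f z.1 ^+ 2)%:E)%E by rewrite lee_fin mulr_ge0 ?sqr_ge0.
have i1 : (\int[mu \x mu]_z (rho n z.1 z.2 * f z.2 ^+ 2)%:E = (ip mu f f)%:E)%E.
  by rewrite fubini_tonelli1// (GsqrE (mrho n) (rho0 n) (rho1 n) (rho1' n) mf) mul1e ip_fin.
have i2 : (\int[mu \x mu]_z (rho n z.1 z.2 * f z.1 ^+ 2)%:E = (ip mu f f)%:E)%E.
  rewrite fubini_tonelli1// -ip_fin//; apply: eq_integral => p _; rewrite /fubini_F/=.
  under eq_integral do rewrite EFinM muleC.
  rewrite ge0_integralZl// ?rho1 ?mule1//.
  - exact/measurable_EFinP/measurable_section.
  - by move=> q _; rewrite lee_fin.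
  - by rewrite lee_fin sqr_ge0.
rewrite energyE//.
apply: (@le_trans _ _ (2%:E * \int[mu \x mu]_z (rho n z.1 z.2 * f z.2 ^+ 2)%:E +
  2%:E * \int[mu \x mu]_z (rho n z.1 z.2 * f z.1 ^+ 2)%:E)%E); last first.
  by rewrite i1 i2 -!EFinM -EFinD lee_fin; lra.
rewrite -!ge0_integralZl// -ge0_integralD//; [|by move=> z _; exact: mule_ge0|exact: measurable_funeM
  |by move=> z _; exact: mule_ge0|exact: measurable_funeM].
apply: ge0_le_integral => //.
- by move=> z _; exact: integrand_ge0.
- exact: measurable_integrand.
- by apply: emeasurable_funD; exact: measurable_funeM.
- move=> z _; rewrite -!EFinM -EFinD lee_fin.
  have h : (f z.2 - f z.1) ^+ 2 <= 2 * f z.2 ^+ 2 + 2 * f z.1 ^+ 2.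
    by have := sqr_ge0 (f z.2 + f z.1); nra.
  have := ler_wpM2l (rho0 n z.1 z.2) h; move/le_trans; apply.
  by rewrite le_eqVlt; apply/orP; left; apply/eqP; ring.
Qed.

Lemma vanish_comb u v w a b : 0 <= a -> 0 <= b -> (forall n, (0 <= v n)%E) -> (forall n, (0 <= w n)%E) ->
  vanish v -> vanish w ->
  (forall n, (u n <= a%:E * v n + b%:E * w n)%E) -> vanish u.
Proof.
move=> a0 b0 v0 w0 hv hw uvw e e0.
have e'0 : 0 < e / (a + b + 1) by rewrite divr_gt0// ltr_wpDl// addr_ge0.
move: (hv _ e'0) (hw _ e'0); apply: filterS2 => n vn wn.
apply: (le_trans (uvw n)).
apply: (@le_trans _ _ (a%:E * (e / (a + b + 1))%:E + b%:E * (e / (a + b + 1))%:E)%E).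
  by apply: leeD; apply: lee_pmul => //; rewrite lee_fin.
rewrite -!EFinM -EFinD lee_fin -mulrDl mulrCA ler_piMr ?(ltW e0)//.
by rewrite ler_pdivrMr ?mul1r ?lerDl// ltr_wpDl// addr_ge0.
Qed.

Lemma energy_ge0 n f : (0 <= energy n f)%E.
Proof. by do 2 apply: integral_ge0 => ? _; rewrite lee_fin mulr_ge0 ?sqr_ge0. Qed.

Lemma mean_cont_comb f g a b : mean_cont f -> mean_cont g -> mean_cont (fun x => a * f x + b * g x).
Proof.
move=> [lf vf] [lg vg].
have l : L2 mu (fun x => a * f x + b * g x) by apply: L2D; exact: L2Z.
split; first exact: l.
have c0 c : 0 <= 2 * c ^+ 2 :> R by apply: mulr_ge0 => //; exact: sqr_ge0.
apply: (vanish_comb (c0 a) (c0 b) _ _ vf vg) => n; try exact: energy_ge0.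
apply: energy_comb => //; [by case: l|by case: lf|by case: lg|].
move=> p q; have := sqr_ge0 (a * (f q - f p) - b * (g q - g p)); nra.
Qed.

Lemma mean_cont_approx f : L2 mu f ->
  (forall e : R, 0 < e -> exists2 g, mean_cont g & ip mu (fun x => g x - f x) (fun x => g x - f x) < e) ->
  mean_cont f.
Proof.
move=> lf H; split; first exact: lf. move=> e e0.
(* The two shares add up to e: 2 (e / 4) from [g], and 2 (4 e / 16) from the difference, where the 4
   comes from [energy_le]. *)
have e16 : 0 < e / 16 by rewrite divr_gt0.
have [g [lg vg] gf] := H _ e16.
have e4 : 0 < e / 4 by rewrite divr_gt0.
apply: filterS (vg _ e4) => n vn.
have lgf := L2B lg lf.
apply: (@le_trans _ _ (2%:E * energy n g + 2%:E * energy n (fun x => (g x - f x)%R))%E).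
  apply: energy_comb => //; [by case: lf|by case: lg|by case: lgf|].
  by move=> p q; have := sqr_ge0 ((g q - g p) + ((g q - f q) - (g p - f p))); nra.
apply: (@le_trans _ _ (2%:E * (e / 4)%:E + 2%:E * (4 * (e / 16))%:E)%E).
  apply: leeD; apply: lee_pmul => //; rewrite ?energy_ge0//.
  by rewrite (le_trans (energy_le n lgf))// lee_fin ler_wpM2l// ltW.
by rewrite -!EFinM -EFinD lee_fin; lra.
Qed.

Lemma mean_cont_ext f g : mean_cont f -> f =1 g -> mean_cont g.
Proof. by move=> gf fg; rewrite -(funext fg). Qed.

Lemma good0 : mean_cont (fun=> 0).
Proof.
split; first exact: L2_0.
move=> e e0; apply: nearW => n; rewrite /energy.
under eq_integral do under eq_integral do rewrite subrr expr0n mulr0.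
by rewrite integral0_eq ?lee_fin ?ltW// => p _; rewrite integral0_eq.
Qed.

Lemma mean_cont_sum (I : Type) (s : seq I) (F : I -> T -> R) :
  (forall i, mean_cont (F i)) -> mean_cont (fun x => \sum_(i <- s) F i x).
Proof.
move=> gF; elim: s => [|i s IH].
  by apply: (mean_cont_ext good0) => x; rewrite big_nil.
apply: (mean_cont_ext (mean_cont_comb 1 1 (gF i) IH)) => x.
by rewrite big_cons !mul1r.
Qed.

Lemma mean_cont_dominated (f_ : nat -> T -> R) f g : (forall n, mean_cont (f_ n)) -> L2 mu g ->
  (forall n x, `|f_ n x| <= `|g x|) -> (forall x, f_ n x @[n --> \oo] --> f x) -> mean_cont f.
Proof.
move=> gf lg fg cf.
have mf n : measurable_fun setT (f_ n) by case: (gf n) => -[].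
have [lf H] := L2_dominated mf lg fg cf.
apply: mean_cont_approx; first exact: lf. move=> e e0; have [n _ h] := H e e0.
by exists (f_ n) => //; exact: (h n (leqnn n)).
Qed.

Context (w : T -> R) (Gs : set (set T)).
Hypothesis w_gt0 : forall x, 0 < w x.
Hypothesis mean_cont_w : mean_cont w.
Hypothesis GsE : @measurable _ T = <<s Gs >>.
Hypothesis GsI : setI_closed Gs.
Hypothesis mean_cont_Gs : forall A, Gs A -> mean_cont (fun x => \1_A x * w x).

(** The weight keeps every indicator in L2 although [mu] may be infinite. Complements amount to
    subtracting from [w], and disjoint unions to a limit of partial sums dominated by [w]. *)
Lemma mean_cont_indic A : measurable A -> mean_cont (fun x => \1_A x * w x).
Proof.
have lw : L2 mu w by case: mean_cont_w.
rewrite GsE; apply: (dynkin_induction (P := fun A => mean_cont (fun x => \1_A x * w x)) GsE GsI).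
- by apply: (mean_cont_ext mean_cont_w) => x; rewrite indicT mul1r.
- exact: mean_cont_Gs.
- move=> S _ gS; apply: (mean_cont_ext (mean_cont_comb 1 (-1) mean_cont_w gS)) => x.
  by rewrite !indicE in_setC; case: (x \in S) => /=; ring.
- move=> F mF tF gF.
  pose S n x := \sum_(k <- iota 0 n) \1_(F k) x * w x.
  (* By disjointness a point lies in one [F i] at most, so the partial sum at it jumps from 0 to
     [w x] once the index [i] is included. *)
  have SE n x i : F i x -> S n x = (i < n)%N%:R * w x.
    move=> Fi; rewrite /S -big_distrl /=; congr (_ * _).
    have -> : \sum_(k <- iota 0 n) \1_(F k) x = \sum_(0 <= k < n) (k == i)%:R :> R.
      rewrite /index_iota subn0; apply: eq_bigr => k _; rewrite indicE; congr (_%:R); congr nat_of_bool.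
      apply/idP/eqP => [/set_mem Fk|->]; last exact: mem_set.
      by apply: (tF k i) => //; exists x.
    elim: n => [|n IH]; first by rewrite big_nil ltn0.
    rewrite big_nat_recr//= IH ltnS [n == i]eq_sym.
    by case: (ltngtP i n) => _ /=; rewrite ?addr0 ?add0r.
  have S0 n x : ~ (exists i, F i x) -> S n x = 0.
    move=> nF; rewrite /S big1// => k _; rewrite indicE memNset ?mul0r// => Fk.
    by apply: nF; exists k.
  apply: (mean_cont_dominated (f_ := S) _ lw).
  + by move=> n; exact: mean_cont_sum.
  + move=> n x; have [[i Fi]|nF] := pselect (exists i, F i x).
      rewrite (SE n x i Fi) normrM ler_piMl// normr_nat.
      by case: (i < n)%N.
    by rewrite S0// normr0.
  + move=> x; have [[i Fi]|nF] := pselect (exists i, F i x).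
      rewrite indicE mem_set ?mul1r; last by exists i.
      apply: cvg_near_cst; exists i.+1 => // n /= ltin.
      by rewrite (SE n x i Fi) ltin mul1r.
    rewrite indicE memNset ?mul0r; last by move=> [i _ Fi]; apply: nF; exists i.
    by apply: cvg_near_cst; apply: nearW => n; exact: S0.
Qed.

(** Simple functions increasing to [f / w], multiplied back by [w], are combinations of weighted
    indicators; they converge to [f] and are dominated by it. *)
Lemma mean_cont_ge0 f : L2 mu f -> (forall x, 0 <= f x) -> mean_cont f.
Proof.
move=> lf f0; have [mf _] := lf.
have mw : measurable_fun setT w by case: mean_cont_w => -[].
have mh : measurable_fun setT (fun x => (f x / w x)%:E).
  apply/measurable_EFinP/measurable_funM => //.
  apply: (measurable_comp (F := [set x : R | x != 0])) => //.
  - by apply: open_measurable; exact: open_neq.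
  - by move=> _ [x _ <-] /=; rewrite gt_eqF.
  - apply: open_continuous_measurable_fun; first exact: open_neq.
    by move=> x /set_mem /= x0; exact: inv_continuous.
have h0 x : setT x -> (0 <= (f x / w x)%:E)%E by move=> _; rewrite lee_fin divr_ge0// ltW.
pose g := nnsfun_approx measurableT mh.
have gc x : g n x @[n --> \oo] --> f x / w x.
  by have := cvg_nnsfun_approx measurableT mh h0 (I : setT x); move/fine_cvg.
have gle n x : g n x <= f x / w x.
  rewrite -(cvg_lim _ (gc x))//; apply: nondecreasing_cvgn_le; last by apply: cvgP (gc x).
  by move=> a b ab; exact/lefP/nd_nnsfun_approx.
apply: (mean_cont_dominated (f_ := fun n x => g n x * w x) (g := f) _ lf).
- move=> n.
  have gF y : mean_cont (fun x => y * (\1_(g n @^-1` [set y]) x * w x)).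
    have mS : measurable (g n @^-1` [set y]) by exact: measurable_sfunP.
    by apply: (mean_cont_ext (mean_cont_comb y 0 (mean_cont_indic mS) mean_cont_w)) => x; rewrite mul0r addr0.
  have H := mean_cont_sum (finmap.enum_fset (fset_set (range (g n)))) gF.
  apply: (mean_cont_ext H) => x.
  rewrite fimfunE fsbig_finite//= big_distrl/=.
  by apply: eq_bigr => y _; rewrite mulrA.
- move=> n x; have gw0 : 0 <= g n x * w x by apply: mulr_ge0; [exact: fun_ge0|exact: ltW].
  by rewrite ger0_norm// ger0_norm// -ler_pdivlMr.
- move=> x; rewrite -[f x](@divfK _ (w x)) ?gt_eqF//.
  by apply: cvgM; [exact: gc|exact: cvg_cst].
Qed.

Lemma goodT f : L2 mu f -> mean_cont f.
Proof.
move=> lf; have [mf _] := lf.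
have mP : measurable_fun setT (fun x => Num.max (f x) 0) by exact: measurable_maxr.
have mN : measurable_fun setT (fun x => Num.max (- f x) 0).
  by apply: measurable_maxr => //; exact: measurableT_comp.
have gP : mean_cont (fun x => Num.max (f x) 0).
  apply: mean_cont_ge0 => [|x]; last by rewrite le_max lexx orbT.
  apply: (L2_le mP lf) => x; case: (leP (f x) 0) => h; rewrite ?normr0//.
have gN : mean_cont (fun x => Num.max (- f x) 0).
  apply: mean_cont_ge0 => [|x]; last by rewrite le_max lexx orbT.
  by apply: (L2_le mN lf) => x; case: (leP (- f x) 0) => h; rewrite ?normr0// normrN.
apply: (mean_cont_ext (mean_cont_comb 1 (-1) gP gN)) => x.
by case: (leP (f x) 0) => h; case: (leP (- f x) 0) => h'; lra.
Qed.

End Energy.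

(** * Gaussian kernels on the plane *)

Section Gauss.
Context (R : realType).
Implicit Types (a b c x y : R).
Notation leb := (@lebesgue_measure R).

Definition gauss c x x' := expR (- c * (x' - x) ^+ 2).
(** The integral of [gauss c x] over the line, see [gauss_int]. *)
Definition gauss_mass c : R := Num.sqrt (pi / c).

Lemma gauss_mass_gt0 c : 0 < c -> 0 < gauss_mass c.
Proof. by move=> c0; rewrite sqrtr_gt0 divr_gt0// pi_gt0. Qed.

Lemma gauss_ge0 c x x' : 0 <= gauss c x x'.
Proof. exact: expR_ge0. Qed.

Lemma gauss_le1 c x x' : 0 < c -> gauss c x x' <= 1.
Proof. by move=> c0; rewrite -expR0 ler_expR mulNr oppr_le0 mulr_ge0 ?sqr_ge0// ltW. Qed.

Lemma gauss_sym c x x' : gauss c x x' = gauss c x' x.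
Proof. by rewrite /gauss -sqrrN opprB. Qed.

Lemma measurable_gauss d (T : measurableType d) c (f g : T -> R) :
  measurable_fun setT f -> measurable_fun setT g ->
  measurable_fun setT (fun t => gauss c (f t) (g t)).
Proof.
move=> mf mg; apply: (measurableT_comp (@measurable_expR R)).
by apply: measurable_funM => //; apply/measurable_funX/measurable_funB.
Qed.

Lemma gauss_int c x : 0 < c -> (\int[leb]_x' (gauss c x x')%:E = (gauss_mass c)%:E)%E.
Proof.
(* The standard deviation of the normal law whose density is proportional to [gauss c x]. *)
move=> c0; pose s := Num.sqrt ((2 * c)^-1).
have c2 : 0 < (2 * c)^-1 by rewrite invr_gt0 mulr_gt0.
have s0 : s != 0 by rewrite gt_eqF// sqrtr_gt0.
have s2 : s ^+ 2 = (2 * c)^-1 by rewrite sqr_sqrtr// ltW.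
have E x' : normal_pdf x s x' = (gauss_mass c)^-1 * gauss c x x'.
  rewrite normal_pdfE// /normal_peak /normal_fun /gauss_mass /gauss s2; congr (_^-1 * expR _).
    by congr Num.sqrt; rewrite -mulr_natl; field; rewrite gt_eqF.
  by rewrite -mulr_natl; field; rewrite gt_eqF.
have := integral_normal_pdf x s; under eq_integral do rewrite E EFinM.
rewrite ge0_integralZl//; last 3 first.
- by apply/measurable_EFinP; exact: measurable_gauss.
- by move=> x' _; rewrite lee_fin gauss_ge0.
- by rewrite lee_fin invr_ge0 ltW// gauss_mass_gt0.
move/(congr1 (fun z => (gauss_mass c)%:E * z)%E); rewrite mule1 muleA -EFinM mulfV ?mul1e//.
by rewrite gt_eqF// gauss_mass_gt0.
Qed.

Lemma expR_sqr_bound (t : R) : `|t| <= expR (t ^+ 2 / 2).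
Proof.
apply: le_trans (expR_ge1Dx _).
rewrite -(real_normK (num_real t)); have := sqr_ge0 (`|t| - 1); nra.
Qed.

(** Half of the exponent absorbs the factor [t], by |y| <= exp(y^2 / 2) at y = t sqrt c. The
    explicit constant 1 / sqrt c is the source of every rate of convergence below. *)
Lemma abs_gauss_sharp c (t : R) : 0 < c ->
  `|t| * expR (- c * t ^+ 2) <= (Num.sqrt c)^-1 * expR (- (c / 2) * t ^+ 2).
Proof.
move=> c0; have s0 : 0 < Num.sqrt c by rewrite sqrtr_gt0.
have h := expR_sqr_bound (Num.sqrt c * t).
rewrite normrM (gtr0_norm s0) exprMn (sqr_sqrtr (ltW c0)) in h.
have -> : expR (- c * t ^+ 2) = expR (- (c * t ^+ 2 / 2)) * expR (- (c / 2) * t ^+ 2).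
  by rewrite -expRD; congr expR; field.
rewrite mulrA ler_wpM2r ?expR_ge0// expRN -ler_pdivlMr ?invr_gt0 ?expR_gt0// invrK.
by rewrite mulrC ler_pdivlMr// mulrC.
Qed.

(** Each power of [t] uses up half of the remaining rate, hence an induction with [c]
    generalised. *)
Lemma abs_gauss_pow c n : 0 < c -> exists2 C : R, 0 <= C & forall t : R, `|t| ^+ n * expR (- c * t ^+ 2) <= C.
Proof.
elim: n c => [|n IH] c c0.
  exists 1 => // t; rewrite mul1r -expR0 ler_expR mulNr oppr_le0.
  exact: mulr_ge0 (ltW c0) (sqr_ge0 _).
have c2 : 0 < c / 2 by rewrite divr_gt0.
have [C C0 HC] := IH _ c2.
have s0 : 0 <= (Num.sqrt (c / 2))^-1 by rewrite invr_ge0 sqrtr_ge0.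
exists (C * (Num.sqrt (c / 2))^-1); first exact: mulr_ge0.
move=> t; have -> : `|t| ^+ n.+1 * expR (- c * t ^+ 2) =
    (`|t| ^+ n * expR (- (c / 2) * t ^+ 2)) * (`|t| * expR (- (c / 2) * t ^+ 2)).
  have -> : expR (- c * t ^+ 2) = expR (- (c / 2) * t ^+ 2) * expR (- (c / 2) * t ^+ 2).
    by rewrite -expRD; congr expR; field.
  by rewrite exprSr; ring.
apply: ler_pM => //; rewrite ?mulr_ge0 ?exprn_ge0 ?expR_ge0//.
apply: (le_trans (abs_gauss_sharp t c2)).
rewrite ler_piMr// -[leRHS]expR0 ler_expR mulNr oppr_le0.
exact: mulr_ge0 (ltW (divr_gt0 c2 _)) (sqr_ge0 _).
Qed.

(** One-dimensional factor of the mollifier kernel (a cutoff in [x], a Gaussian in [x' - x]) times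
    monomials. Up to linear combinations the family is stable under multiplication by [x] or [x']
    and under derivation in either variable. *)
Definition mgauss a b (i k : nat) x x' :=
  x ^+ i * (x' - x) ^+ k * expR (- a * x ^+ 2) * gauss b x x'.

Lemma measurable_mgauss d (T : measurableType d) a b i k (f g : T -> R) :
  measurable_fun setT f -> measurable_fun setT g ->
  measurable_fun setT (fun t => mgauss a b i k (f t) (g t)).
Proof.
move=> mf mg; apply: measurable_funM; last exact: measurable_gauss.
apply: measurable_funM.
  by apply: measurable_funM; apply/measurable_funX => //; exact: measurable_funB.
apply: (measurableT_comp (@measurable_expR R)).
by apply: measurable_funM => //; exact/measurable_funX.
Qed.

(** The cutoff absorbs the power of [x], one half of the Gaussian absorbs the power of [x' - x], and
    the other half remains as a majorant fit for Schur's test. *)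
Lemma mgauss_bound a b i k : 0 < a -> 0 < b ->
  exists2 C : R, 0 <= C & forall x x', `|mgauss a b i k x x'| <= C * gauss (b / 2) x x'.
Proof.
move=> a0 b0; have b2 : 0 < b / 2 by rewrite divr_gt0.
have [C C0 HC] := abs_gauss_pow i a0.
have [D D0 HD] := abs_gauss_pow k b2.
exists (C * D); first exact: mulr_ge0.
move=> x x'; rewrite /mgauss.
have -> : gauss b x x' = gauss (b / 2) x x' * gauss (b / 2) x x'.
  by rewrite /gauss -expRD; congr expR; field.
rewrite mulrA normrM (ger0_norm (gauss_ge0 _ _ _)) ler_wpM2r ?gauss_ge0//.
rewrite !normrM !normrX !(ger0_norm (expR_ge0 _)).
have -> : `|x| ^+ i * `|x' - x| ^+ k * expR (- a * x ^+ 2) * gauss (b / 2) x x' =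
  (`|x| ^+ i * expR (- a * x ^+ 2)) * (`|x' - x| ^+ k * gauss (b / 2) x x') by ring.
by apply: ler_pM; rewrite ?HC ?HD// mulr_ge0 ?exprn_ge0 ?expR_ge0.
Qed.

Lemma mgauss_shift a b i k x x' : x' * mgauss a b i k x x' = mgauss a b i.+1 k x x' + mgauss a b i k.+1 x x'.
Proof. by rewrite /mgauss !exprS; ring. Qed.

Lemma mgauss_mulx a b i k n x x' : x ^+ n * mgauss a b i k x x' = mgauss a b (n + i) k x x'.
Proof. by rewrite /mgauss exprD !mulrA. Qed.

(** Each factor [x'] is written x + (x' - x), which raises one of the two exponents. This is decay
    in the integration variable, needed for the kernel to be a test function. *)
Lemma mgauss_bound_x' a b i k n : 0 < a -> 0 < b ->
  exists2 C : R, 0 <= C & forall x x', `|x' ^+ n * mgauss a b i k x x'| <= C.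
Proof.
move=> a0 b0; elim: n i k => [|n IH] i k.
  have [C C0 HC] := mgauss_bound i k a0 b0; exists C => // x x'; rewrite mul1r.
  by apply: (le_trans (HC x x')); rewrite ler_piMr// gauss_le1// divr_gt0.
have [C C0 HC] := IH i.+1 k; have [D D0 HD] := IH i k.+1.
exists (C + D); first exact: addr_ge0.
move=> x x'; rewrite exprSr -mulrA mgauss_shift mulrDr.
by apply: (le_trans (ler_normD _ _)); exact: lerD.
Qed.

Lemma is_derive_tr (f g : R -> R) (x df dg : R) : is_derive x 1 f df -> f =1 g -> df = dg ->
  is_derive x 1 g dg.
Proof. by move=> h fg <-; rewrite -(funext fg). Qed.

Lemma is_derive_pow (f : R -> R) n x df : is_derive x 1 f df ->
  is_derive x 1 (fun x => f x ^+ n) (n%:R * f x ^+ n.-1 * df).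
Proof. by move=> h; have := is_deriveX n h; rewrite exprfctE. Qed.

Lemma is_derive_mul (f g : R -> R) x df dg : is_derive x 1 f df -> is_derive x 1 g dg ->
  is_derive x 1 (fun x => f x * g x) (f x * dg + g x * df).
Proof. by move=> h h'; exact: is_deriveM. Qed.

Lemma is_derive_exp (f : R -> R) x df : is_derive x 1 f df ->
  is_derive x 1 (fun x => expR (f x)) (expR (f x) * df).
Proof. by move=> h; exact: (is_derive1_comp (is_derive_expR (f x)) h). Qed.

Lemma is_derive_csub (y x : R) : is_derive x 1 (fun x => y - x) (-1).
Proof.
by apply: (is_derive_tr (is_deriveB (is_derive_cst y x 1) (is_derive_id x 1))) => //; rewrite sub0r.
Qed.

Lemma is_derive_subc (y x : R) : is_derive x 1 (fun x => x - y) 1.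
Proof.
by apply: (is_derive_tr (is_deriveB (is_derive_id x 1) (is_derive_cst y x 1))) => //; rewrite subr0.
Qed.

Lemma is_derive_gauss b x x' : is_derive x 1 (fun x => gauss b x x') (2 * b * (x' - x) * gauss b x x').
Proof.
apply: (is_derive_tr (is_derive_exp (is_derive_mul (is_derive_cst (- b) x 1) (is_derive_pow 2 (is_derive_csub x' x))))) => //.
by rewrite /gauss /=; ring.
Qed.

(** At exponent 0 the predecessor is again 0; the coefficients [i%:R] and [k%:R] then vanish, so the
    formula holds without a case distinction. *)
Lemma is_derive_mgauss a b i k x x' : is_derive x 1 (fun x => mgauss a b i k x x')
  (i%:R * mgauss a b i.-1 k x x' - k%:R * mgauss a b i k.-1 x x'
   - 2 * a * mgauss a b i.+1 k x x' + 2 * b * mgauss a b i k.+1 x x').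
Proof.
have e1 := is_derive_pow i (is_derive_id x 1).
have e2 := is_derive_pow k (is_derive_csub x' x).
have e3 := is_derive_exp (is_derive_mul (is_derive_cst (- a) x 1) (is_derive_pow 2 (is_derive_id x 1))).
apply: (is_derive_tr (is_derive_mul (is_derive_mul (is_derive_mul e1 e2) e3) (is_derive_gauss b x x'))) => //.
by rewrite /mgauss /= !exprS; ring.
Qed.

Lemma is_derive_hk' a b i k x x' : is_derive x' 1 (mgauss a b i k x)
  (k%:R * mgauss a b i k.-1 x x' - 2 * b * mgauss a b i k.+1 x x').
Proof.
have e2 := is_derive_pow k (is_derive_subc x x').
have e4 : is_derive x' 1 (gauss b x) (- 2 * b * (x' - x) * gauss b x x').
  by apply: (is_derive_tr (is_derive_gauss b x' x)) => [y|]; rewrite gauss_sym//; ring.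
apply: (is_derive_tr (is_derive_mul (is_derive_mul (is_derive_mul (is_derive_cst (x ^+ i) x' 1) e2)
  (is_derive_cst (expR (- a * x ^+ 2)) x' 1)) e4)) => //.
by rewrite /mgauss /= !exprS; ring.
Qed.

End Gauss.

(** Products of the two exhausting sequences do the job; monotonicity allows a single index, the
    maximum of the two, to serve both coordinates. *)
Lemma product_measure_sigma_finite d1 d2 (T1 : measurableType d1) (T2 : measurableType d2) (R : realType)
 (m1 : {sigma_finite_measure set T1 -> \bar R}) (m2 : {sigma_finite_measure set T2 -> \bar R}) :
  sigma_finite setT (m1 \x m2)%E.
Proof.
have /sigma_finiteP[F [TF ndF Foo]] := sigma_finiteT m1.
have /sigma_finiteP[G [TG ndG Goo]] := sigma_finiteT m2.
exists (fun n => F n `*` G n).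
  rewrite -setXTT TF TG predeqE => -[x y]; split.
    move=> [/= [n _ Fnx] [k _ Gky]]; exists (maxn n k) => //; split.
    - by move: x Fnx; exact/subsetPset/ndF/leq_maxl.
    - by move: y Gky; exact/subsetPset/ndG/leq_maxr.
  by move=> [n _ []/= ? ?]; split; exists n.
move=> k; have [? ?] := Foo k; have [? ?] := Goo k.
split; first exact: measurableX.
by rewrite product_measure1E// lte_mul_pinfty// ge0_fin_numE.
Qed.

(* The sigma-finiteness of a product measure is not inferred by the library;
   [mu2s] is [mu2] equipped with this structure, and is convertible to it. *)
Section SigmaFiniteMeasure.
Context d (T : measurableType d) (R : realType) (m : {measure set T -> \bar R}) (hm : sigma_finite setT m).
Definition sfm := m : set T -> \bar R.
HB.instance Definition _ := Measure.copy sfm m.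
HB.instance Definition _ := Measure_isSigmaFinite.Build _ _ _ sfm hm.
Definition sfmeasure : {sigma_finite_measure set T -> \bar R} := sfm.
End SigmaFiniteMeasure.

Lemma mu2_sigma_finite (R : realType) : sigma_finite setT (mu2 R).
Proof. exact: product_measure_sigma_finite. Qed.

Definition mu2s (R : realType) := sfmeasure (@mu2_sigma_finite R).

(** * Gaussian averages of Lipschitz functions on the plane *)

Section Plane.
Context (R : realType).
Notation leb := (@lebesgue_measure R).
Notation M := (mu2s R).
Implicit Types (p q : R * R).

Lemma int2_tonelli (f : R * R -> \bar R) : measurable_fun setT f -> (forall p, (0 <= f p)%E) ->
  (\int[M]_p f p = \int[leb]_x \int[leb]_y f (x, y))%E.
Proof. by move=> mf f0; rewrite [LHS](_ : _ = \int[mu2 R]_p f p)%E// fubini_tonelli1. Qed.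

Lemma int2_prod (f g : R -> R) : measurable_fun setT f -> measurable_fun setT g ->
  (forall x, 0 <= f x) -> (forall x, 0 <= g x) ->
  (\int[M]_q (f q.1 * g q.2)%:E = (\int[leb]_x (f x)%:E) * (\int[leb]_x (g x)%:E))%E.
Proof.
move=> mf mg f0 g0.
rewrite int2_tonelli; last 2 first.
- by apply/measurable_EFinP/measurable_funM; exact: measurableT_comp.
- by move=> q; rewrite lee_fin mulr_ge0.
under eq_integral do under eq_integral do rewrite EFinM.
transitivity (\int[leb]_x ((f x)%:E * \int[leb]_y (g y)%:E))%E.
  apply: eq_integral => x _ /=; rewrite ge0_integralZl//.
  - exact/measurable_EFinP.
  - by move=> y _; rewrite lee_fin.
  - by rewrite lee_fin.
rewrite ge0_integralZr//=.
- exact/measurable_EFinP.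
- by move=> x _; rewrite lee_fin.
- by apply: integral_ge0 => y _; rewrite lee_fin.
Qed.

Definition gauss2 (c : R) p q := gauss c p.1 q.1 * gauss c p.2 q.2.

Lemma measurable_gauss2 c : measurable_fun setT (fun z : (R * R) * (R * R) => gauss2 c z.1 z.2).
Proof.
by apply: measurable_funM; apply: measurable_gauss; (apply: measurableT_comp => //; exact: measurable_fst || exact: measurable_snd).
Qed.

Lemma gauss2_ge0 c p q : 0 <= gauss2 c p q.
Proof. by rewrite mulr_ge0 ?gauss_ge0. Qed.

Lemma gauss2_le1 c p q : 0 < c -> gauss2 c p q <= 1.
Proof. by move=> c0; rewrite mulr_ile1 ?gauss_ge0 ?gauss_le1. Qed.

Lemma gauss2_sym c p q : gauss2 c p q = gauss2 c q p.
Proof. by rewrite /gauss2 gauss_sym (gauss_sym _ p.2). Qed.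

Lemma int_gauss2 c p : 0 < c -> (\int[M]_q (gauss2 c p q)%:E = (gauss_mass c ^+ 2)%:E)%E.
Proof.
move=> c0; rewrite (int2_prod (f := gauss c p.1) (g := gauss c p.2)).
- by rewrite !gauss_int// -EFinM expr2.
- exact: measurable_gauss.
- exact: measurable_gauss.
- by move=> x; exact: gauss_ge0.
- by move=> x; exact: gauss_ge0.
Qed.

Lemma int_G2' c q : 0 < c -> (\int[M]_p (gauss2 c p q)%:E = (gauss_mass c ^+ 2)%:E)%E.
Proof. by move=> c0; under eq_integral do rewrite gauss2_sym; exact: int_gauss2. Qed.

(** In the plane, halving the rate doubles the mass: the price of each estimate that gives up half
    of the exponent. *)
Lemma gauss_mass_half (c : R) : 0 < c -> gauss_mass (c / 2) ^+ 2 = 2 * gauss_mass c ^+ 2.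
Proof.
move=> c0; have p0 := pi_gt0 R; rewrite /gauss_mass !sqr_sqrtr ?divr_ge0 ?ltW ?divr_gt0//.
by field; rewrite gt_eqF.
Qed.

(* A Lipschitz integrable positive weight. *)
Definition w1 (x : R) := (oneDsqr x)^-1.
Definition w2 p := w1 p.1 * w1 p.2.

Lemma w1_gt0 x : 0 < w1 x.
Proof. by rewrite invr_gt0 (lt_le_trans ltr01)// oneDsqr_ge1. Qed.

Lemma w1_le1 x : w1 x <= 1.
Proof. exact: oneDsqrV_le1. Qed.

Lemma measurable_w1 : measurable_fun setT w1.
Proof. by apply: continuous_measurable_fun; exact: continuous_oneDsqrV. Qed.

Lemma w1_int : (\int[leb]_x (w1 x)%:E = pi%:E)%E.
Proof.
rewrite ge0_symfun_integralT//; last 3 first.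
- by move=> x; rewrite ltW// w1_gt0.
- exact: continuous_oneDsqrV.
- by move=> x /=; rewrite /w1 /oneDsqr sqrrN.
have -> : [set x : R | 0 <= x] = `[0, +oo[%classic.
  by apply/seteqP; split => x /=; rewrite in_itv/= andbT.
by rewrite integral0y_oneDsqr -EFinM; congr (_%:E); field.
Qed.

Lemma w1_lip x x' : `|w1 x' - w1 x| <= `|x' - x|.
Proof.
have o0 z : 0 < oneDsqr z :> R by rewrite (lt_le_trans ltr01)// oneDsqr_ge1.
have -> : w1 x' - w1 x = (x - x') * ((x + x') * (w1 x * w1 x')).
  by rewrite /w1; move: (o0 x) (o0 x') => /lt0r_neq0 + /lt0r_neq0; rewrite /oneDsqr => h h'; field; rewrite h h'.
rewrite normrM distrC ler_piMr//.
rewrite ler_norml; have := w1_gt0 x; have := w1_gt0 x'; have := mulVf (lt0r_neq0 (o0 x)); have := mulVf (lt0r_neq0 (o0 x')).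
rewrite -/(w1 x) -/(w1 x') /oneDsqr; move: (w1 x) (w1 x') => u v hv hu v0 u0.
(* Since 2 |x| <= 1 + x^2, each of x u and x' v has modulus at most 1/2, which bounds (x + x') u v
   by 1. *)
have U : - 1 <= 2 * x * u <= 1.
  by have s1 := sqr_ge0 (x - 1); have s2 := sqr_ge0 (x + 1); apply/andP; split; nra.
have V : - 1 <= 2 * x' * v <= 1.
  by have s1 := sqr_ge0 (x' - 1); have s2 := sqr_ge0 (x' + 1); apply/andP; split; nra.
have u1 : u <= 1 by have := sqr_ge0 x; nra.
have v1 : v <= 1 by have := sqr_ge0 x'; nra.
by move: U V => /andP[? ?] /andP[? ?]; apply/andP; split; nra.
Qed.

Lemma w2_gt0 p : 0 < w2 p.
Proof. by rewrite mulr_gt0 ?w1_gt0. Qed.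

Lemma w2_le1 p : w2 p <= 1.
Proof. by rewrite mulr_ile1 ?w1_le1// ltW// w1_gt0. Qed.

Lemma measurable_w2 : measurable_fun setT w2.
Proof.
by apply: measurable_funM; apply: (measurableT_comp measurable_w1) => //; (exact: measurable_fst || exact: measurable_snd).
Qed.

Lemma w2_int : (\int[M]_p (w2 p)%:E = (pi ^+ 2)%:E)%E.
Proof.
rewrite (int2_prod (f := w1) (g := w1)) ?w1_int ?expr2//; try exact: measurable_w1.
  by move=> x; rewrite ltW// w1_gt0.
by move=> x; rewrite ltW// w1_gt0.
Qed.

Lemma w2_integr : integr M w2.
Proof.
apply: Rint_ge0_integr; first exact: measurable_w2.
  by move=> p; rewrite ltW// w2_gt0.
by rewrite w2_int ltry.
Qed.

Lemma L2_w2 : L2 M w2.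
Proof.
apply: (L2_bounded (C := 1) w2_integr) => p; rewrite ger0_norm ?w2_le1//.
by rewrite ltW// w2_gt0.
Qed.

Definition dist1 p q := `|q.1 - p.1| + `|q.2 - p.2|.

Lemma w2_lip p q : `|w2 q - w2 p| <= dist1 p q.
Proof.
have -> : w2 q - w2 p = (w1 q.1 - w1 p.1) * w1 q.2 + w1 p.1 * (w1 q.2 - w1 p.2) by rewrite /w2; ring.
apply: (le_trans (ler_normD _ _)); rewrite !normrM !(gtr0_norm (w1_gt0 _)).
apply: lerD.
  by rewrite (le_trans _ (w1_lip _ _))// ler_piMr// w1_le1.
by rewrite (le_trans _ (w1_lip _ _))// ler_piMl// w1_le1.
Qed.

Definition rays2 : set (set (R * R)) :=
  [set A | exists s t, A = [set p : R * R | p.1 < s /\ p.2 < t]].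

Lemma rays2I : setI_closed rays2.
Proof.
move=> _ _ [s [t ->]] [s' [t' ->]]; exists (Num.min s s'), (Num.min t t').
apply/seteqP; split => p /=; rewrite !lt_min.
  by move=> [[-> ->] [-> ->]].
by move=> [/andP[-> ->] /andP[-> ->]].
Qed.

(** A half-plane is a countable union of quadrants, so both coordinates are measurable for the
    sigma-algebra generated by the quadrants, which therefore contains all measurable rectangles. *)
Lemma rays2E : @measurable _ (measurableTypeR R * measurableTypeR R)%type = <<s rays2 >>.
Proof.
apply/seteqP; split; last first.
  apply: smallest_sub; first exact: sigma_algebra_measurable.
  move=> _ [s [t ->]].
  rewrite (_ : [set p : R * R | _] = `]-oo, s[%classic `*` `]-oo, t[%classic); last first.
    by apply/seteqP; split => p /=; rewrite !in_itv/=.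
  by apply: measurableX; exact: measurable_itv.
have H1 : measurable_fun setT (fst : g_sigma_algebraType rays2 -> R).
  apply: (measurability _ (RGenInftyO.measurableE R)) => _ [_ [s ->] <-].
  rewrite setTI (_ : _ @^-1` _ = \bigcup_n [set p : R * R | p.1 < s /\ p.2 < n%:R]).
    by apply: bigcup_measurable => n _; apply: sub_sigma_algebra; exists s, n%:R.
  apply/seteqP; split => p /=; rewrite in_itv/=.
    move=> ps; exists (Num.bound `|p.2|) => //=; split => //.
    by rewrite (le_lt_trans (ler_norm _))// archi_boundP.
  by move=> [n _ []].
have H2 : measurable_fun setT (snd : g_sigma_algebraType rays2 -> R).
  apply: (measurability _ (RGenInftyO.measurableE R)) => _ [_ [s ->] <-].
  rewrite setTI (_ : _ @^-1` _ = \bigcup_n [set p : R * R | p.1 < n%:R /\ p.2 < s]).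
    by apply: bigcup_measurable => n _; apply: sub_sigma_algebra; exists n%:R, s.
  apply/seteqP; split => p /=; rewrite in_itv/=.
    move=> ps; exists (Num.bound `|p.1|) => //=; split => //.
    by rewrite (le_lt_trans (ler_norm _))// archi_boundP.
  by move=> [n _ []].
rewrite measurable_prod_measurableType; apply: smallest_sub; first exact: smallest_sigma_algebra.
move=> _ [A mA] [B mB] <-.
have -> : A `*` B = (setT `&` fst @^-1` A) `&` (setT `&` snd @^-1` B) by rewrite !setTI.
by apply: (@measurableI _ (g_sigma_algebraType rays2)); [exact: H1|exact: H2].
Qed.

(** The weights make this double integral finite, which the kernel alone would not be on the whole
    plane. By Tonelli and symmetry each weight contributes the same amount. *)
Lemma int_gauss2_weight c : 0 < c ->
  (\int[M]_p \int[M]_q (gauss2 c p q * (w2 p + w2 q))%:E = (2 * gauss_mass c ^+ 2 * pi ^+ 2)%:E)%E.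
Proof.
move=> c0.
have m1 p : measurable_fun setT (fun q => (gauss2 c p q * w2 p)%:E).
  apply/measurable_EFinP/measurable_funM => //.
  exact: (measurable_section (k := gauss2 c) (measurable_gauss2 c)).
have m2 p : measurable_fun setT (fun q => (gauss2 c p q * w2 q)%:E).
  apply/measurable_EFinP/measurable_funM; last exact: measurable_w2.
  exact: (measurable_section (k := gauss2 c) (measurable_gauss2 c)).
have E p : (\int[M]_q (gauss2 c p q * (w2 p + w2 q))%:E =
    (gauss_mass c ^+ 2 * w2 p)%:E + \int[M]_q (gauss2 c p q * w2 q)%:E)%E.
  under eq_integral do rewrite mulrDr EFinD.
  rewrite ge0_integralD//; last 4 first.
  - by move=> q _; rewrite lee_fin mulr_ge0 ?gauss2_ge0 ?ltW ?w2_gt0.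
  - exact: m1.
  - by move=> q _; rewrite lee_fin mulr_ge0 ?gauss2_ge0 ?ltW ?w2_gt0.
  - exact: m2.
  congr (_ + _)%E; under eq_integral do rewrite mulrC EFinM.
  rewrite ge0_integralZl// ?int_gauss2// -?EFinM 1?mulrC//.
  - apply/measurable_EFinP; exact: (measurable_section (k := gauss2 c) (measurable_gauss2 c)).
  - by move=> q _; rewrite lee_fin gauss2_ge0.
  - by rewrite lee_fin ltW// w2_gt0.
under eq_integral do rewrite E.
have mS : measurable_fun setT (fun z : (R * R) * (R * R) => (gauss2 c z.1 z.2 * w2 z.2)%:E).
  apply/measurable_EFinP/measurable_funM; first exact: measurable_gauss2.
  exact: (measurableT_comp measurable_w2).
have pS (z : (R * R) * (R * R)) : (0 <= (gauss2 c z.1 z.2 * w2 z.2)%:E)%E.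
  by rewrite lee_fin mulr_ge0 ?gauss2_ge0 ?ltW ?w2_gt0.
rewrite ge0_integralD//; last 4 first.
- by move=> p _; rewrite lee_fin mulr_ge0 ?sqr_ge0 ?ltW ?w2_gt0.
- by apply/measurable_EFinP/measurable_funM => //; exact: measurable_w2.
- by move=> p _; apply: integral_ge0 => q _; exact: (pS (p, q)).
- exact: (measurable_fun_fubini_tonelli_F (m2 := M) _ mS pS).
have -> : (\int[M]_p (gauss_mass c ^+ 2 * w2 p)%:E = (gauss_mass c ^+ 2 * pi ^+ 2)%:E)%E.
  under eq_integral do rewrite EFinM.
  rewrite ge0_integralZl// ?w2_int -?EFinM//.
  - by apply/measurable_EFinP; exact: measurable_w2.
  - by move=> p _; rewrite lee_fin ltW ?w2_gt0.
  - by rewrite lee_fin sqr_ge0.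
have -> : (\int[M]_p \int[M]_q (gauss2 c p q * w2 q)%:E = (gauss_mass c ^+ 2 * pi ^+ 2)%:E)%E.
  rewrite (fubini_tonelli (m1 := M) (m2 := M) _ mS pS) /=.
  transitivity (\int[M]_q ((gauss_mass c ^+ 2)%:E * (w2 q)%:E))%E.
    apply: eq_integral => q _; under eq_integral do rewrite mulrC EFinM.
    rewrite ge0_integralZl// ?int_G2'// 1?muleC//.
    - apply/measurable_EFinP; exact: (measurable_section2 (k := gauss2 c) (measurable_gauss2 c)).
    - by move=> p _; rewrite lee_fin gauss2_ge0.
    - by rewrite lee_fin ltW// w2_gt0.
  rewrite ge0_integralZl// ?w2_int -?EFinM//.
  - by apply/measurable_EFinP; exact: measurable_w2.
  - by move=> p _; rewrite lee_fin ltW ?w2_gt0.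
  - by rewrite lee_fin sqr_ge0.
by rewrite -EFinD; congr (_%:E); ring.
Qed.

(** Rates of Gaussians of standard deviation 1/(n+1) for the averaging kernel and n+1 for the
    cutoff. With this choice the two commutator errors, b^(-1/2) and 2 a^(1/2), are equal. *)
Definition heat_rate n : R := n.+1%:R ^+ 2 / 2.
Definition cutoff_rate n : R := (2 * n.+1%:R ^+ 2)^-1.
Definition heat n p q := (gauss_mass (heat_rate n) ^+ 2)^-1 * gauss2 (heat_rate n) p q.

Lemma heat_rate_gt0 n : 0 < heat_rate n.
Proof. by rewrite divr_gt0// exprn_gt0. Qed.

Lemma cutoff_rate_gt0 n : 0 < cutoff_rate n.
Proof. by rewrite invr_gt0 mulr_gt0// exprn_gt0. Qed.

Lemma measurable_heat n : measurable_fun setT (fun z : (R * R) * (R * R) => heat n z.1 z.2).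
Proof. by apply: measurable_funM => //; exact: measurable_gauss2. Qed.

Lemma VI2V_ge0 c : 0 <= (gauss_mass c ^+ 2)^-1 :> R.
Proof. by rewrite invr_ge0 sqr_ge0. Qed.

Lemma heat_ge0 n p q : 0 <= heat n p q.
Proof. by rewrite mulr_ge0 ?gauss2_ge0// VI2V_ge0. Qed.

Lemma heat_le n p q : heat n p q <= (gauss_mass (heat_rate n) ^+ 2)^-1.
Proof. by rewrite ler_piMr ?VI2V_ge0// gauss2_le1// heat_rate_gt0. Qed.

Lemma int_heat n p : (\int[M]_q (heat n p q)%:E = 1%:E)%E.
Proof.
under eq_integral do rewrite EFinM.
rewrite ge0_integralZl//; last 3 first.
- apply/measurable_EFinP; exact: (measurable_section (k := gauss2 _) (measurable_gauss2 _)).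
- by move=> q _; rewrite lee_fin gauss2_ge0.
- by rewrite lee_fin VI2V_ge0.
by rewrite int_gauss2 ?heat_rate_gt0// -EFinM mulVf// expf_neq0// gt_eqF// gauss_mass_gt0// heat_rate_gt0.
Qed.

Lemma int_rho' n q : (\int[M]_p (heat n p q)%:E = 1%:E)%E.
Proof. by rewrite -(int_heat n q); apply: eq_integral => p _; rewrite /heat gauss2_sym. Qed.

(** The distance is absorbed by halving the rate in the coordinate concerned, which gains a factor
    of order 1/n; in the other coordinate the rate is simply lowered. *)
Lemma heat_dist1 n p q : heat n p q * dist1 p q <=
  2 * (gauss_mass (heat_rate n) ^+ 2)^-1 * (Num.sqrt (heat_rate n))^-1 * gauss2 (heat_rate n / 2) p q.
Proof.
rewrite /heat; move: (heat_rate n) (heat_rate_gt0 n) => b b0.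
have h x x' : gauss b x x' * `|x' - x| <= (Num.sqrt b)^-1 * gauss (b / 2) x x'.
  by rewrite mulrC; exact: abs_gauss_sharp.
have g x x' : gauss b x x' <= gauss (b / 2) x x'.
  by rewrite ler_expR !mulNr lerN2 ler_wpM2r ?sqr_ge0// ler_pdivrMr// ler_peMr ?ltW// ltr1n.
rewrite /gauss2 /dist1 -!mulrA [2 * _]mulrCA ler_wpM2l ?VI2V_ge0//.
have s0 : 0 <= (Num.sqrt b)^-1 by rewrite invr_ge0 sqrtr_ge0.
have A := ler_pM (mulr_ge0 (gauss_ge0 b p.1 q.1) (normr_ge0 _)) (gauss_ge0 b p.2 q.2) (h p.1 q.1) (g p.2 q.2).
have B := ler_pM (gauss_ge0 b p.1 q.1) (mulr_ge0 (gauss_ge0 b p.2 q.2) (normr_ge0 _)) (g p.1 q.1) (h p.2 q.2).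
have := lerD A B; congr (_ <= _); ring.
Qed.

Notation mean_cont := (mean_cont M (@heat)).

(** In [(f q - f p) ^+ 2] one factor is bounded by the Lipschitz condition, which gives smallness
    through [heat_dist1], and the other by [w2 p + w2 q], which gives integrability. *)
Lemma mean_cont_lip (f : R * R -> R) (L : R) : measurable_fun setT f -> 0 <= L ->
  (forall p q, `|f q - f p| <= L * dist1 p q) -> (forall p, `|f p| <= w2 p) -> mean_cont f.
Proof.
move=> mf L0 fL fw.
have lf : L2 M f.
  by apply: (@L2_le _ _ _ M f w2 mf L2_w2) => p; rewrite (gtr0_norm (w2_gt0 p)).
split => // e e0.
have pi0 : (0 : R) < pi by exact: pi_gt0.
(* The product of 2 L from [heat_dist1], 2 pi^2 from [int_gauss2_weight] and 2 from
   [gauss_mass_half]. *)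
pose K : R := 8 * L * pi ^+ 2.
have K0 : 0 <= K by apply: mulr_ge0; [exact: mulr_ge0|exact: sqr_ge0].
have en n : (energy M (@heat) n f <= (K * (Num.sqrt (heat_rate n))^-1)%:E)%E.
  pose c := 2 * L * (gauss_mass (heat_rate n) ^+ 2)^-1 * (Num.sqrt (heat_rate n))^-1.
  have c0 : 0 <= c by rewrite !mulr_ge0 ?VI2V_ge0 ?invr_ge0 ?sqrtr_ge0.
  have b2 : 0 < heat_rate n / 2 by rewrite divr_gt0// heat_rate_gt0.
  have mG : measurable_fun setT (fun z : (R * R) * (R * R) => (gauss2 (heat_rate n / 2) z.1 z.2 * (w2 z.1 + w2 z.2))%:E).
    apply/measurable_EFinP/measurable_funM; first exact: measurable_gauss2.
    by apply: measurable_funD; apply: (measurableT_comp measurable_w2).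
  have pG (z : (R * R) * (R * R)) : (0 <= (gauss2 (heat_rate n / 2) z.1 z.2 * (w2 z.1 + w2 z.2))%:E)%E.
    by rewrite lee_fin mulr_ge0 ?gauss2_ge0 ?addr_ge0// ltW// w2_gt0.
  have mF : measurable_fun setT (fun p => \int[M]_q (gauss2 (heat_rate n / 2) p q * (w2 p + w2 q))%:E)%E.
    exact: (measurable_fun_fubini_tonelli_F (m2 := M) (fun z : (R * R) * (R * R) => (gauss2 (heat_rate n / 2) z.1 z.2 * (w2 z.1 + w2 z.2))%:E) mG pG).
  have -> : ((K * (Num.sqrt (heat_rate n))^-1)%:E = c%:E *
      \int[M]_p \int[M]_q (gauss2 (heat_rate n / 2) p q * (w2 p + w2 q))%:E)%E.
    rewrite int_gauss2_weight// gauss_mass_half ?heat_rate_gt0// -EFinM; congr (_%:E).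
    rewrite /K /c; field; rewrite !gt_eqF ?gauss_mass_gt0 ?sqrtr_gt0 ?heat_rate_gt0//.
  rewrite -ge0_integralZl//; last by move=> p _; apply: integral_ge0 => q _; exact: (pG (p, q)).
  apply: ge0_le_integral => //.
    + by move=> p _; apply: integral_ge0 => q _; rewrite lee_fin mulr_ge0 ?heat_ge0 ?sqr_ge0.
    + apply: (measurable_fun_fubini_tonelli_F (m2 := M) (fun z : (R * R) * (R * R) => (heat n z.1 z.2 * (f z.2 - f z.1) ^+ 2)%:E)).
        exact: (measurable_integrand (@measurable_heat)).
      by move=> z; rewrite lee_fin mulr_ge0 ?heat_ge0 ?sqr_ge0.
    + by apply: measurable_funeM; exact: mF.
    + move=> p _; rewrite -ge0_integralZl//; last 2 first.
      * exact: (measurableT_comp mG (measurable_pair1 p)).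
      * by move=> q _; exact: (pG (p, q)).
      apply: ge0_le_integral => //.
      * by move=> q _; rewrite lee_fin mulr_ge0 ?heat_ge0 ?sqr_ge0.
      * apply/measurable_EFinP/measurable_funM; last exact/measurable_funX/measurable_funB.
        exact: (measurable_section (k := heat n) (@measurable_heat n)).
      * by apply: measurable_funeM; exact: (measurableT_comp mG (measurable_pair1 p)).
      * move=> q _; rewrite -EFinM lee_fin.
        have fs : (f q - f p) ^+ 2 <= L * dist1 p q * (w2 p + w2 q).
          rewrite -(real_normK (num_real _)) expr2; apply: ler_pM => //.
          by rewrite (le_trans (ler_normB _ _))// addrC lerD.
        apply: (le_trans (ler_wpM2l (heat_ge0 n p q) fs)).
        have := ler_wpM2r (addr_ge0 (ltW (w2_gt0 p)) (ltW (w2_gt0 q))) (ler_wpM2l L0 (heat_dist1 n p q)).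
        by congr (_ <= _); rewrite /c; ring.
have c0 : K * (Num.sqrt (heat_rate n))^-1 @[n --> \oo] --> (0 : R).
  have E n : (Num.sqrt (heat_rate n))^-1 = Num.sqrt 2 * n.+1%:R^-1 :> R.
    by rewrite /heat_rate sqrtrM ?sqr_ge0// sqrtr_sqr ger0_norm// sqrtrV// invfM invrK mulrC.
  under eq_fun do rewrite E mulrA.
  have h : K * Num.sqrt 2 * n.+1%:R^-1 @[n --> \oo] --> K * Num.sqrt 2 * (0 : R).
    by apply: cvgM; [exact: cvg_cst|exact: cvg_harmonic].
  by rewrite mulr0 in h.
move/cvgrPdist_lt : c0 => /(_ _ e0); apply: filterS => n.
rewrite sub0r normrN => h; apply: (le_trans (en n)); rewrite lee_fin.
exact: le_trans (ler_norm _) (ltW h).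
Qed.

End Plane.

(** * The mollifiers and their convergence in L2 *)

Section Mollifier.
Context (R : realType).
Notation leb := (@lebesgue_measure R).
Notation M := (mu2s R).
Notation mean_cont := (mean_cont M (@heat R)).
Implicit Types (p q : R * R).

Lemma mean_cont_w2 : mean_cont (@w2 R).
Proof.
apply: (mean_cont_lip (L := 1)) => //; first exact: measurable_w2.
  by move=> p q; rewrite mul1r w2_lip.
by move=> p; rewrite (gtr0_norm (w2_gt0 p)).
Qed.

(* Lipschitz approximations of the indicators of the quadrants [rays2]. *)
Definition ramp (m : nat) (s t : R) p := Num.min 1 (m%:R * Num.max 0 (Num.min (s - p.1) (t - p.2))).

Lemma ramp_ge0 m s t p : 0 <= ramp m s t p.
Proof. by rewrite le_min ler01 mulr_ge0// le_max lexx. Qed.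

Lemma ramp_le1 m s t p : ramp m s t p <= 1.
Proof. by rewrite ge_min lexx. Qed.

Lemma minmax_lip (a b : R) : `|Num.min 1 a - Num.min 1 b| <= `|a - b| /\
  `|Num.max 0 a - Num.max 0 b| <= `|a - b|.
Proof.
wlog : a b / a <= b.
  move=> H; case: (leP a b) => [/H//|/ltW /H [h1 h2]].
  by rewrite (distrC a b) (distrC (Num.min 1 a)) (distrC (Num.max 0 a)).
move=> ab; have ab0 : a - b <= 0 by rewrite subr_le0.
rewrite [`|a - b|]ler0_norm// !ler_norml.
by split; apply/andP; split; case: (leP 1 a) => ?; case: (leP 1 b) => ?; case: (leP 0 a) => ?; case: (leP 0 b) => ?; lra.
Qed.

Lemma min_lip (a b a' b' : R) : `|Num.min a b - Num.min a' b'| <= `|a - a'| + `|b - b'|.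
Proof.
have := ler_norm (a - a'); have := ler_norm (b - b').
have := ler_norm (a' - a); have := ler_norm (b' - b).
rewrite (distrC a' a) (distrC b' b) => h1 h2 h3 h4.
rewrite ler_norml; apply/andP; split; case: (leP a b) => ?; case: (leP a' b') => ?; lra.
Qed.

Lemma ramp_lip m s t p q : `|ramp m s t q - ramp m s t p| <= m%:R * dist1 p q.
Proof.
apply: (le_trans (minmax_lip _ _).1); rewrite -mulrBr normrM normr_nat ler_wpM2l//.
apply: (le_trans (minmax_lip _ _).2); apply: (le_trans (min_lip _ _ _ _)).
by rewrite /dist1 [`|q.1 - _|]distrC [`|q.2 - _|]distrC !opprB !addrA lerD// le_eqVlt; apply/orP; left; apply/eqP; congr `|_|; ring.
Qed.

Lemma measurable_ramp m s t : measurable_fun setT (ramp m s t).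
Proof.
apply: measurable_minr => //; apply: measurable_funM => //; apply: measurable_maxr => //.
by apply: measurable_minr; apply: measurable_funB => //; exact: measurable_fst || exact: measurable_snd.
Qed.

Lemma ramp_cvg s t p : ramp m s t p @[m --> \oo] --> (\1_[set p : R * R | p.1 < s /\ p.2 < t] p : R).
Proof.
rewrite indicE; have [[ps pt]|n] := pselect (p.1 < s /\ p.2 < t).
  rewrite mem_set//; apply: cvg_near_cst.
  pose d := Num.min (s - p.1) (t - p.2).
  have d0 : 0 < d by rewrite lt_min !subr_gt0 ps pt.
  (* Inside the quadrant the ramp has reached 1 as soon as m d >= 1. *)
  exists (Num.bound d^-1) => // m /= hm; apply/min_idPl.
  rewrite [Num.max 0 _]max_r; last exact: ltW.
  rewrite -ler_pdivrMr; last exact: d0.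
  rewrite div1r.
  apply: (le_trans (y := (Num.bound d^-1)%:R)); last by rewrite ler_nat.
  by rewrite ltW// archi_boundP// invr_ge0 ltW.
rewrite memNset//; apply: cvg_near_cst; apply: nearW => m.
rewrite /ramp [Num.max 0 _]max_l; first by rewrite mulr0 min_r.
rewrite ge_min !subr_le0; apply/orP.
have [h|h] := leP s p.1; [by left|right].
by rewrite leNgt; apply/negP => h'; apply: n.
Qed.

(** The products of [w2] with the ramps are Lipschitz and below [w2]; they converge pointwise under
    domination by [w2], although their Lipschitz constants [m%:R + 1] blow up. *)
Lemma mean_cont_rays A : rays2 (R := R) A -> mean_cont (fun p => \1_A p * w2 p).
Proof.
move=> [s [t ->]].
apply: (mean_cont_dominated (mu := M) (@measurable_heat R) (@heat_ge0 R) (@int_heat R) (@int_rho' R)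
  (f_ := fun m p => ramp m s t p * w2 p) _ (@L2_w2 R)).
- move=> m; apply: (mean_cont_lip (L := m%:R + 1)) => //.
  + by apply: measurable_funM; [exact: measurable_ramp|exact: measurable_w2].
  + move=> p q; have -> : ramp m s t q * w2 q - ramp m s t p * w2 p =
      (ramp m s t q - ramp m s t p) * w2 q + ramp m s t p * (w2 q - w2 p) by ring.
    rewrite (le_trans (ler_normD _ _))// normrM [X in _ + X]normrM mulrDl mul1r; apply: lerD.
      by rewrite (gtr0_norm (w2_gt0 q)) (le_trans _ (ramp_lip m s t p q))// ler_piMr// w2_le1.
    by rewrite (ger0_norm (ramp_ge0 m s t p)) (le_trans _ (w2_lip p q))// ler_piMl// ramp_le1.
  + by move=> p; rewrite normrM (ger0_norm (ramp_ge0 m s t p)) (gtr0_norm (w2_gt0 p)) ler_piMl ?ramp_le1// ltW// w2_gt0.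
- by move=> m p; rewrite normrM ler_piMl// (ger0_norm (ramp_ge0 m s t p)) ramp_le1.
- by move=> p; apply: cvgM; [exact: ramp_cvg|exact: cvg_cst].
Qed.

Lemma mean_cont_plane (f : R * R -> R) : L2 M f -> mean_cont f.
Proof.
apply: (goodT (mu := M) (@measurable_heat R) (@heat_ge0 R) (@int_heat R) (@int_rho' R) (@w2_gt0 R) mean_cont_w2 (@rays2E R) (@rays2I R)).
exact: mean_cont_rays.
Qed.

Definition cutoff (n : nat) p : R := expR (- cutoff_rate R n * p.1 ^+ 2) * expR (- cutoff_rate R n * p.2 ^+ 2).

Lemma cutoff_ge0 n p : 0 <= cutoff n p.
Proof. by rewrite mulr_ge0 ?expR_ge0. Qed.

Lemma cutoff_le1 n p : cutoff n p <= 1.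
Proof.
have h x : expR (- cutoff_rate R n * x ^+ 2) <= 1.
  by rewrite -expR0 ler_expR mulNr oppr_le0 mulr_ge0 ?sqr_ge0// ltW// cutoff_rate_gt0.
by rewrite mulr_ile1 ?expR_ge0.
Qed.

Lemma measurable_cutoff n : measurable_fun setT (cutoff n).
Proof.
by apply: measurable_funM; apply: (measurableT_comp (@measurable_expR R)); apply: measurable_funM => //;
  apply: measurable_funX; [exact: measurable_fst|exact: measurable_snd].
Qed.

Lemma cutoff_cvg p : cutoff n p @[n --> \oo] --> (1 : R).
Proof.
have ha : cutoff_rate R n @[n --> \oo] --> (0 : R).
  rewrite (_ : cutoff_rate R = (fun n => 2^-1 * (n.+1%:R^-1 * n.+1%:R^-1))); last by apply/funext => n; rewrite /cutoff_rate invfM expr2 invfM.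
  have hh : (n.+1%:R^-1 : R) @[n --> \oo] --> (0 : R) by exact: cvg_harmonic.
  have h := cvgM (cvg_cst (2^-1 : R)) (cvgM hh hh).
  by rewrite !mulr0 in h; exact: h.
have h (x : R) : expR (- cutoff_rate R n * x ^+ 2) @[n --> \oo] --> (1 : R).
  have h : (- cutoff_rate R n * x ^+ 2) @[n --> \oo] --> - (0 : R) * x ^+ 2.
    by apply: cvgM; [exact: cvgN|exact: cvg_cst].
  rewrite oppr0 mul0r in h.
  have := cvg_comp _ _ h (@continuous_expR R 0); rewrite expR0; exact.
have h2 := cvgM (h p.1) (h p.2); rewrite mul1r in h2; exact: h2.
Qed.

(** The kernel of J_n, cutoff times heat kernel as [JkE] shows, written with [mgauss] so that its
    derivatives stay within one family. *)
Definition molker n p q := (gauss_mass (heat_rate R n) ^+ 2)^-1 *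
  (mgauss (cutoff_rate R n) (heat_rate R n) 0 0 p.1 q.1 *
   mgauss (cutoff_rate R n) (heat_rate R n) 0 0 p.2 q.2).

Lemma JkE n p q : molker n p q = cutoff n p * heat n p q.
Proof. by rewrite /molker /cutoff /heat /mgauss /gauss2 !expr0 !mul1r; ring. Qed.

Lemma measurable_molker n : measurable_fun setT (fun z : (R * R) * (R * R) => molker n z.1 z.2).
Proof.
apply: measurable_funM => //; apply: measurable_funM; apply: measurable_mgauss;
 (apply: measurableT_comp => //; exact: measurable_fst || exact: measurable_snd).
Qed.

Definition mollify n (f : R * R -> R) p := \int[M]_q (molker n p q * f q).

Lemma molker_le n p q : `|molker n p q| <= (gauss_mass (heat_rate R n) ^+ 2)^-1 * gauss2 (heat_rate R n) p q.
Proof.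
rewrite JkE normrM (ger0_norm (cutoff_ge0 _ _)) (ger0_norm (heat_ge0 _ _ _)).
by rewrite ler_piMl ?heat_ge0// cutoff_le1.
Qed.

Lemma mollify_schur n (f : R * R -> R) : L2 M f -> (forall p, integr M (fun q => molker n p q * f q)) /\ L2 M (mollify n f).
Proof.
move=> lf.
have [] := schur (mu := M) (@measurable_gauss2 R _) (@gauss2_ge0 R _) (fun p q => gauss2_le1 p q (heat_rate_gt0 R n))
  (fun p => int_gauss2 p (heat_rate_gt0 R n)) (fun q => int_G2' q (heat_rate_gt0 R n)) (@measurable_molker n) (@molker_le n) lf.
by [].
Qed.

(** The error splits at [cutoff n p * f p]. The first part is the cutoff times an average of
    [f q - f p], whose square is at most the average of the squares, so it is controlled by
    [energy]; the second is dominated convergence. *)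
Lemma mollify_cvg (f : R * R -> R) : L2 M f -> forall e : R, 0 < e -> \forall n \near \oo,
  ip M (fun p => mollify n f p - f p) (fun p => mollify n f p - f p) < e.
Proof.
move=> lf e e0; have [_ vf] := mean_cont_plane lf; have [mf _] := lf.
have mcf n : measurable_fun setT (fun p => cutoff n p * f p) by apply: measurable_funM => //; exact: measurable_cutoff.
have cl n p : `|cutoff n p * f p| <= `|f p|.
  by rewrite normrM (ger0_norm (cutoff_ge0 n p)) ler_piMl// cutoff_le1.
have cc p : cutoff n p * f p @[n --> \oo] --> f p.
  have h := cvgM (cutoff_cvg p) (cvg_cst (f p)); rewrite mul1r in h; exact: h.
have [_ H] := L2_dominated (mu := M) mcf lf cl cc.
(* Each part contributes at most 2 (e / 8) through [ip_sqrD]. *)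
have e8 : 0 < e / 8 by rewrite divr_gt0.
move: (H _ e8) (vf _ e8); apply: filterS2 => n h1 h2.
have lJ := (mollify_schur n lf).2.
have lc : L2 M (fun p => cutoff n p * f p) by exact: (L2_le (mu := M) (mcf n) lf (cl n)).
have ld : L2 M (fun p => mollify n f p - cutoff n p * f p) by exact: L2B.
have le' : L2 M (fun p => cutoff n p * f p - f p) by exact: L2B.
have ri p : integr M (heat n p).
  apply: Rint_ge0_integr; [exact: (measurable_section (k := heat n) (@measurable_heat R n))|exact: heat_ge0|].
  by rewrite int_heat ltry.
have rfi p : integr M (fun q => heat n p q * f q).
  exact: (weighted_CS (mu := M) mf (heat_ge0 n p) (ri p) (Gsqr_integr (mu := M) (@measurable_heat R n) (@heat_ge0 R n) (@heat_le R n) p lf)).1.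
have r2i p : integr M (fun q => heat n p q * (f q - f p) ^+ 2).
  have := integrD (integrD (Gsqr_integr (mu := M) (@measurable_heat R n) (@heat_ge0 R n) (@heat_le R n) p lf)
    (integrZ (- 2 * f p) (rfi p))) (integrZ (f p ^+ 2) (ri p)).
  by congr integr; apply/funext => q; ring.
have point p : (mollify n f p - cutoff n p * f p) ^+ 2 <= \int[M]_q (heat n p q * (f q - f p) ^+ 2).
  have E : mollify n f p - cutoff n p * f p = cutoff n p * \int[M]_q (heat n p q * (f q - f p)).
    transitivity (cutoff n p * (\int[M]_q (heat n p q * f q) - f p * \int[M]_q heat n p q)).
      rewrite /mollify; under eq_Rintegral do rewrite JkE -mulrA.
      rewrite RintegralZl//; last exact: rfi.
      by rewrite mulrBr; congr (_ - _); rewrite {1}/Rintegral int_heat/= mulr1.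
    rewrite -RintegralZl//; last exact: ri.
    rewrite -RintegralB//; [|exact: rfi|exact: integrZ].
    by congr (_ * _); apply: eq_Rintegral => q _; ring.
  have [_] := weighted_CS (mu := M) (measurable_funB mf (measurable_cst (f p))) (heat_ge0 n p) (ri p) (r2i p).
  rewrite /Rintegral int_heat/= mul1r => cs.
  rewrite E exprMn; apply: le_trans cs; rewrite ler_piMl ?sqr_ge0//.
  by rewrite expr_le1// ?cutoff_le1// cutoff_ge0.
have d4 : ip M (fun p => mollify n f p - cutoff n p * f p) (fun p => mollify n f p - cutoff n p * f p) <= e / 8.
  rewrite -lee_fin -ip_fin//; apply: le_trans h2; apply: ge0_le_integral => //.
  - by move=> p _; rewrite lee_fin sqr_ge0.
  - by apply/measurable_EFinP/measurable_funX; case: ld.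
  - apply: (measurable_fun_fubini_tonelli_F (m2 := M) (fun z : (R * R) * (R * R) => (heat n z.1 z.2 * (f z.2 - f z.1) ^+ 2)%:E)).
      exact: (measurable_integrand (@measurable_heat R)).
    by move=> z; rewrite lee_fin mulr_ge0 ?heat_ge0 ?sqr_ge0.
  - by move=> p _; rewrite (integr_fin (r2i p)) lee_fin.
have := ip_sqrD ld le'.
rewrite [X in ip _ X _](_ : _ = (fun p => mollify n f p - f p)); last by apply/funext => p; ring.
rewrite [X in ip _ _ X](_ : _ = (fun p => mollify n f p - f p)); last by apply/funext => p; ring.
by move=> h; lra.
Qed.

End Mollifier.

(** * Schwartz functions *)

Section Continuous2.
Context (R : realType).

(** Measurability on the plane refers to the product sigma-algebra, whereas continuity refers to the
    product topology; rational boxes reconcile the two. *)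
Lemma open2_measurable (O : set (R * R)) : open O -> measurable O.
Proof.
move=> oO.
pose box (r : (rat * rat) * (rat * rat)) : set (R * R) :=
  `]ratr r.1.1, ratr r.1.2[%classic `*` `]ratr r.2.1, ratr r.2.2[%classic.
(* Boxes not contained in [O] are replaced by the empty set, so that the union runs over all
   rational quadruples, a countable type. *)
rewrite (_ : O = \bigcup_r (if pselect (box r `<=` O) then box r else set0)).
  apply: countable_bigcupT_measurable; first exact: countableP.
  move=> r; case: (pselect (box r `<=` O)) => h /=; last exact: measurable0.
  by apply: measurableX; exact: measurable_itv.
apply/seteqP; split => p; last by move=> [r _]; case: pselect => // h /h.
move=> Op; have /nbhs_ballP[e /= e0 he] : nbhs p O by move: oO; rewrite openE; exact.
have [a1 /[!in_itv]/= /andP[a1l a1r]] : exists r : rat, ratr r \in `]p.1 - e, p.1[.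
  by apply: rat_in_itvoo; rewrite ltrBlDr ltrDl.
have [b1 /[!in_itv]/= /andP[b1l b1r]] : exists r : rat, ratr r \in `]p.1, p.1 + e[.
  by apply: rat_in_itvoo; rewrite ltrDl.
have [a2 /[!in_itv]/= /andP[a2l a2r]] : exists r : rat, ratr r \in `]p.2 - e, p.2[.
  by apply: rat_in_itvoo; rewrite ltrBlDr ltrDl.
have [b2 /[!in_itv]/= /andP[b2l b2r]] : exists r : rat, ratr r \in `]p.2, p.2 + e[.
  by apply: rat_in_itvoo; rewrite ltrDl.
exists ((a1, b1), (a2, b2)); first by [].
case: (pselect (box ((a1, b1), (a2, b2)) `<=` O)) => [_|[]] /=.
  by split; rewrite /= in_itv/=; apply/andP; split.
move=> q [/= /[!in_itv]/= /andP[q1 q2] /andP[q3 q4]]; apply: he.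
by split; rewrite -ball_normE /ball_/= ltr_norml; apply/andP; split; lra.
Qed.

Lemma continuous2_measurable (f : R * R -> R) : continuous f -> measurable_fun setT f.
Proof.
move=> cf; apply: (measurability _ (RGenInftyO.measurableE R)) => _ [_ [s ->] <-].
rewrite setTI; apply: open2_measurable.
rewrite (_ : `]-oo, s[%classic = [set x | x < s]); last by apply/seteqP; split => x /=; rewrite in_itv.
by apply: open_comp; [move=> p _; exact: cf|exact: open_lt].
Qed.

Lemma lip_of_derive (f f' : R -> R) (C : R) : (forall x : R, is_derive x 1 f (f' x)) ->
  (forall x, `|f' x| <= C) -> forall x y : R, `|f y - f x| <= C * `|y - x|.
Proof.
move=> df fC.
suff H x y : x < y -> `|f y - f x| <= C * `|y - x|.
  move=> x y; case: (ltgtP x y) => [/H//|/H|->]; last by rewrite !subrr normr0 mulr0.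
  by rewrite distrC (distrC x).
move=> xy; have [c _ ->] := MVT xy (fun x _ => df x) (derivable_within_continuous (fun x _ => @ex_derive _ _ _ _ _ _ _ (df x))).
by rewrite normrM ler_wpM2r.
Qed.

(** Moving along one axis at a time, the mean value theorem gives a Lipschitz bound. Differentiation
    under the integral only yields partial derivatives; this recovers the joint continuity demanded
    of Schwartz functions. *)
Lemma continuous_partials (f fx fy : R * R -> R) (C D : R) :
  (forall p : R * R, is_derive p.1 1 (fun t => f (t, p.2)) (fx p)) ->
  (forall p : R * R, is_derive p.2 1 (fun t => f (p.1, t)) (fy p)) ->
  (forall p, `|fx p| <= C) -> (forall p, `|fy p| <= D) -> continuous f.
Proof.
move=> dx dy bx by_ p.
have L q : `|f q - f p| <= C * `|q.1 - p.1| + D * `|q.2 - p.2|.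
  have -> : f q - f p = (f (q.1, q.2) - f (p.1, q.2)) + (f (p.1, q.2) - f (p.1, p.2)).
    by rewrite -!surjective_pairing; ring.
  apply: (le_trans (ler_normD _ _)); apply: lerD.
    exact: (lip_of_derive (f := fun t => f (t, q.2)) (f' := fun t => fx (t, q.2)) (fun x => dx (x, q.2)) (fun x => bx _)).
  exact: (lip_of_derive (f := fun t => f (p.1, t)) (f' := fun t => fy (p.1, t)) (fun x => dy (p.1, x)) (fun x => by_ _)).
have c0 : C * `|q.1 - p.1| + D * `|q.2 - p.2| @[q --> p] --> (0 : R).
  have h1 : (q.1 - p.1) @[q --> p] --> p.1 - p.1 by apply: cvgB; [exact: cvg_fst|exact: cvg_cst].
  have h2 : (q.2 - p.2) @[q --> p] --> p.2 - p.2 by apply: cvgB; [exact: cvg_snd|exact: cvg_cst].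
  have h : C * `|q.1 - p.1| + D * `|q.2 - p.2| @[q --> p] --> C * `|p.1 - p.1| + D * `|p.2 - p.2|.
    apply: cvgD; apply: cvgM; [exact: cvg_cst| |exact: cvg_cst|].
      exact: (cvg_norm h1).
    exact: (cvg_norm h2).
  by rewrite !subrr !normr0 !mulr0 addr0 in h.
apply/cvgrPdistC_lt => e e0; move/cvgrPdist_lt : c0 => /(_ _ e0); apply: filterS => q.
rewrite sub0r normrN => h; apply: (le_lt_trans (L q)); exact: (le_lt_trans (ler_norm _) h).
Qed.

End Continuous2.

(** * Real Schwartz functions and a criterion for families *)

Section RealSchwartz.
Context (R : realType).
Notation M := (mu2s R).
Implicit Types (f g : R * R -> R) (p q : R * R).

Definition px f p := derive1 (fun t => f (t, p.2)) p.1.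
Definition py f p := derive1 (fun t => f (p.1, t)) p.2.
Definition rpart (w : seq bool) f := foldr (fun b => if b then py else px) f w.

Definition rschwartz f :=
  (forall w, [/\ continuous (rpart w f),
     forall p, derivable (fun t => rpart w f (t, p.2)) p.1 1 &
     forall p, derivable (fun t => rpart w f (p.1, t)) p.2 1]) /\
  (forall w a b, exists C : R, forall p, `|p.1 ^+ a * p.2 ^+ b * rpart w f p| <= C).

Lemma px_is_derive f p df : is_derive p.1 1 (fun t => f (t, p.2)) df -> px f p = df.
Proof. by move=> h; rewrite /px derive1E; apply: derive_val. Qed.

Lemma py_is_derive f p df : is_derive p.2 1 (fun t => f (p.1, t)) df -> py f p = df.
Proof. by move=> h; rewrite /py derive1E; apply: derive_val. Qed.

Lemma rschwartz_px f : rschwartz f -> rschwartz (px f).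
Proof.
move=> [h1 h2]; split=> [w|w a b]; rewrite -[px f]/(rpart [:: false] f) /rpart -foldr_cat -/(rpart _ _).
  exact: h1.
exact: h2.
Qed.

Lemma rschwartz_py f : rschwartz f -> rschwartz (py f).
Proof.
move=> [h1 h2]; split=> [w|w a b]; rewrite -[py f]/(rpart [:: true] f) /rpart -foldr_cat -/(rpart _ _).
  exact: h1.
exact: h2.
Qed.

Lemma rschwartz_dx f p : rschwartz f -> is_derive p.1 1 (fun t => f (t, p.2)) (px f p).
Proof. by move=> [/(_ [::])[_ h _] _]; rewrite /px derive1E; apply/derivableP; exact: h. Qed.

Lemma rschwartz_dy f p : rschwartz f -> is_derive p.2 1 (fun t => f (p.1, t)) (py f p).
Proof. by move=> [/(_ [::])[_ _ h] _]; rewrite /py derive1E; apply/derivableP; exact: h. Qed.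

Lemma rschwartz_continuous f : rschwartz f -> continuous f.
Proof. by move=> [/(_ [::])[]]. Qed.

Lemma rschwartz_bound f a b : rschwartz f -> exists C : R, forall p, `|p.1 ^+ a * p.2 ^+ b * f p| <= C.
Proof. by move=> [_ h]; exact: (h [::]). Qed.

Lemma rpart_comb w f g (a b : R) : rschwartz f -> rschwartz g ->
  rpart w (fun p => a * f p + b * g p) = (fun p => a * rpart w f p + b * rpart w g p).
Proof.
move=> [hf _] [hg _]; elim: w => [//|c w IH] /=; rewrite IH.
have [_ fx fy] := hf w; have [_ gx gy] := hg w.
case: c; apply/funext => p.
  apply: (@py_is_derive _ p); have /derivableP h1 := fy p; have /derivableP h2 := gy p.
  rewrite /py !derive1E.
  apply: (is_derive_tr (is_deriveD (is_deriveZ a h1) (is_deriveZ b h2))) => //.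
apply: (@px_is_derive _ p); have /derivableP h1 := fx p; have /derivableP h2 := gx p.
rewrite /px !derive1E.
by apply: (is_derive_tr (is_deriveD (is_deriveZ a h1) (is_deriveZ b h2))).
Qed.

Lemma rschwartz_comb f g (a b : R) : rschwartz f -> rschwartz g -> rschwartz (fun p => a * f p + b * g p).
Proof.
move=> sf sg; split=> [w|w i j]; rewrite rpart_comb//.
  have [cf fx fy] := sf.1 w; have [cg gx gy] := sg.1 w; split.
  - move=> p; apply: cvgD; (apply: cvgM; [exact: cvg_cst|]); [exact: cf|exact: cg].
  - by move=> p; apply: derivableD; apply: derivableZ.
  - by move=> p; apply: derivableD; apply: derivableZ.
have [C HC] := sf.2 w i j; have [D HD] := sg.2 w i j.
exists (`|a| * C + `|b| * D) => p.
have -> : p.1 ^+ i * p.2 ^+ j * (a * rpart w f p + b * rpart w g p) =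
  a * (p.1 ^+ i * p.2 ^+ j * rpart w f p) + b * (p.1 ^+ i * p.2 ^+ j * rpart w g p) by ring.
apply: (le_trans (ler_normD _ _)); rewrite normrM [X in _ + X]normrM.
by apply: lerD; exact: ler_wpM2l.
Qed.

(** Multiplying by 1 / w2 = (1 + x^2)(1 + y^2) and expanding produces exactly the four quantities
    assumed bounded. *)
Lemma w2_dom (u : R * R -> R) (C0 C1 C2 C3 : R) : (forall p, `|u p| <= C0) ->
  (forall p, `|p.1 ^+ 2 * u p| <= C1) -> (forall p, `|p.2 ^+ 2 * u p| <= C2) ->
  (forall p, `|p.1 ^+ 2 * (p.2 ^+ 2 * u p)| <= C3) ->
  forall p, `|u p| <= (C0 + C1 + C2 + C3) * w2 p.
Proof.
have E (x v : R) : `|x ^+ 2 * v| = x ^+ 2 * `|v| by rewrite normrM ger0_norm ?sqr_ge0.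
move=> H0 H1 H2 H3 p.
rewrite /w2 /w1 -invfM ler_pdivlMr; last by rewrite mulr_gt0// (lt_le_trans ltr01)// oneDsqr_ge1.
move: (H0 p) (H1 p) (H2 p) (H3 p); rewrite !E /oneDsqr => h0 h1 h2 h3.
by rewrite (_ : _ * _ = `|u p| + p.1 ^+ 2 * `|u p| + p.2 ^+ 2 * `|u p| + p.1 ^+ 2 * (p.2 ^+ 2 * `|u p|)); [lra|ring].
Qed.

Lemma rschwartz_w2 i j f : rschwartz f -> exists C : R, forall p, `|p.1 ^+ i * p.2 ^+ j * f p| <= C * w2 p.
Proof.
move=> sf.
have [C0 H0] := rschwartz_bound i j sf; have [C1 H1] := rschwartz_bound (2 + i) j sf.
have [C2 H2] := rschwartz_bound i (2 + j) sf; have [C3 H3] := rschwartz_bound (2 + i) (2 + j) sf.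
exists (C0 + C1 + C2 + C3); apply: w2_dom => // p.
- by have := H1 p; rewrite exprD !mulrA.
- by have := H2 p; rewrite exprD; congr (`|_| <= _); ring.
- by have := H3 p; rewrite !exprD; congr (`|_| <= _); ring.
Qed.

Lemma rschwartz_L2_mono i j f : rschwartz f -> L2 M (fun p => p.1 ^+ i * p.2 ^+ j * f p).
Proof.
move=> sf; have [C HC] := rschwartz_w2 i j sf.
have m : measurable_fun setT (fun p : R * R => p.1 ^+ i * p.2 ^+ j * f p).
  apply: measurable_funM; last exact: (continuous2_measurable (rschwartz_continuous sf)).
  by apply: measurable_funM; apply: measurable_funX; [exact: measurable_fst|exact: measurable_snd].
apply: (L2_le (mu := M) m (L2Z C (@L2_w2 R))) => p.
by rewrite (le_trans (HC p))// ler_norm.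
Qed.

Lemma rschwartz_L2 f : rschwartz f -> L2 M f.
Proof. by move=> /(rschwartz_L2_mono 0 0); congr L2; apply/funext => p; ring. Qed.

Lemma rschwartz_mulx f : rschwartz f -> L2 M (fun p => p.1 * f p).
Proof. by move=> /(rschwartz_L2_mono 1 0); congr L2; apply/funext => p; ring. Qed.

Lemma rschwartz_muly f : rschwartz f -> L2 M (fun p => p.2 * f p).
Proof. by move=> /(rschwartz_L2_mono 0 1); congr L2; apply/funext => p; ring. Qed.

(* A family of rapidly decreasing functions whose partial derivatives are
   linear combinations of members of the family consists of Schwartz functions. *)
Section Family.
Context (I : Type) (F : I -> R * R -> R).
Definition lcomb (s : seq (R * I)) p := \sum_(c <- s) c.1 * F c.2 p.
Hypothesis Fx : forall i, exists s, forall p, is_derive p.1 1 (fun t => F i (t, p.2)) (lcomb s p).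
Hypothesis Fy : forall i, exists s, forall p, is_derive p.2 1 (fun t => F i (p.1, t)) (lcomb s p).
Hypothesis Fb : forall i a b, exists C : R, forall p, `|p.1 ^+ a * p.2 ^+ b * F i p| <= C.

Lemma lcomb_cons c i s p : lcomb ((c, i) :: s) p = c * F i p + lcomb s p.
Proof. by rewrite /lcomb big_cons. Qed.

Lemma lcomb_scale_cat c s t p : lcomb ([seq (c * x.1, x.2) | x <- s] ++ t) p = c * lcomb s p + lcomb t p.
Proof.
rewrite /lcomb big_cat big_map; congr (_ + _).
by rewrite big_distrr /=; apply: eq_bigr => x _ /=; rewrite mulrA.
Qed.

Lemma lcomb_x s : exists s', forall p, is_derive p.1 1 (fun t => lcomb s (t, p.2)) (lcomb s' p).
Proof.
elim: s => [|[c i] s [s' IH]].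
  exists [::] => p; rewrite /lcomb big_nil.
  by apply: (is_derive_tr (is_derive_cst (0 : R) p.1 1)) => // t; rewrite big_nil.
have [s1 H1] := Fx i; exists ([seq (c * x.1, x.2) | x <- s1] ++ s') => p.
apply: (is_derive_tr (is_deriveD (is_deriveZ c (H1 p)) (IH p))) => [t|].
  by rewrite lcomb_cons.
by rewrite lcomb_scale_cat.
Qed.

Lemma lcomb_y s : exists s', forall p, is_derive p.2 1 (fun t => lcomb s (p.1, t)) (lcomb s' p).
Proof.
elim: s => [|[c i] s [s' IH]].
  exists [::] => p; rewrite /lcomb big_nil.
  by apply: (is_derive_tr (is_derive_cst (0 : R) p.2 1)) => // t; rewrite big_nil.
have [s1 H1] := Fy i; exists ([seq (c * x.1, x.2) | x <- s1] ++ s') => p.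
apply: (is_derive_tr (is_deriveD (is_deriveZ c (H1 p)) (IH p))) => [t|].
  by rewrite lcomb_cons.
by rewrite lcomb_scale_cat.
Qed.

Lemma lcomb_b s a b : exists C : R, forall p, `|p.1 ^+ a * p.2 ^+ b * lcomb s p| <= C.
Proof.
elim: s => [|[c i] s [C IH]].
  by exists 0 => p; rewrite /lcomb big_nil mulr0 normr0.
have [D HD] := Fb i a b; exists (`|c| * D + C) => p.
rewrite lcomb_cons mulrDr; apply: (le_trans (ler_normD _ _)); apply: lerD => //.
by rewrite mulrCA normrM ler_wpM2l.
Qed.

Lemma rpart_lcomb w s : exists s', rpart w (lcomb s) = lcomb s'.
Proof.
elim: w => [|c w [s' IH]]; first by exists s.
rewrite /= IH; case: c.
  by have [t H] := lcomb_y s'; exists t; apply/funext => p; exact: py_is_derive.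
by have [t H] := lcomb_x s'; exists t; apply/funext => p; exact: px_is_derive.
Qed.

(** All iterated derivatives are again combinations. Their continuity follows from the boundedness
    of the next derivatives, the case of exponents 0 of [lcomb_b]. *)
Lemma rschwartz_lcomb s : rschwartz (lcomb s).
Proof.
split=> [w|w a b]; have [t ->] := rpart_lcomb w s; last exact: lcomb_b.
have [tx Hx] := lcomb_x t; have [ty Hy] := lcomb_y t.
have [C HC] := lcomb_b tx 0 0; have [D HD] := lcomb_b ty 0 0.
split => [|p|p]; [|exact: (@ex_derive _ _ _ _ _ _ _ (Hx p))|exact: (@ex_derive _ _ _ _ _ _ _ (Hy p))].
apply: (continuous_partials Hx Hy (C := C) (D := D)) => p.
  by have := HC p; rewrite !expr0 !mul1r.
by have := HD p; rewrite !expr0 !mul1r.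
Qed.

Lemma rschwartz_family i : rschwartz (F i).
Proof.
have := rschwartz_lcomb [:: (1, i)]; rewrite (_ : lcomb _ = F i)//.
by apply/funext => p; rewrite lcomb_cons /lcomb big_nil mul1r addr0.
Qed.

End Family.

End RealSchwartz.

(** * Integral operators with Gaussian kernels: regularity of the images *)

Section KernelOps.
Context (R : realType) (a b : R).
Hypotheses (a0 : 0 < a) (b0 : 0 < b).
Notation M := (mu2s R).
Notation mgauss := (mgauss a b).
Implicit Types (f g : R * R -> R) (p q : R * R).

Definition gker (i j k l : nat) p q := mgauss i k p.1 q.1 * mgauss j l p.2 q.2.
Definition gop f (i j k l : nat) p := \int[M]_q (gker i j k l p q * f q).

Lemma b2_gt0 : 0 < b / 2. Proof. by rewrite divr_gt0. Qed.

Lemma measurable_gker i j k l : measurable_fun setT (fun z : (R * R) * (R * R) => gker i j k l z.1 z.2).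
Proof.
apply: measurable_funM; apply: measurable_mgauss;
 (apply: measurableT_comp => //; exact: measurable_fst || exact: measurable_snd).
Qed.

Lemma gker_bound i j k l : exists2 C : R, 0 <= C & forall p q, `|gker i j k l p q| <= C * gauss2 (b / 2) p q.
Proof.
have [C C0 HC] := mgauss_bound i k a0 b0; have [D D0 HD] := mgauss_bound j l a0 b0.
exists (C * D); first exact: mulr_ge0.
move=> p q; rewrite normrM /gauss2 mulrACA; exact: ler_pM.
Qed.

Lemma gker_integr i j k l f p : L2 M f -> integr M (fun q => gker i j k l p q * f q).
Proof.
move=> lf; have [C C0 HC] := gker_bound i j k l.
have [H _ _] := schur (mu := M) (@measurable_gauss2 R _) (@gauss2_ge0 R _) (fun p q => gauss2_le1 p q b2_gt0)
  (fun p => int_gauss2 p b2_gt0) (fun q => int_G2' q b2_gt0) (measurable_gker i j k l) HC lf.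
exact: H.
Qed.

(** A bound at every point [p] by the L2 norm: Cauchy-Schwarz against a kernel with values in [0, 1]
    and finite mass. *)
Lemma gauss2_CS c f p : 0 < c -> L2 M f -> integr M (fun q => gauss2 c p q * `|f q|) /\
  (\int[M]_q (gauss2 c p q * `|f q|)) ^+ 2 <= gauss_mass c ^+ 2 * ip M f f.
Proof.
move=> c0 lf.
have G1 p' q : gauss2 c p' q <= 1 by exact: gauss2_le1.
have [h1 h2] := G_CS (mu := M) (@measurable_gauss2 R c) (@gauss2_ge0 R _) G1 (fun p => int_gauss2 p c0) p lf.
split=> //; apply: (le_trans h2); rewrite ler_wpM2l ?sqr_ge0//.
apply: le_Rintegral => //.
- exact: (Gsqr_integr (mu := M) (@measurable_gauss2 R c) (@gauss2_ge0 R _) G1 p lf).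
- exact: integr_mul.
- by move=> q _; rewrite -expr2 ler_piMl ?sqr_ge0.
Qed.

Lemma gop_bound i j k l f : L2 M f -> exists C : R, forall p, `|gop f i j k l p| <= C.
Proof.
move=> lf; have [C C0 HC] := gker_bound i j k l.
(* The inequality z <= 1 + z^2 turns the bound on the square into a bound on the integral without a
   square root. *)
exists (C * (1 + gauss_mass (b / 2) ^+ 2 * ip M f f)) => p.
have [h1 h2] := gauss2_CS p b2_gt0 lf.
apply: (le_trans (le_normr_Rintegral _ (gker_integr i j k l p lf))) => //.
apply: (le_trans (y := \int[M]_q (C * (gauss2 (b / 2) p q * `|f q|)))).
  apply: le_Rintegral => //.
  - exact: (integr_norm (gker_integr i j k l p lf)).
  - exact: (integrZ C h1).
  - by move=> q _; rewrite normrM mulrA ler_wpM2r.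
rewrite RintegralZl// ler_wpM2l//; move: h2; move: (\int[M]_q _) => z h2.
by have := sqr_ge0 (z - 1); have := sqr_ge0 z; nra.
Qed.

(** Differentiation under the integral needs one majorant for all [x] near [x0]; halving the rate
    once more frees the Gaussian from [x], by (y - x0)^2 <= 2 (y - x)^2 + 2 (x - x0)^2. *)
Lemma gauss_shift x0 x y : `|x - x0| <= 1 -> gauss (b / 2) x y <= expR (b / 2) * gauss (b / 4) x0 y.
Proof.
move=> h; rewrite /gauss -expRD ler_expR.
have h2 : (x - x0) ^+ 2 <= 1 by rewrite -(real_normK (num_real _)) expr_le1.
have h3 : (y - x0) ^+ 2 <= 2 * (y - x) ^+ 2 + 2.
  have := sqr_ge0 (y - x - (x - x0)); nra.
have := ler_wpM2l (ltW b0) h3; nra.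
Qed.

(** Abstracting the projection [pr] treats both coordinates at once: [g] collects [f] and the kernel
    factor in the other variable. The rate b/4 results from two halvings, one in [mgauss_bound] and
    one in [gauss_shift]. *)
Lemma diff_mgauss (pr g : R * R -> R) (i k : nat) (x0 : R) :
  (forall i k (x : R), integr M (fun q => mgauss i k x (pr q) * g q)) ->
  (forall x : R, integr M (fun q => gauss (b / 4) x (pr q) * `|g q|)) ->
  is_derive x0 1 (fun x => \int[M]_q (mgauss i k x (pr q) * g q))
    (i%:R * \int[M]_q (mgauss i.-1 k x0 (pr q) * g q) - k%:R * \int[M]_q (mgauss i k.-1 x0 (pr q) * g q)
     - 2 * a * \int[M]_q (mgauss i.+1 k x0 (pr q) * g q) + 2 * b * \int[M]_q (mgauss i k.+1 x0 (pr q) * g q)).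
Proof.
move=> ih ig.
pose D x y : R := i%:R * mgauss i.-1 k x y - k%:R * mgauss i k.-1 x y - 2 * a * mgauss i.+1 k x y + 2 * b * mgauss i k.+1 x y.
have dD (x : R) q : is_derive x 1 (fun x => mgauss i k x (pr q) * g q) (D x (pr q) * g q).
  apply: (is_derive_tr (is_derive_mul (is_derive_mgauss a b i k x (pr q)) (is_derive_cst (g q) x 1))) => //.
  by rewrite /D /=; ring.
have dE (x : R) q : derive1 (fun x => mgauss i k x (pr q) * g q) x = D x (pr q) * g q.
  by rewrite derive1E; apply: derive_val.
have [C1 C10 H1] := mgauss_bound i.-1 k a0 b0; have [C2 C20 H2] := mgauss_bound i k.-1 a0 b0.
have [C3 C30 H3] := mgauss_bound i.+1 k a0 b0; have [C4 C40 H4] := mgauss_bound i k.+1 a0 b0.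
have a2 : 0 <= 2 * a by rewrite mulr_ge0// ltW.
have b2 : 0 <= 2 * b by rewrite mulr_ge0// ltW.
pose S : R := i%:R * C1 + k%:R * C2 + 2 * a * C3 + 2 * b * C4.
have S0 : 0 <= S.
  by apply: addr_ge0; [apply: addr_ge0; [apply: addr_ge0|]|]; exact: mulr_ge0.
pose C := S * expR (b / 2).
have DC (x y : R) : `|x - x0| <= 1 -> `|D x y| <= C * gauss (b / 4) x0 y.
  move=> h; apply: (@le_trans _ _ (S * gauss (b / 2) x y)).
    have bnd (c E u z : R) : 0 <= c -> `|u| <= E * z -> `|c * u| <= c * E * z.
      by move=> c0 uE; rewrite normrM (ger0_norm c0) -mulrA ler_wpM2l.
    have n0 (n : nat) : 0 <= n%:R :> R by [].
    have B1 := bnd _ _ _ _ (n0 i) (H1 x y); have B2 := bnd _ _ _ _ (n0 k) (H2 x y).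
    have B3 := bnd _ _ _ _ a2 (H3 x y); have B4 := bnd _ _ _ _ b2 (H4 x y).
    rewrite /D; apply: (le_trans (ler_normD _ _)).
    rewrite [leRHS](_ : _ = i%:R * C1 * gauss (b / 2) x y + k%:R * C2 * gauss (b / 2) x y
       + 2 * a * C3 * gauss (b / 2) x y + 2 * b * C4 * gauss (b / 2) x y); last by rewrite /S; ring.
    apply: lerD => //; apply: (le_trans (ler_normB _ _)); apply: lerD => //.
    by apply: (le_trans (ler_normB _ _)); exact: lerD.
  by have := ler_wpM2l S0 (gauss_shift y h); rewrite mulrA.
have CC0 : 0 <= C by rewrite mulr_ge0 ?expR_ge0.
have Ix : `]x0 - 1, x0 + 1[%classic x0 by rewrite /= in_itv/=; apply/andP; split; lra.
have Gi : M.-integrable setT (EFin \o (fun q => C * (gauss (b / 4) x0 (pr q) * `|g q|))).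
  exact: (integrZ C (ig x0)).
have ub (x : R) q : `]x0 - 1, x0 + 1[%classic x -> setT q ->
    `|derive1 (fun x => mgauss i k x (pr q) * g q) x| <= C * (gauss (b / 4) x0 (pr q) * `|g q|).
  rewrite /= in_itv/= => /andP[h1 h2] _; rewrite dE normrM mulrA ler_wpM2r//.
  by apply: DC; rewrite ler_norml; apply/andP; split; lra.
have G0 q : 0 <= C * (gauss (b / 4) x0 (pr q) * `|g q|).
  exact: (mulr_ge0 CC0 (mulr_ge0 (gauss_ge0 _ _ _) (normr_ge0 _))).
have dr (x : R) q : `]x0 - 1, x0 + 1[%classic x -> setT q -> derivable (fun x => mgauss i k x (pr q) * g q) x 1.
  by move=> _ _; exact: (@ex_derive _ _ _ _ _ _ _ (dD x q)).
have h1 := derivable_under_integral (mu := M) measurableT Ix (fun x _ => ih i k x) dr G0 Gi ub.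
have h2 := differentiation_under_integral (mu := M) measurableT Ix (fun x _ => ih i k x) dr G0 Gi ub.
apply: DeriveDef; first exact: h1.
rewrite -derive1E h2.
transitivity (\int[M]_q (i%:R * (mgauss i.-1 k x0 (pr q) * g q) - k%:R * (mgauss i k.-1 x0 (pr q) * g q)
   - 2 * a * (mgauss i.+1 k x0 (pr q) * g q) + 2 * b * (mgauss i k.+1 x0 (pr q) * g q))).
  by apply: eq_Rintegral => q _; rewrite /partial1of2 dE /D; ring.
have I1 := integrZ i%:R (ih i.-1 k x0); have I2 := integrZ k%:R (ih i k.-1 x0).
have I3 := integrZ (2 * a) (ih i.+1 k x0); have I4 := integrZ (2 * b) (ih i k.+1 x0).
rewrite RintegralD//; last exact: (integrB (integrB I1 I2) I3).
rewrite RintegralB//; last exact: (integrB I1 I2).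
by rewrite RintegralB// !RintegralZl//; exact: ih.
Qed.

(** Supplies the second hypothesis of [diff_mgauss]: [h] is the kernel factor in the other variable,
    and the two one-dimensional Gaussians combine into [gauss2]. *)
Lemma mgauss_gauss_integr f (p : R * R) (h : R -> R) C : L2 M f -> 0 <= C -> measurable_fun setT h ->
  (forall y, `|h y| <= C * gauss (b / 4) p.2 y) ->
  integr M (fun q => gauss (b / 4) p.1 q.1 * `|h q.2 * f q|).
Proof.
move=> lf C0 mh hC; have b4 : 0 < b / 4 by rewrite divr_gt0.
have [mf _] := lf.
apply: (integr_le _ (integrZ C (gauss2_CS p b4 lf).1)) => [|q].
  apply: measurable_funM; first by apply: measurable_gauss => //; exact: measurable_fst.
  apply: measurableT_comp => //; apply: measurable_funM => //.
  by apply: (measurableT_comp mh); exact: measurable_snd.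
have g0 : 0 <= gauss (b / 4) p.1 q.1 by exact: gauss_ge0.
rewrite ger0_norm ?mulr_ge0// normrM.
have := ler_wpM2r (normr_ge0 (f q)) (ler_wpM2l g0 (hC q.2)).
by congr (_ <= _); rewrite /gauss2; ring.
Qed.

Lemma mgauss_gauss_integr' f (p : R * R) (h : R -> R) C : L2 M f -> 0 <= C -> measurable_fun setT h ->
  (forall y, `|h y| <= C * gauss (b / 4) p.1 y) ->
  integr M (fun q => gauss (b / 4) p.2 q.2 * `|h q.1 * f q|).
Proof.
move=> lf C0 mh hC; have b4 : 0 < b / 4 by rewrite divr_gt0.
have [mf _] := lf.
apply: (integr_le _ (integrZ C (gauss2_CS p b4 lf).1)) => [|q].
  apply: measurable_funM; first by apply: measurable_gauss => //; exact: measurable_snd.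
  apply: measurableT_comp => //; apply: measurable_funM => //.
  by apply: (measurableT_comp mh); exact: measurable_fst.
have g0 : 0 <= gauss (b / 4) p.2 q.2 by exact: gauss_ge0.
rewrite ger0_norm ?mulr_ge0// normrM.
have := ler_wpM2r (normr_ge0 (f q)) (ler_wpM2l g0 (hC q.1)).
by congr (_ <= _); rewrite /gauss2; ring.
Qed.

Lemma mgauss_bound4 i k : exists2 C : R, 0 <= C & forall x y, `|mgauss i k x y| <= C * gauss (b / 4) x y.
Proof.
have [C C0 HC] := mgauss_bound i k a0 b0; exists C => // x y; apply: (le_trans (HC x y)).
rewrite ler_wpM2l// /gauss ler_expR !mulNr lerN2 ler_wpM2r ?sqr_ge0//.
have b1 := b0; lra.
Qed.

Lemma gop_dx i j k l f p : L2 M f -> is_derive p.1 1 (fun t => gop f i j k l (t, p.2))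
  (i%:R * gop f i.-1 j k l p - k%:R * gop f i j k.-1 l p - 2 * a * gop f i.+1 j k l p
    + 2 * b * gop f i j k.+1 l p).
Proof.
move=> lf; pose g (q : R * R) := mgauss j l p.2 q.2 * f q.
have E i' k' x : (fun q => mgauss i' k' x q.1 * g q) = (fun q => gker i' j k' l (x, p.2) q * f q).
  by apply/funext => q; rewrite /g /gker mulrA.
have ih i' k' x : integr M (fun q => mgauss i' k' x q.1 * g q) by rewrite E; exact: gker_integr.
have [C C0 HC] := mgauss_bound4 j l.
have ig x : integr M (fun q => gauss (b / 4) x q.1 * `|g q|).
  by apply: (mgauss_gauss_integr (p := (x, p.2)) lf C0) => [|y]; [exact: measurable_mgauss|exact: HC].
have EE i' k' x : \int[M]_q (mgauss i' k' x q.1 * g q) = gop f i' j k' l (x, p.2).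
  by rewrite /gop; apply: eq_Rintegral => q _; rewrite /g /gker mulrA.
apply: (is_derive_tr (diff_mgauss i k p.1 ih ig)) => [x|]; first exact: EE.
by rewrite !EE -surjective_pairing.
Qed.

Lemma gop_dy i j k l f p : L2 M f -> is_derive p.2 1 (fun t => gop f i j k l (p.1, t))
  (j%:R * gop f i j.-1 k l p - l%:R * gop f i j k l.-1 p - 2 * a * gop f i j.+1 k l p
    + 2 * b * gop f i j k l.+1 p).
Proof.
move=> lf; pose g (q : R * R) := mgauss i k p.1 q.1 * f q.
have E j' l' x : (fun q => mgauss j' l' x q.2 * g q) = (fun q => gker i j' k l' (p.1, x) q * f q).
  by apply/funext => q; rewrite /g /gker /=; ring.
have ih j' l' x : integr M (fun q => mgauss j' l' x q.2 * g q) by rewrite E; exact: gker_integr.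
have [C C0 HC] := mgauss_bound4 i k.
have ig x : integr M (fun q => gauss (b / 4) x q.2 * `|g q|).
  by apply: (mgauss_gauss_integr' (p := (p.1, x)) lf C0) => [|y]; [exact: measurable_mgauss|exact: HC].
have EE j' l' x : \int[M]_q (mgauss j' l' x q.2 * g q) = gop f i j' k l' (p.1, x).
  by rewrite /gop; apply: eq_Rintegral => q _; rewrite /g /gker /=; ring.
apply: (is_derive_tr (diff_mgauss j l p.2 ih ig)) => [x|]; first exact: EE.
by rewrite !EE -surjective_pairing.
Qed.

Lemma gop_mono i j k l f n m p : L2 M f -> p.1 ^+ n * p.2 ^+ m * gop f i j k l p = gop f (n + i) (m + j) k l p.
Proof.
move=> lf; rewrite /gop -RintegralZl//; last exact: gker_integr.
by apply: eq_Rintegral => q _; rewrite /gker -!mgauss_mulx; ring.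
Qed.

Definition idx4 := (nat * nat * (nat * nat))%type.

(** The family criterion applies with all four exponents free: derivatives shift them, and
    multiplication by a monomial in [p] only raises the first two, so that decay reduces to
    boundedness. *)
Lemma rschwartz_gop i j k l f : L2 M f -> rschwartz (gop f i j k l).
Proof.
move=> lf.
apply: (rschwartz_family (F := fun v : idx4 => gop f v.1.1 v.1.2 v.2.1 v.2.2) _ _ _ (i, j, (k, l))).
- move=> [[i' j'] [k' l']] /=.
  exists [:: (i'%:R, (i'.-1, j', (k', l'))); (- k'%:R, (i', j', (k'.-1, l')));
    (- 2 * a, (i'.+1, j', (k', l'))); (2 * b, (i', j', (k'.+1, l')))] => p.
  apply: (is_derive_tr (gop_dx i' j' k' l' p lf)) => //.
  by rewrite !lcomb_cons /lcomb big_nil /=; ring.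
- move=> [[i' j'] [k' l']] /=.
  exists [:: (j'%:R, (i', j'.-1, (k', l'))); (- l'%:R, (i', j', (k', l'.-1)));
    (- 2 * a, (i', j'.+1, (k', l'))); (2 * b, (i', j', (k', l'.+1)))] => p.
  apply: (is_derive_tr (gop_dy i' j' k' l' p lf)) => //.
  by rewrite !lcomb_cons /lcomb big_nil /=; ring.
- move=> [[i' j'] [k' l']] n m /=.
  have [C HC] := gop_bound (n + i') (m + j') k' l' lf.
  by exists C => p; rewrite gop_mono.
Qed.

Lemma gker_dx i j k l p q : is_derive q.1 1 (fun t => gker i j k l p (t, q.2))
  (k%:R * gker i j k.-1 l p q - 2 * b * gker i j k.+1 l p q).
Proof.
apply: (is_derive_tr (is_derive_mul (is_derive_hk' a b i k p.1 q.1) (is_derive_cst (mgauss j l p.2 q.2) q.1 1))) => //.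
by rewrite /gker /=; ring.
Qed.

Lemma gker_dy i j k l p q : is_derive q.2 1 (fun t => gker i j k l p (q.1, t))
  (l%:R * gker i j k l.-1 p q - 2 * b * gker i j k l.+1 p q).
Proof.
apply: (is_derive_tr (is_derive_mul (is_derive_cst (mgauss i k p.1 q.1) q.2 1) (is_derive_hk' a b j l p.2 q.2))) => //.
by rewrite /gker /=; ring.
Qed.

(** Regularity in the second variable, with [p] fixed: [i] and [j] stay constant and only the
    exponents of [q - p] move. *)
Lemma rschwartz_gker i j k l p : rschwartz (gker i j k l p).
Proof.
apply: (rschwartz_family (F := fun v : nat * nat => gker i j v.1 v.2 p) _ _ _ (k, l)).
- move=> [k' l'] /=.
  exists [:: (k'%:R, (k'.-1, l')); (- 2 * b, (k'.+1, l'))] => q.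
  apply: (is_derive_tr (gker_dx i j k' l' p q)) => //.
  by rewrite !lcomb_cons /lcomb big_nil /=; ring.
- move=> [k' l'] /=.
  exists [:: (l'%:R, (k', l'.-1)); (- 2 * b, (k', l'.+1))] => q.
  apply: (is_derive_tr (gker_dy i j k' l' p q)) => //.
  by rewrite !lcomb_cons /lcomb big_nil /=; ring.
- move=> [k' l'] n m /=.
  have [C C0 HC] := mgauss_bound_x' i k' n a0 b0; have [D D0 HD] := mgauss_bound_x' j l' m a0 b0.
  exists (C * D) => q; rewrite /gker mulrACA normrM; exact: ler_pM.
Qed.

End KernelOps.

(** * Commutators of the mollifiers *)

Section Commutators.
Context (R : realType) (n : nat).
Notation M := (mu2s R).
Notation a := (cutoff_rate R n).
Notation b := (heat_rate R n).
Notation V := ((gauss_mass b ^+ 2)^-1).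
Notation gkab := (gker a b).
Notation Kab := (gop a b).
Implicit Types (f g : R * R -> R) (p q : R * R).
Let a0 := cutoff_rate_gt0 R n.
Let b0 := heat_rate_gt0 R n.

Lemma molker_gker p q : molker n p q = V * gkab 0 0 0 0 p q.
Proof. by []. Qed.

Lemma mollify_gop f p : L2 M f -> mollify n f p = V * Kab f 0 0 0 0 p.
Proof.
move=> lf; rewrite /mollify /Kab -RintegralZl//; last exact: gker_integr.
by apply: eq_Rintegral => q _; rewrite molker_gker mulrA.
Qed.

Lemma rschwartzZ (c : R) f : rschwartz f -> rschwartz (fun p => c * f p).
Proof. by move=> /[dup] sf /(rschwartz_comb c 0 sf); congr rschwartz; apply/funext => p; rewrite mul0r addr0. Qed.

Lemma rschwartz_mollify f : L2 M f -> rschwartz (mollify n f).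
Proof.
move=> lf; rewrite (_ : mollify n f = (fun p => V * Kab f 0 0 0 0 p)).
  by apply: rschwartzZ; exact: rschwartz_gop.
by apply/funext => p; exact: mollify_gop.
Qed.

Lemma rschwartz_molker p : rschwartz (molker n p).
Proof. exact: (@rschwartzZ V (gkab 0 0 0 0 p) (rschwartz_gker a0 b0 0 0 0 0 p)). Qed.

Lemma px_mollify f p : L2 M f -> px (mollify n f) p = V * (2 * b * Kab f 0 0 1 0 p - 2 * a * Kab f 1 0 0 0 p).
Proof.
move=> lf; apply: px_is_derive.
apply: (is_derive_tr (is_deriveZ V (gop_dx a0 b0 0 0 0 0 p lf))) => [t|]; first by rewrite mollify_gop.
by rewrite /GRing.scale/=; ring.
Qed.

Lemma py_mollify f p : L2 M f -> py (mollify n f) p = V * (2 * b * Kab f 0 0 0 1 p - 2 * a * Kab f 0 1 0 0 p).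
Proof.
move=> lf; apply: py_is_derive.
apply: (is_derive_tr (is_deriveZ V (gop_dy a0 b0 0 0 0 0 p lf))) => [t|]; first by rewrite mollify_gop.
by rewrite /GRing.scale/=; ring.
Qed.

Lemma px_molker p q : px (molker n p) q = - V * (2 * b * gkab 0 0 1 0 p q).
Proof.
apply: px_is_derive; apply: (is_derive_tr (is_deriveZ V (gker_dx a b 0 0 0 0 p q))) => [t|]; first by rewrite molker_gker.
by rewrite /GRing.scale/=; ring.
Qed.

Lemma py_molker p q : py (molker n p) q = - V * (2 * b * gkab 0 0 0 1 p q).
Proof.
apply: py_is_derive; apply: (is_derive_tr (is_deriveZ V (gker_dy a b 0 0 0 0 p q))) => [t|]; first by rewrite molker_gker.
by rewrite /GRing.scale/=; ring.
Qed.

(* The kernel J(p, q) commutes with x up to the factor p.1 - q.1, and with d/dx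
   up to the derivative of the cutoff; [comX_E] and [comDx_E] below. *)
Definition comX f p := - V * Kab f 0 0 1 0 p.
Definition comY f p := - V * Kab f 0 0 0 1 p.
Definition comDx f p := - (2 * a) * V * Kab f 1 0 0 0 p.
Definition comDy f p := - (2 * a) * V * Kab f 0 1 0 0 p.

(** The product [q.1 * f q] need not be square-integrable, so the coordinate is attached to the
    kernel; writing q.1 = p.1 + (q.1 - p.1) leaves the kernel of [comX]. *)
Lemma comX_E f p : L2 M f -> comX f p = p.1 * mollify n f p - \int[M]_q (q.1 * molker n p q * f q).
Proof.
move=> lf.
have -> : \int[M]_q (q.1 * molker n p q * f q) = \int[M]_q (V * (gkab 1 0 0 0 p q * f q) + V * (gkab 0 0 1 0 p q * f q)).
  apply: eq_Rintegral => q _; rewrite molker_gker /gker.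
  rewrite (_ : q.1 * _ * _ = V * (q.1 * mgauss a b 0 0 p.1 q.1) * mgauss a b 0 0 p.2 q.2 * f q); last by ring.
  by rewrite mgauss_shift; ring.
have i1 := gker_integr a0 b0 1 0 0 0 p lf; have i2 := gker_integr a0 b0 0 0 1 0 p lf.
rewrite RintegralD//; [|exact: integrZ|exact: integrZ].
rewrite !RintegralZl// mollify_gop// -!/(Kab f _ _ _ _ p).
have <- : p.1 * Kab f 0 0 0 0 p = Kab f 1 0 0 0 p.
  by rewrite -(gop_mono a0 b0 0 0 0 0 1 0 p lf); ring.
by rewrite /comX; ring.
Qed.

Lemma comY_E f p : L2 M f -> comY f p = p.2 * mollify n f p - \int[M]_q (q.2 * molker n p q * f q).
Proof.
move=> lf.
have -> : \int[M]_q (q.2 * molker n p q * f q) = \int[M]_q (V * (gkab 0 1 0 0 p q * f q) + V * (gkab 0 0 0 1 p q * f q)).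
  apply: eq_Rintegral => q _; rewrite molker_gker /gker.
  rewrite (_ : q.2 * _ * _ = V * mgauss a b 0 0 p.1 q.1 * (q.2 * mgauss a b 0 0 p.2 q.2) * f q); last by ring.
  by rewrite mgauss_shift; ring.
have i1 := gker_integr a0 b0 0 1 0 0 p lf; have i2 := gker_integr a0 b0 0 0 0 1 p lf.
rewrite RintegralD//; [|exact: integrZ|exact: integrZ].
rewrite !RintegralZl// mollify_gop// -!/(Kab f _ _ _ _ p).
have <- : p.2 * Kab f 0 0 0 0 p = Kab f 0 1 0 0 p.
  by rewrite -(gop_mono a0 b0 0 0 0 0 0 1 p lf); ring.
by rewrite /comY; ring.
Qed.

(** The sign is + because the derivative of [f] has been moved to the kernel by parts. The
    derivatives of the heat kernel in [p] and in [q] cancel, and the derivative of the cutoff is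
    left. *)
Lemma comDx_E f p : L2 M f -> comDx f p = px (mollify n f) p + \int[M]_q (px (molker n p) q * f q).
Proof.
move=> lf; rewrite px_mollify//.
have -> : \int[M]_q (px (molker n p) q * f q) = \int[M]_q (- V * (2 * b) * (gkab 0 0 1 0 p q * f q)).
  by apply: eq_Rintegral => q _; rewrite px_molker; ring.
rewrite RintegralZl//; last exact: gker_integr.
by rewrite -/(Kab f _ _ _ _ p) /comDx; ring.
Qed.

Lemma comDy_E f p : L2 M f -> comDy f p = py (mollify n f) p + \int[M]_q (py (molker n p) q * f q).
Proof.
move=> lf; rewrite py_mollify//.
have -> : \int[M]_q (py (molker n p) q * f q) = \int[M]_q (- V * (2 * b) * (gkab 0 0 0 1 p q * f q)).
  by apply: eq_Rintegral => q _; rewrite py_molker; ring.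
rewrite RintegralZl//; last exact: gker_integr.
by rewrite -/(Kab f _ _ _ _ p) /comDy; ring.
Qed.

(** Schur's test with majorant of mass 2 / V, by [gauss_mass_half], and constant L V: the product is
    2 L, hence the factor 4 on squares. *)
Lemma scaled_schur (c L : R) i j k l f : 0 <= L ->
  (forall p q, `|c * gkab i j k l p q| <= L * V * gauss2 (b / 2) p q) -> L2 M f ->
  let F p := c * Kab f i j k l p in L2 M F /\ ip M F F <= 4 * L ^+ 2 * ip M f f.
Proof.
move=> L0 H lf F.
have b2 : 0 < b / 2 by rewrite divr_gt0.
have mk : measurable_fun setT (fun z : (R * R) * (R * R) => c * gkab i j k l z.1 z.2).
  by apply: measurable_funM => //; exact: measurable_gker.
have [h1 h2 h3] := schur (mu := M) (k := fun p q => c * gkab i j k l p q) (@measurable_gauss2 R _) (@gauss2_ge0 R _) (fun p q => gauss2_le1 p q b2)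
  (fun p => int_gauss2 p b2) (fun q => int_G2' q b2) mk H lf.
have E : F = (fun p => \int[M]_q (c * gkab i j k l p q * f q)).
  apply/funext => p; rewrite /F /gop -RintegralZl//; last exact: gker_integr.
  by apply: eq_Rintegral => q _; rewrite mulrA.
rewrite E; split; first exact: h2.
apply: (le_trans h3); rewrite gauss_mass_half// le_eqVlt; apply/orP; left; apply/eqP.
by field; rewrite gt_eqF// gauss_mass_gt0.
Qed.

Lemma gauss_half_le c x x' : 0 < c -> gauss c x x' <= gauss (c / 2) x x' :> R.
Proof.
move=> c0; rewrite ler_expR !mulNr lerN2 ler_wpM2r ?sqr_ge0//; have := c0; lra.
Qed.

Lemma expN_le1 c (x : R) : 0 <= c -> expR (- c * x ^+ 2) <= 1.
Proof. by move=> c0; rewrite -expR0 ler_expR mulNr oppr_le0 mulr_ge0 ?sqr_ge0. Qed.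

Lemma hk00_bound x x' : `|mgauss a b 0 0 x x'| <= gauss (b / 2) x x'.
Proof.
rewrite /mgauss !expr0 !mul1r normrM (ger0_norm (expR_ge0 _)) (ger0_norm (gauss_ge0 _ _ _)).
by apply: le_trans (gauss_half_le x x' b0); rewrite ler_piMl ?gauss_ge0// expN_le1// ltW.
Qed.

Lemma hk01_bound x x' : `|mgauss a b 0 1 x x'| <= (Num.sqrt b)^-1 * gauss (b / 2) x x'.
Proof.
rewrite /mgauss expr0 mul1r expr1 !normrM (ger0_norm (expR_ge0 _)) (ger0_norm (gauss_ge0 _ _ _)).
apply: le_trans (abs_gauss_sharp (x' - x) b0).
by rewrite -/(gauss b x x') ler_wpM2r ?gauss_ge0// ler_piMr// expN_le1// ltW.
Qed.

Lemma hk10_bound x x' : `|mgauss a b 1 0 x x'| <= (Num.sqrt a)^-1 * gauss (b / 2) x x'.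
Proof.
rewrite /mgauss expr0 mulr1 expr1 !normrM (ger0_norm (expR_ge0 _)) (ger0_norm (gauss_ge0 _ _ _)).
apply: ler_pM; rewrite ?gauss_ge0 ?mulr_ge0 ?expR_ge0// ?gauss_half_le//.
apply: (le_trans (abs_gauss_sharp x a0)).
by rewrite ler_piMr ?invr_ge0 ?sqrtr_ge0// expN_le1// divr_ge0// ltW.
Qed.

(** The common value of the squares of b^(-1/2) and 2 a^(1/2), by the two lemmas that follow. *)
Definition eps : R := 2 / n.+1%:R ^+ 2.

Lemma sqrtVb2 : (Num.sqrt b)^-1 ^+ 2 = eps.
Proof. by rewrite exprVn sqr_sqrtr ?ltW// /heat_rate /eps invf_div. Qed.

Lemma sqrta2 : (2 * a / Num.sqrt a) ^+ 2 = eps.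
Proof.
rewrite expr_div_n sqr_sqrtr ?ltW//.
have := a0; rewrite /cutoff_rate /eps invr_gt0 => h; have h2 : 2 * n.+1%:R ^+ 2 != 0 :> R by rewrite gt_eqF.
have m0 : n.+1%:R != 0 :> R by rewrite pnatr_eq0.
by move: n.+1%:R m0 => m m0; field.
Qed.

(** A factor [q - p] is worth b^(-1/2) against the heat kernel, and a factor [p] is worth a^(-1/2)
    against the cutoff; in the second case the prefactor 2 a leaves 2 a^(1/2). *)
Lemma com_bounds f : L2 M f ->
  [/\ L2 M (comX f) /\ ip M (comX f) (comX f) <= 4 * eps * ip M f f,
      L2 M (comY f) /\ ip M (comY f) (comY f) <= 4 * eps * ip M f f,
      L2 M (comDx f) /\ ip M (comDx f) (comDx f) <= 4 * eps * ip M f f &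
      L2 M (comDy f) /\ ip M (comDy f) (comDy f) <= 4 * eps * ip M f f].
Proof.
move=> lf; have V0 : 0 <= V := VI2V_ge0 b.
have sb : 0 <= (Num.sqrt b)^-1 by rewrite invr_ge0 sqrtr_ge0.
have sa : 0 <= 2 * a / Num.sqrt a by rewrite divr_ge0 ?sqrtr_ge0// mulr_ge0// ltW.
have a2 : 0 <= 2 * a by rewrite mulr_ge0// ltW.
split.
- rewrite -sqrtVb2; apply: scaled_schur => // p q.
  rewrite normrM normrN (ger0_norm V0) [_ * V]mulrC -mulrA ler_wpM2l//.
  rewrite normrM /gauss2 mulrA; exact: (ler_pM _ _ (hk01_bound _ _) (hk00_bound _ _)).
- rewrite -sqrtVb2; apply: scaled_schur => // p q.
  rewrite normrM normrN (ger0_norm V0) [_ * V]mulrC -mulrA ler_wpM2l//.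
  rewrite normrM /gauss2 mulrCA; exact: (ler_pM _ _ (hk00_bound _ _) (hk01_bound _ _)).
- rewrite -sqrta2; apply: scaled_schur => // p q.
  rewrite normrM normrM normrN (ger0_norm V0) (ger0_norm a2).
  have := ler_wpM2l (mulr_ge0 a2 V0) (ler_pM (normr_ge0 _) (normr_ge0 _) (hk10_bound p.1 q.1) (hk00_bound p.2 q.2)).
  by congr (_ <= _); rewrite ?normrM /gauss2; ring.
- rewrite -sqrta2; apply: scaled_schur => // p q.
  rewrite normrM normrM normrN (ger0_norm V0) (ger0_norm a2).
  have := ler_wpM2l (mulr_ge0 a2 V0) (ler_pM (normr_ge0 _) (normr_ge0 _) (hk00_bound p.1 q.1) (hk10_bound p.2 q.2)).
  by congr (_ <= _); rewrite ?normrM /gauss2; ring.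
Qed.

End Commutators.

Lemma eps_cvg (R : realType) (C e : R) : 0 <= C -> 0 < e -> \forall n \near \oo, C * eps R n < e.
Proof.
move=> C0 e0.
have h : C * (2 * (n.+1%:R^-1 * n.+1%:R^-1)) @[n --> \oo] --> C * (2 * ((0 : R) * 0)).
  apply: cvgM; [exact: cvg_cst|apply: cvgM; [exact: cvg_cst|]].
  by apply: cvgM; exact: cvg_harmonic.
rewrite !mulr0 in h; move/cvgrPdist_lt : h => /(_ _ e0); apply: filterS => n.
rewrite sub0r normrN => h; apply: (le_lt_trans _ h); apply: le_trans (ler_norm _).
by rewrite /eps expr2 invfM.
Qed.

(** * Integration by parts on the plane *)

Section ByParts.
Context (R : realType).
Notation M := (mu2s R).
Notation leb := (@lebesgue_measure R).
Implicit Types (f g : R * R -> R).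

Lemma w1_le_inv m : w1 (m.+1%:R : R) <= m.+1%:R^-1 /\ w1 (- m.+1%:R : R) <= m.+1%:R^-1.
Proof.
have h : m.+1%:R <= oneDsqr (m.+1%:R : R).
  by rewrite /oneDsqr; have : 1 <= m.+1%:R :> R by [rewrite ler1n]; nra.
have E : w1 (- m.+1%:R : R) = w1 m.+1%:R by rewrite /w1 /oneDsqr sqrrN.
by rewrite E /w1 lef_pV2 ?posrE// (lt_le_trans _ h).
Qed.

(** The fundamental theorem on [-(n+1), n+1] gives boundary terms of size at most 2 |C| / (n+1), as
    the weight at m is at most 1/m; dominated convergence identifies the limit of the integrals. *)
Lemma int_derive0 (u u' : R -> R) (C : R) : (forall x : R, is_derive x 1 u (u' x)) -> continuous u' ->
  (forall x, `|u x| <= C * w1 x) -> leb.-integrable setT (EFin \o u') ->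
  (\int[leb]_x (u' x)%:E = 0)%E.
Proof.
move=> du cu uC iu.
have mu' : measurable_fun setT u' by exact: continuous_measurable_fun.
(* With [n.+1] the interval is nondegenerate already at [n = 0]. *)
pose I n : set R := `[- n.+1%:R, n.+1%:R]%classic.
pose h n : R -> \bar R := (EFin \o u') \_ (I n).
have mI n : measurable (I n) by exact: measurable_itv.
have mh n : measurable_fun setT (h n).
  by apply/(measurable_restrictT _ (mI n))/measurable_EFinP; exact: (measurable_funTS mu').
have hc (x : R) : h ^~ x @ \oo --> (EFin \o u') x.
  apply: cvg_near_cst; exists (Num.bound `|x|) => // n /= hn.
  rewrite /h patchE mem_set// /I /= in_itv/= -ler_norml.
  rewrite (le_trans (ltW (archi_boundP (normr_ge0 x))))// ler_nat.
  exact: leqW.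
have ia : leb.-integrable setT (abse \o (EFin \o u')) by exact: integrable_abse.
have hle x n : (`|h n x| <= (abse \o (EFin \o u')) x)%E.
  by rewrite /h patchE; case: ifP => _ //=; rewrite normr0 lee_fin.
have [_ _ lim] := @dominated_convergence _ _ _ leb setT measurableT h (EFin \o u') (abse \o (EFin \o u'))
  mh (measurable_int _ iu) (aeW leb (fun x _ => hc x)) ia (aeW leb (fun x n _ => hle x n)).
have dc (x : R) : {for x, continuous u}.
  by apply: differentiable_continuous; apply/derivable1_diffP; exact: (@ex_derive _ _ _ _ _ _ _ (du x)).
have E n : (\int[leb]_x h n x = (u n.+1%:R - u (- n.+1%:R))%:E)%E.
  rewrite -integral_mkcond EFinB; apply: continuous_FTC2.
  - by rewrite gtrN// ltr0n.
  - by apply: continuous_subspaceT.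
  - split.
    + by move=> x _; exact: (@ex_derive _ _ _ _ _ _ _ (du x)).
    + exact/cvg_at_right_filter/dc.
    + exact/cvg_at_left_filter/dc.
  - by move=> x _; rewrite derive1E; apply: derive_val.
have {}lim : (u n.+1%:R - u (- n.+1%:R))%:E @[n --> \oo] --> (\int[leb]_x (EFin \o u') x)%E.
  by under eq_fun do rewrite -E; exact: lim.
have c0 : (u n.+1%:R - u (- n.+1%:R)) @[n --> \oo] --> (0 : R).
  have hh : 2 * `|C| * n.+1%:R^-1 @[n --> \oo] --> 2 * `|C| * (0 : R).
    by apply: cvgM; [exact: cvg_cst|exact: cvg_harmonic].
  rewrite mulr0 in hh.
  apply/cvgrPdistC_lt => e e0; move/cvgrPdist_lt : hh => /(_ _ e0); apply: filterS => n.
  rewrite sub0r normrN subr0 => hn; apply: (le_lt_trans _ hn); apply: le_trans (ler_norm _).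
  have [w w'] := w1_le_inv n.
  have B x : w1 x <= n.+1%:R^-1 -> `|u x| <= `|C| * n.+1%:R^-1.
    move=> hx; apply: (le_trans (uC x)); apply: ler_pM (ler_norm C) hx => //; last by rewrite ltW// w1_gt0.
    by have := le_trans (normr_ge0 _) (uC x); rewrite pmulr_lge0// w1_gt0.
  apply: (le_trans (ler_normB _ _)).
  by rewrite (_ : 2 * `|C| * _ = `|C| * n.+1%:R^-1 + `|C| * n.+1%:R^-1); [apply: lerD; exact: B|ring].
have c0E : (u n.+1%:R - u (- n.+1%:R))%:E @[n --> \oo] --> 0%:E by apply: cvg_EFin => //; exact: nearW.
by have := cvg_unique _ lim c0E; apply.
Qed.

Lemma prod_w2 (u v C D : R) p : `|u| <= C * w2 p -> `|v| <= D * w2 p -> `|u * v| <= C * D * w2 p.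
Proof.
move=> h1 h2; have w0 := w2_gt0 p; have w1' := w2_le1 p.
have C0 : 0 <= C by have := le_trans (normr_ge0 _) h1; rewrite pmulr_lge0.
have D0 : 0 <= D by have := le_trans (normr_ge0 _) h2; rewrite pmulr_lge0.
rewrite normrM; apply: (le_trans (ler_pM _ _ h1 h2)) => //.
rewrite (_ : C * w2 p * (D * w2 p) = C * D * w2 p * w2 p); last by ring.
by rewrite ler_piMr// (mulr_ge0 (mulr_ge0 C0 D0) (ltW w0)).
Qed.

Lemma w1_integrable : leb.-integrable setT (EFin \o (@w1 R)).
Proof.
apply: Rint_ge0_integr; first exact: measurable_w1.
  by move=> x; rewrite ltW// w1_gt0.
by rewrite w1_int ltry.
Qed.

Lemma section_integrable (h : R -> R) D : continuous h -> (forall x, `|h x| <= D * w1 x) ->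
  leb.-integrable setT (EFin \o h).
Proof.
move=> ch hD; apply: (integr_le (mu := leb) (continuous_measurable_fun ch) _ hD).
exact: (integrZ D w1_integrable).
Qed.

Lemma w2_section1 (C u x y : R) : `|u| <= C * w2 (x, y) -> `|u| <= C * w1 x.
Proof.
move=> h; have C0 : 0 <= C by have := le_trans (normr_ge0 _) h; rewrite pmulr_lge0// w2_gt0.
by apply: (le_trans h); rewrite ler_wpM2l// /w2/= ler_piMr ?w1_le1// ltW// w1_gt0.
Qed.

Lemma w2_section2 (C u x y : R) : `|u| <= C * w2 (x, y) -> `|u| <= C * w1 y.
Proof.
move=> h; have C0 : 0 <= C by have := le_trans (normr_ge0 _) h; rewrite pmulr_lge0// w2_gt0.
by apply: (le_trans h); rewrite ler_wpM2l// /w2/= ler_piMl ?w1_le1// ltW// w1_gt0.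
Qed.

(** Fubini with the integral in [x] innermost, where [int_derive0] applies on every horizontal line;
    domination by [w2] ensures both Fubini and the one-dimensional decay. *)
Lemma int_dx0 (h hx : R * R -> R) (C D : R) : (forall p : R * R, is_derive p.1 1 (fun t => h (t, p.2)) (hx p)) ->
  continuous hx -> (forall p, `|h p| <= C * w2 p) -> (forall p, `|hx p| <= D * w2 p) ->
  \int[M]_p hx p = 0.
Proof.
move=> dh ch hC hD.
have ih : integr M hx.
  exact: (integr_le (mu := M) (continuous2_measurable ch) (integrZ D (@w2_integr R)) hD).
rewrite /Rintegral; have := integral21_prod_meas1 (m1 := leb) (m2 := leb) ih.
rewrite (_ : (\int[_ \x _]_z _ = \int[M]_x (hx x)%:E)%E) => [<-|//].
rewrite (_ : (\int[leb]_x _ = 0)%E)//; apply: integral0_eq => y _.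
have cy : continuous (fun x => hx (x, y)).
  by move=> x; apply: (cvg_comp _ hx (cvg_pair cvg_id (cvg_cst y))); exact: ch.
apply: (int_derive0 (u := fun x => h (x, y)) (C := C)) => //.
- by move=> x; exact: (dh (x, y)).
- by move=> x; exact: (w2_section1 (hC (x, y))).
- by apply: (section_integrable (D := D) cy) => x; exact: (w2_section1 (hD (x, y))).
Qed.

Lemma int_dy0 (h hy : R * R -> R) (C D : R) : (forall p : R * R, is_derive p.2 1 (fun t => h (p.1, t)) (hy p)) ->
  continuous hy -> (forall p, `|h p| <= C * w2 p) -> (forall p, `|hy p| <= D * w2 p) ->
  \int[M]_p hy p = 0.
Proof.
move=> dh ch hC hD.
have ih : integr M hy.
  exact: (integr_le (mu := M) (continuous2_measurable ch) (integrZ D (@w2_integr R)) hD).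
rewrite /Rintegral; have := integral12_prod_meas1 (m1 := leb) (m2 := leb) ih.
rewrite (_ : (\int[_ \x _]_z _ = \int[M]_x (hy x)%:E)%E) => [<-|//].
rewrite (_ : (\int[leb]_x _ = 0)%E)//; apply: integral0_eq => x _.
have cx : continuous (fun y => hy (x, y)).
  by move=> y; apply: (cvg_comp _ hy (cvg_pair (cvg_cst x) cvg_id)); exact: ch.
apply: (int_derive0 (u := fun y => h (x, y)) (C := C)) => //.
- by move=> y; exact: (dh (x, y)).
- by move=> y; exact: (w2_section2 (hC (x, y))).
- by apply: (section_integrable (D := D) cx) => y; exact: (w2_section2 (hD (x, y))).
Qed.

Lemma rschwartz_w2_0 f : rschwartz f -> exists C : R, forall p, `|f p| <= C * w2 p.
Proof. by move=> /(rschwartz_w2 0 0) [C HC]; exists C => p; have := HC p; rewrite !expr0 !mul1r. Qed.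

(** The derivative of [f * g] has integral 0; products of Schwartz functions inherit a bound by [w2]
    from [prod_w2]. *)
Lemma ip_px f g : rschwartz f -> rschwartz g -> ip M (px f) g = - ip M f (px g).
Proof.
move=> sf sg; have sfx := rschwartz_px sf; have sgx := rschwartz_px sg.
have [C1 H1] := rschwartz_w2_0 sf; have [C2 H2] := rschwartz_w2_0 sg.
have [C3 H3] := rschwartz_w2_0 sfx; have [C4 H4] := rschwartz_w2_0 sgx.
have := int_dx0 (h := fun p => f p * g p) (hx := fun p => f p * px g p + g p * px f p)
  (C := C1 * C2) (D := C1 * C4 + C2 * C3).
rewrite RintegralD//; last 2 first.
- exact: (integr_mul (rschwartz_L2 sf) (rschwartz_L2 sgx)).
- exact: (integr_mul (rschwartz_L2 sg) (rschwartz_L2 sfx)).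
have -> : ip M (px f) g = ip M g (px f) := ipC M _ _; move=> H; apply/eqP; rewrite -addr_eq0 addrC; apply/eqP; apply: H.
- by move=> [x y]; exact: (is_derive_mul (rschwartz_dx (x, y) sf) (rschwartz_dx (x, y) sg)).
- move=> p; apply: cvgD; apply: cvgM; exact: rschwartz_continuous.
- by move=> p; exact: prod_w2.
- move=> p; rewrite mulrDl; apply: (le_trans (ler_normD _ _)); apply: lerD; exact: prod_w2.
Qed.

Lemma ip_py f g : rschwartz f -> rschwartz g -> ip M (py f) g = - ip M f (py g).
Proof.
move=> sf sg; have sfx := rschwartz_py sf; have sgx := rschwartz_py sg.
have [C1 H1] := rschwartz_w2_0 sf; have [C2 H2] := rschwartz_w2_0 sg.
have [C3 H3] := rschwartz_w2_0 sfx; have [C4 H4] := rschwartz_w2_0 sgx.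
have := int_dy0 (h := fun p => f p * g p) (hy := fun p => f p * py g p + g p * py f p)
  (C := C1 * C2) (D := C1 * C4 + C2 * C3).
rewrite RintegralD//; last 2 first.
- exact: (integr_mul (rschwartz_L2 sf) (rschwartz_L2 sgx)).
- exact: (integr_mul (rschwartz_L2 sg) (rschwartz_L2 sfx)).
have -> : ip M (py f) g = ip M g (py f) := ipC M _ _; move=> H; apply/eqP; rewrite -addr_eq0 addrC; apply/eqP; apply: H.
- by move=> [x y]; exact: (is_derive_mul (rschwartz_dy (x, y) sf) (rschwartz_dy (x, y) sg)).
- move=> p; apply: cvgD; apply: cvgM; exact: rschwartz_continuous.
- by move=> p; exact: prod_w2.
- move=> p; rewrite mulrDl; apply: (le_trans (ler_normD _ _)); apply: lerD; exact: prod_w2.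
Qed.

End ByParts.

Local Open Scope complex_scope.

(** * Waves and spinors *)

Section Lfun2.
Context d (T : measurableType d) (R : realType) (mu : {measure set T -> \bar R}).

Lemma Lfun2P (f : T -> R) : f \in Lfun mu 2%:E <-> L2 mu f.
Proof.
split=> [hf|[mf hf]].
  split; last exact: Lfun2_integrable_sqr.
  by move: hf; rewrite inE => /andP[]; rewrite inE.
rewrite inE; apply/andP; split; rewrite inE//= /finite_norm unlock poweR_lty//.
have /integrableP[_] := hf; congr (_ < _)%E; apply: eq_integral => x _ /=.
by rewrite powR_mulrn// -normrX.
Qed.

Lemma ae_comp U V (k : U -> V) (f g : T -> U) : f = g %[ae mu] -> (k \o f) = (k \o g) %[ae mu].
Proof. by apply: filterS => x h /h /= ->. Qed.

Lemma ae_comp2 U U' V (k : U -> U' -> V) (f g : T -> U) (f' g' : T -> U') : f = g %[ae mu] -> f' = g' %[ae mu] ->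
  (fun x => k (f x) (f' x)) = (fun x => k (g x) (g' x)) %[ae mu].
Proof. by apply: filterS2 => x h h' xT; rewrite h// h'. Qed.

Lemma ae_subr0 (U : zmodType) (f g : T -> U) : (fun x => f x - g x) = (fun=> 0) %[ae mu] -> f = g %[ae mu].
Proof. by apply: filterS => x h /h /eqP; rewrite subr_eq0 => /eqP. Qed.

End Lfun2.

(** * The Hilbert space structure of complex waves, from real and imaginary parts *)

Section ComplexL2.
Context (R : realType).
Notation M := (mu2s R).
Notation reo f := (@complex.Re R \o f).
Notation imo f := (@complex.Im R \o f).
Implicit Types (f g h : wave R) (z : R[i]).

Definition sqint f := L2 M (reo f) /\ L2 M (imo f).
(** The squared modulus as a real number, whereas the norm of [R[i]] takes values in [R[i]]. *)
Definition nsq z : R := complex.Re z ^+ 2 + complex.Im z ^+ 2.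
Definition nrm2 f : R := ip M (reo f) (reo f) + ip M (imo f) (imo f).
Definition wave_of (a b : R * R -> R) : wave R := fun p => a p +i* b p.

Lemma isL2P f : isL2 f <-> sqint f.
Proof.
split=> [[/Lfun2P h1 /Lfun2P h2]|[h1 h2]]; first by split.
by split; apply/Lfun2P.
Qed.

Lemma complexP z z' : complex.Re z = complex.Re z' -> complex.Im z = complex.Im z' -> z = z'.
Proof. by case: z => a b; case: z' => a' b' /= -> ->. Qed.

Lemma ReD z z' : complex.Re (z + z') = complex.Re z + complex.Re z'.
Proof. by case: z => a b; case: z'. Qed.
Lemma ImD z z' : complex.Im (z + z') = complex.Im z + complex.Im z'.
Proof. by case: z => a b; case: z'. Qed.
Lemma ReN z : complex.Re (- z) = - complex.Re z.
Proof. by case: z. Qed.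
Lemma ImN z : complex.Im (- z) = - complex.Im z.
Proof. by case: z. Qed.
Lemma ReM z z' : complex.Re (z * z') = complex.Re z * complex.Re z' - complex.Im z * complex.Im z'.
Proof. by case: z => a b; case: z'. Qed.
Lemma ImM z z' : complex.Im (z * z') = complex.Re z * complex.Im z' + complex.Im z * complex.Re z'.
Proof. by case: z => a b; case: z'. Qed.
Lemma ReC z : complex.Re (conjc z) = complex.Re z.
Proof. by case: z. Qed.
Lemma ImC z : complex.Im (conjc z) = - complex.Im z.
Proof. by case: z. Qed.
Definition ReImE := (ReD, ImD, ReN, ImN, ReM, ImM, ReC, ImC).

Lemma nsq_ge0 z : 0 <= nsq z.
Proof. by rewrite addr_ge0 ?sqr_ge0. Qed.

Lemma nsqD z z' : nsq (z + z') <= 2 * nsq z + 2 * nsq z'.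
Proof.
rewrite /nsq !ReImE; case: z z' => a b [c d] /=.
by have := sqr_ge0 (a - c); have := sqr_ge0 (b - d); nra.
Qed.

Lemma nsqN z : nsq (- z) = nsq z.
Proof. by rewrite /nsq !ReImE !sqrrN. Qed.

Lemma nsqB z z' : nsq (z - z') <= 2 * nsq z + 2 * nsq z'.
Proof. by rewrite -(nsqN z') nsqD. Qed.

(** The form in which limits are taken in identities between scalar products: it suffices to bound
    the squared defect by a fixed multiple of every positive [e]. *)
Lemma nsq_small z K : (forall e : R, 0 < e -> nsq z <= K * e) -> z = 0.
Proof.
move=> h; have z0 : nsq z <= 0.
  apply/ler_addgt0Pr => e e0; rewrite add0r.
  have K1 : 0 < `|K| + 1 by rewrite ltr_wpDl.
  apply: (le_trans (h _ (divr_gt0 e0 K1))); rewrite mulrCA ler_piMr ?(ltW e0)//.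
  by rewrite ler_pdivrMr// mul1r (le_trans (ler_norm K))// lerDl.
move: z0; rewrite /nsq => z0; apply: complexP => /=; apply/eqP; rewrite -sqrf_eq0 eq_le sqr_ge0 andbT.
  by apply: (le_trans _ z0); rewrite lerDl sqr_ge0.
by apply: (le_trans _ z0); rewrite lerDr sqr_ge0.
Qed.

Lemma reoD f g : reo (f \+ g) = (fun p => reo f p + reo g p).
Proof. by apply/funext => p; rewrite /= ReD. Qed.
Lemma imoD f g : imo (f \+ g) = (fun p => imo f p + imo g p).
Proof. by apply/funext => p; rewrite /= ImD. Qed.
Lemma reoB f g : reo (f \- g) = (fun p => reo f p - reo g p).
Proof. by apply/funext => p; rewrite /= ReD ReN. Qed.
Lemma imoB f g : imo (f \- g) = (fun p => imo f p - imo g p).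
Proof. by apply/funext => p; rewrite /= ImD ImN. Qed.
Lemma reoZ z f : reo (z \*o f) = (fun p => complex.Re z * reo f p - complex.Im z * imo f p).
Proof. by apply/funext => p; rewrite /= ReM. Qed.
Lemma imoZ z f : imo (z \*o f) = (fun p => complex.Re z * imo f p + complex.Im z * reo f p).
Proof. by apply/funext => p; rewrite /= ImM. Qed.

Lemma sqintD f g : sqint f -> sqint g -> sqint (f \+ g).
Proof.
move=> [f1 f2] [g1 g2]; split; rewrite ?reoD ?imoD; exact: (L2D (mu := M)).
Qed.
Lemma sqintB f g : sqint f -> sqint g -> sqint (f \- g).
Proof.
move=> [f1 f2] [g1 g2]; split; rewrite ?reoB ?imoB; exact: (L2B (mu := M)).
Qed.
Lemma sqintZ z f : sqint f -> sqint (z \*o f).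
Proof.
move=> [f1 f2]; split; rewrite ?reoZ ?imoZ.
  by apply: (L2B (mu := M)); exact: (L2Z (mu := M)).
by apply: (L2D (mu := M)); exact: (L2Z (mu := M)).
Qed.
Lemma sqint_0 : sqint (fun=> 0).
Proof. by split; exact: (L2_0 M). Qed.

Lemma dotL2E f g : sqint f -> sqint g ->
  dotL2 f g = (ip M (reo f) (reo g) + ip M (imo f) (imo g)) +i*
              (ip M (reo f) (imo g) - ip M (imo f) (reo g)).
Proof.
move=> [f1 f2] [g1 g2].
have i11 := integr_mul (mu := M) f1 g1; have i22 := integr_mul (mu := M) f2 g2.
have i12 := integr_mul (mu := M) f1 g2; have i21 := integr_mul (mu := M) f2 g1.
apply: complexP => /=.
- rewrite /ip -(RintegralD (mu := M) measurableT i11 i22).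
  by apply: eq_Rintegral => p _; rewrite !ReImE/=; ring.
- rewrite /ip -(RintegralB (mu := M) measurableT i12 i21).
  by apply: eq_Rintegral => p _; rewrite !ReImE/=; ring.
Qed.

Lemma dotL2C f g : sqint f -> sqint g -> dotL2 g f = conjc (dotL2 f g).
Proof.
move=> hf hg; rewrite !dotL2E//; apply: complexP => /=.
  by rewrite (ipC M (reo g)) (ipC M (imo g)).
by rewrite (ipC M (reo g)) (ipC M (imo g)); ring.
Qed.

Lemma nrm2E f : sqint f -> nrm2 f = complex.Re (dotL2 f f).
Proof. by move=> hf; rewrite dotL2E. Qed.

Lemma dotL2Dl f g h : sqint f -> sqint g -> sqint h -> dotL2 (f \+ g) h = dotL2 f h + dotL2 g h.
Proof.
move=> hf hg hh; have hfg := sqintD hf hg; rewrite !dotL2E// reoD imoD.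
case: hf hg hh => [f1 f2] [g1 g2] [h1 h2].
by rewrite !(ipDl (mu := M))//; apply: complexP => /=; ring.
Qed.

Lemma dotL2Dr f g h : sqint f -> sqint g -> sqint h -> dotL2 h (f \+ g) = dotL2 h f + dotL2 h g.
Proof.
move=> hf hg hh; have hfg := sqintD hf hg.
by rewrite (dotL2C hfg hh) dotL2Dl// (dotL2C hf hh) (dotL2C hg hh) rmorphD.
Qed.

Lemma dotL2Zl z f h : sqint f -> sqint h -> dotL2 (z \*o f) h = conjc z * dotL2 f h.
Proof.
move=> hf hh; have hzf := sqintZ z hf; rewrite !dotL2E// reoZ imoZ.
case: hf hh => [f1 f2] [h1 h2].
have L k u : L2 M u -> L2 M (fun x => k * u x) by exact: (L2Z (mu := M)).
rewrite !(ipBl (mu := M)) ?(ipDl (mu := M)) ?(ipZl (mu := M))//; try exact: L.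
by apply: complexP; rewrite !ReImE /=; ring.
Qed.

Lemma dotL2Zr z f h : sqint f -> sqint h -> dotL2 h (z \*o f) = z * dotL2 h f.
Proof.
move=> hf hh; have hzf := sqintZ z hf.
by rewrite (dotL2C hzf hh) dotL2Zl// (dotL2C hf hh) rmorphM /= conjcK.
Qed.

Lemma subE f g : f \- g = f \+ ((-1) \*o g).
Proof. by apply/funext => p /=; rewrite mulN1r. Qed.

Lemma dotL2Bl f g h : sqint f -> sqint g -> sqint h -> dotL2 (f \- g) h = dotL2 f h - dotL2 g h.
Proof.
move=> hf hg hh; rewrite subE dotL2Dl//; last exact: sqintZ.
by rewrite dotL2Zl// rmorphN1 mulN1r.
Qed.

Lemma nrm2_ge0 f : 0 <= nrm2 f.
Proof. by rewrite addr_ge0 ?(ip_ge0 M). Qed.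

Lemma nrm2D f g : sqint f -> sqint g -> nrm2 (f \+ g) <= 2 * nrm2 f + 2 * nrm2 g.
Proof.
move=> [f1 f2] [g1 g2]; rewrite /nrm2 reoD imoD.
by have := ip_sqrD (mu := M) f1 g1; have := ip_sqrD (mu := M) f2 g2; lra.
Qed.

Lemma nrm2Z z f : sqint f -> nrm2 (z \*o f) = nsq z * nrm2 f.
Proof.
move=> hf; have hzf := sqintZ z hf.
rewrite nrm2E// dotL2Zl// dotL2Zr// mulrA ReM -nrm2E// !ReImE /nsq.
ring.
Qed.

Lemma nrm2B f g : sqint f -> sqint g -> nrm2 (f \- g) <= 2 * nrm2 f + 2 * nrm2 g.
Proof.
move=> hf hg; have := nrm2D hf (sqintZ (-1) hg); rewrite -subE nrm2Z// /nsq !ReImE/=.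
by rewrite (_ : (- 1) ^+ 2 + (- 0) ^+ 2 = 1 :> R) ?mul1r//; ring.
Qed.

(** Real Cauchy-Schwarz on the four pairs of components. The constants here and in [dotH_CS] are not
    sharp; they only serve to pass to limits. *)
Lemma dotL2_CS f g : sqint f -> sqint g -> nsq (dotL2 f g) <= 4 * (nrm2 f * nrm2 g).
Proof.
move=> hf hg; rewrite dotL2E// /nsq /nrm2 /=; case: hf hg => [f1 f2] [g1 g2].
have c11 := ip_CS (mu := M) f1 g1; have c22 := ip_CS (mu := M) f2 g2.
have c12 := ip_CS (mu := M) f1 g2; have c21 := ip_CS (mu := M) f2 g1.
have sq (x y : R) : (x + y) ^+ 2 <= 2 * x ^+ 2 + 2 * y ^+ 2 by have := sqr_ge0 (x - y); nra.
have s1 := sq (ip M (reo f) (reo g)) (ip M (imo f) (imo g)).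
have s2 := sq (ip M (reo f) (imo g)) (- ip M (imo f) (reo g)).
have a1 := ip_ge0 M (reo f); have a2 := ip_ge0 M (imo f).
have b1 := ip_ge0 M (reo g); have b2 := ip_ge0 M (imo g).
have := mulr_ge0 a1 b1; have := mulr_ge0 a1 b2; have := mulr_ge0 a2 b1; have := mulr_ge0 a2 b2.
rewrite sqrrN in s2; lra.
Qed.

Lemma dotL2_ae f g h : sqint f -> sqint g -> sqint h -> f = g %[ae mu2 R] -> dotL2 f h = dotL2 g h.
Proof.
move=> hf hg hh e; rewrite !dotL2E//; case: hf hg hh => [f1 f2] [g1 g2] [h1 h2].
have E l : L2 M l -> ip M (reo f) l = ip M (reo g) l /\ ip M (imo f) l = ip M (imo g) l.
  by move=> hl; split; apply: (ip_ae (mu := M)) => //; exact: (ae_comp (mu := M) _ e).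
by rewrite !(E _ h1).1 !(E _ h1).2 !(E _ h2).1 !(E _ h2).2.
Qed.

Lemma nrm2_eq0 f : sqint f -> nrm2 f = 0 -> f = (fun=> 0) %[ae mu2 R].
Proof.
move=> [f1 f2] /eqP; rewrite paddr_eq0 ?(ip_ge0 M)// => /andP[/eqP h1 /eqP h2].
have e1 := ip_eq0 (mu := M) f1 h1; have e2 := ip_eq0 (mu := M) f2 h2.
by apply: filterS2 e1 e2 => p /= E1 E2 _; apply: complexP; [exact: E1|exact: E2].
Qed.

End ComplexL2.

(** * Complex Schwartz functions through real and imaginary parts *)

Section SchwartzBridge.
Context (R : realType).
Notation reo f := (@complex.Re R \o f).
Notation imo f := (@complex.Im R \o f).
Implicit Types (f g h : wave R) (z : R[i]).

Lemma partialsE w f : partials w f = wave_of (rpart w (reo f)) (rpart w (imo f)).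
Proof.
elim: w => [|c w IH]; first by apply/funext => p; apply: complexP.
by rewrite /partials /= -/(partials w f) IH; case: c; apply/funext => p; apply: complexP.
Qed.

Lemma norm_realM (t : R) z : `|t%:C * z| = (Num.sqrt ((t * complex.Re z) ^+ 2 + (t * complex.Im z) ^+ 2))%:C.
Proof.
case: z => a b; rewrite normc_def /=; congr ((Num.sqrt _)%:C); ring.
Qed.

(** Derivatives are defined componentwise, and the modulus lies between each component and the sum
    of their absolute values. *)
Lemma schwartzP f : schwartz f <-> rschwartz (reo f) /\ rschwartz (imo f).
Proof.
split=> [[sm bd]|[[h1 b1] [h2 b2]]].
  split; split=> [w|w a b].
  - have := sm w; rewrite partialsE => -[c1 _ d1 d2]; split=> [|p|p]; [exact: c1|exact: (d1 p).1|exact: (d2 p).1].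
  - have [C HC] := bd w a b; exists C => p; have := HC p; rewrite partialsE norm_realM lecR; apply: le_trans.
    by rewrite -sqrtr_sqr ler_wsqrtr// lerDl sqr_ge0.
  - have := sm w; rewrite partialsE => -[_ c1 d1 d2]; split=> [|p|p]; [exact: c1|exact: (d1 p).2|exact: (d2 p).2].
  - have [C HC] := bd w a b; exists C => p; have := HC p; rewrite partialsE norm_realM lecR; apply: le_trans.
    by rewrite -sqrtr_sqr ler_wsqrtr// lerDr sqr_ge0.
split=> [w|w a b].
  rewrite partialsE; have [c1 x1 y1] := h1 w; have [c2 x2 y2] := h2 w.
  by split; [exact: c1|exact: c2|move=> p; split; [exact: x1|exact: x2]|move=> p; split; [exact: y1|exact: y2]].
have [C1 H1] := b1 w a b; have [C2 H2] := b2 w a b; exists (C1 + C2) => p.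
rewrite partialsE norm_realM lecR /=.
have k1 := H1 p; have k2 := H2 p.
set x := _ * rpart w (reo f) p in k1 *; set y := _ * rpart w (imo f) p in k2 *.
apply: (le_trans _ (lerD k1 k2)).
rewrite -(ger0_norm (addr_ge0 (normr_ge0 x) (normr_ge0 y))) -sqrtr_sqr ler_wsqrtr//.
have ex : `|x| ^+ 2 = x ^+ 2 := real_normK (num_real x).
have ey : `|y| ^+ 2 = y ^+ 2 := real_normK (num_real y).
by rewrite sqrrD ex ey; have := mulr_ge0 (normr_ge0 x) (normr_ge0 y); lra.
Qed.

Lemma schwartz_sqint f : schwartz f -> sqint f.
Proof. by move=> /schwartzP[h1 h2]; split; exact: rschwartz_L2. Qed.

End SchwartzBridge.

(** * Spinors, closures and adjoints of symmetric operators *)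

Section Spinors.
Context (R : realType).
Implicit Types (psi phi chi u v : spinor R) (a z : R[i]) (f g : wave R).

(** A squared norm: [distH] is the square root of its value on a difference. *)
Definition nrmH psi : R := \sum_(j < 2) nrm2 (psi j).
Notation "psi -- phi" := (fun j => psi j \- phi j) (at level 50).
Notation comb a psi phi := (fun j => (a \*o psi j) \+ phi j).

Lemma isHP psi : isH psi <-> forall j, sqint (psi j).
Proof. by split=> h j; apply/isL2P. Qed.

Lemma isHB psi phi : isH psi -> isH phi -> isH (psi -- phi).
Proof. by move=> /isHP h /isHP h'; apply/isHP => j; exact: sqintB. Qed.

Lemma isH_comb a psi phi : isH psi -> isH phi -> isH (comb a psi phi).
Proof. by move=> /isHP h /isHP h'; apply/isHP => j; apply: sqintD => //; exact: sqintZ. Qed.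

Lemma nrmH_ge0 psi : 0 <= nrmH psi.
Proof. by apply: sumr_ge0 => j _; exact: nrm2_ge0. Qed.

Lemma dotHC psi phi : isH psi -> isH phi -> dotH phi psi = conjc (dotH psi phi).
Proof.
move=> /isHP h /isHP h'; rewrite /dotH rmorph_sum /=; apply: eq_bigr => j _.
exact: dotL2C.
Qed.

Lemma nrmHE psi : isH psi -> nrmH psi = complex.Re (dotH psi psi).
Proof.
by move=> /isHP h; rewrite /nrmH /dotH !big_ord_recl !big_ord0 !ReImE /= !addr0 !nrm2E.
Qed.

Lemma dotHBl psi phi chi : isH psi -> isH phi -> isH chi ->
  dotH (psi -- phi) chi = dotH psi chi - dotH phi chi.
Proof.
move=> /isHP h /isHP h' /isHP h''; rewrite /dotH -sumrB; apply: eq_bigr => j _.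
exact: dotL2Bl.
Qed.

Lemma nrmH_comb a psi phi : isH psi -> isH phi ->
  nrmH (comb a psi phi) <= 2 * nsq a * nrmH psi + 2 * nrmH phi.
Proof.
move=> /isHP h /isHP h'; rewrite /nrmH !mulr_sumr -big_split; apply: ler_sum => j _ /=.
by apply: (le_trans (nrm2D (sqintZ a (h j)) (h' j))); rewrite nrm2Z// mulrA.
Qed.

Lemma nrmHB psi phi : isH psi -> isH phi ->
  nrmH (psi -- phi) <= 2 * nrmH psi + 2 * nrmH phi.
Proof.
move=> /isHP h /isHP h'; rewrite /nrmH !mulr_sumr -big_split; apply: ler_sum => j _ /=.
exact: nrm2B.
Qed.

Lemma dotH_CS psi phi : isH psi -> isH phi -> nsq (dotH psi phi) <= 8 * (nrmH psi * nrmH phi).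
Proof.
move=> /isHP h /isHP h'; rewrite /nrmH /dotH !big_ord_recl !big_ord0 !addr0.
apply: (le_trans (nsqD _ _)).
have H j := dotL2_CS (h j) (h' j).
apply: (le_trans (lerD (ler_wpM2l _ (H _)) (ler_wpM2l _ (H _)))) => //.
have p j := nrm2_ge0 (psi j); have q j := nrm2_ge0 (phi j).
move: (p ord0) (p (lift ord0 ord0)) (q ord0) (q (lift ord0 ord0)).
move: (nrm2 _) (nrm2 _) (nrm2 _) (nrm2 _) => x y x' y' x0 y0 x0' y0'.
by have := mulr_ge0 x0 y0'; have := mulr_ge0 y0 x0'; lra.
Qed.

Lemma eqH_refl psi : isH psi -> eqH psi psi.
Proof. by move=> h j; split; [exact: h|exact: h|exact: aeW]. Qed.

Lemma eqL2_sym f g : eqL2 f g -> eqL2 g f.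
Proof. by move=> [h1 h2 e]; split=> //; exact: (ae_eq_sym (mu := mu2s R)). Qed.

Lemma eqL2_trans f g h : eqL2 f g -> eqL2 g h -> eqL2 f h.
Proof. by move=> [h1 h2 e] [k1 k2 e']; split=> //; exact: (ae_eq_trans (mu := mu2s R) e e'). Qed.

Lemma eqH_sym psi phi : eqH psi phi -> eqH phi psi.
Proof. by move=> h j; exact: eqL2_sym. Qed.

Lemma eqH_trans psi phi chi : eqH psi phi -> eqH phi chi -> eqH psi chi.
Proof. by move=> h h' j; exact: eqL2_trans (h j) (h' j). Qed.

Lemma eqH_isH psi phi : eqH psi phi -> isH psi /\ isH phi.
Proof. by move=> h; split=> j; have [] := h j. Qed.

Lemma eqL2D f f' g g' : eqL2 f f' -> eqL2 g g' -> eqL2 (f \+ g) (f' \+ g').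
Proof.
move=> [/isL2P h1 /isL2P h2 e] [/isL2P k1 /isL2P k2 e']; split; [apply/isL2P; exact: sqintD|apply/isL2P; exact: sqintD|].
exact: (ae_comp2 (mu := mu2s R) (fun x y => x + y) e e').
Qed.

Lemma eqL2B f f' g g' : eqL2 f f' -> eqL2 g g' -> eqL2 (f \- g) (f' \- g').
Proof.
move=> [/isL2P h1 /isL2P h2 e] [/isL2P k1 /isL2P k2 e']; split; [apply/isL2P; exact: sqintB|apply/isL2P; exact: sqintB|].
exact: (ae_comp2 (mu := mu2s R) (fun x y => x - y) e e').
Qed.

Lemma eqL2Z a f f' : eqL2 f f' -> eqL2 (a \*o f) (a \*o f').
Proof.
move=> [/isL2P h1 /isL2P h2 e]; split; [apply/isL2P; exact: sqintZ|apply/isL2P; exact: sqintZ|].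
exact: (ae_comp (mu := mu2s R) (fun x => a * x) e).
Qed.

Lemma eqH_comb a psi psi' phi phi' : eqH psi psi' -> eqH phi phi' -> eqH (comb a psi phi) (comb a psi' phi').
Proof. by move=> h h' j; apply: eqL2D => //; exact: eqL2Z. Qed.

Lemma eqHB psi psi' phi phi' : eqH psi psi' -> eqH phi phi' -> eqH (psi -- phi) (psi' -- phi').
Proof. by move=> h h' j; apply: eqL2B. Qed.

Lemma dotH_eql psi phi chi : eqH psi phi -> isH chi -> dotH psi chi = dotH phi chi.
Proof.
move=> h /isHP h'; apply: eq_bigr => j _; have [/isL2P h1 /isL2P h2 e] := h j.
exact: dotL2_ae.
Qed.

Lemma dotH_eqr psi phi chi : eqH psi phi -> isH chi -> dotH chi psi = dotH chi phi.
Proof.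
move=> h h'; have [h1 h2] := eqH_isH h.
by rewrite (dotHC h1 h') (dotH_eql h h') -dotHC.
Qed.

Lemma nrmH_eq psi phi : eqH psi phi -> nrmH psi = nrmH phi.
Proof.
move=> h; have [h1 h2] := eqH_isH h.
by rewrite !nrmHE// (dotH_eql h h1) (dotH_eqr h h2).
Qed.

Lemma nrmH_eq0 psi phi : isH psi -> isH phi -> nrmH (psi -- phi) = 0 -> eqH psi phi.
Proof.
move=> h h' /eqP e j; split=> //; move/isHP : (h) => c; move/isHP : (h') => c'.
have e' : nrm2 (psi j \- phi j) = 0.
  apply/eqP; move: e; rewrite psumr_eq0 => [/allP/(_ j)|k _]; last exact: nrm2_ge0.
  by rewrite mem_index_enum; apply.
have := nrm2_eq0 (sqintB (c j) (c' j)) e'.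
exact: (ae_subr0 (mu := mu2s R)).
Qed.

Lemma distH_lt psi phi (e : R) : isH psi -> isH phi -> 0 < e -> (distH psi phi < e) = (nrmH (psi -- phi) < e ^+ 2).
Proof.
move=> h h' e0; rewrite /distH -nrmHE; last exact: isHB.
by rewrite -{1}(ger0_norm (ltW e0)) -sqrtr_sqr ltr_sqrt// exprn_gt0.
Qed.

Section Graph.
Variable T : graph R.
Hypothesis TH : forall psi phi, T psi phi -> isH psi /\ isH phi.

Lemma op_closureP psi phi : op_closure T psi phi <-> [/\ isH psi, isH phi &
  forall e : R, 0 < e -> exists u v, [/\ T u v, nrmH (psi -- u) < e & nrmH (phi -- v) < e]].
Proof.
split=> [[h h' H]|[h h' H]]; split=> // e e0.
  have s0 : 0 < Num.sqrt e by rewrite sqrtr_gt0.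
  have [u [v [uv d1 d2]]] := H _ s0; have [hu hv] := TH uv.
  by exists u, v; rewrite !distH_lt// sqr_sqrtr// ltW in d1 d2 *.
have [u [v [uv d1 d2]]] := H (e ^+ 2) (exprn_gt0 2 e0); have [hu hv] := TH uv.
by exists u, v; rewrite !distH_lt.
Qed.

Lemma nrmH_sub0 psi : isH psi -> nrmH (psi -- psi) = 0.
Proof.
move=> h; rewrite nrmHE; last exact: isHB.
rewrite dotHBl//; last exact: isHB.
by rewrite subrr.
Qed.

Lemma sub_closure psi phi : T psi phi -> op_closure T psi phi.
Proof.
move=> t; have [h h'] := TH t; apply/op_closureP; split=> // e e0; exists psi, phi; split=> //.
- by rewrite nrmH_sub0.
- by rewrite nrmH_sub0.
Qed.

Lemma closure_eqH psi psi' phi phi' : op_closure T psi phi -> eqH psi psi' -> eqH phi phi' ->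
  op_closure T psi' phi'.
Proof.
move=> /op_closureP[h h' H] e e'; apply/op_closureP; have [_ k] := eqH_isH e; have [_ k'] := eqH_isH e'.
split=> // eps eps0; have [u [v [uv d1 d2]]] := H _ eps0; have [hu hv] := TH uv.
exists u, v; split=> //.
- by rewrite -(nrmH_eq (eqHB e (eqH_refl hu))).
- by rewrite -(nrmH_eq (eqHB e' (eqH_refl hv))).
Qed.

Lemma closure_comb a psi psi' phi phi' :
  (forall psi psi' phi phi', T psi phi -> T psi' phi' -> T (comb a psi psi') (comb a phi phi')) ->
  op_closure T psi phi -> op_closure T psi' phi' -> op_closure T (comb a psi psi') (comb a phi phi').
Proof.
move=> Tlin /op_closureP[h k H] /op_closureP[h' k' H']; apply/op_closureP; split; [exact: isH_comb|exact: isH_comb|].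
move=> e e0; have K0 : 0 < 2 * nsq a + 2 by have := nsq_ge0 a; lra.
have [u [v [uv d1 d2]]] := H _ (divr_gt0 e0 K0); have [hu hv] := TH uv.
have [u' [v' [uv' d1' d2']]] := H' _ (divr_gt0 e0 K0); have [hu' hv'] := TH uv'.
exists (comb a u u'), (comb a v v'); split; first exact: Tlin.
  suff: nrmH (comb a (psi -- u) (psi' -- u')) < e.
    by congr (nrmH _ < e); apply/funext => j; apply/funext => p /=; ring.
  apply: (le_lt_trans (nrmH_comb a (isHB h hu) (isHB h' hu'))).
  rewrite -[ltRHS](divfK (lt0r_neq0 K0)) [ltRHS]mulrC (mulrDl (2 * nsq a) 2).
  by apply: ler_ltD; rewrite ?ltr_pM2l// ler_wpM2l ?mulr_ge0 ?nsq_ge0 ?ltW.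
suff: nrmH (comb a (phi -- v) (phi' -- v')) < e.
  by congr (nrmH _ < e); apply/funext => j; apply/funext => p /=; ring.
apply: (le_lt_trans (nrmH_comb a (isHB k hv) (isHB k' hv'))).
rewrite -[ltRHS](divfK (lt0r_neq0 K0)) [ltRHS]mulrC (mulrDl (2 * nsq a) 2).
by apply: ler_ltD; rewrite ?ltr_pM2l// ler_wpM2l ?mulr_ge0 ?nsq_ge0 ?ltW.
Qed.

(** Subtracting the identity for an approximant (u', v') of (u, v) leaves scalar products with
    [v - v'] and [u - u'], small by Cauchy-Schwarz. *)
Lemma adjoint_closure S : (forall psi phi, S psi phi -> isH psi /\ isH phi) ->
  (forall psi phi u v, S psi phi -> T u v -> dotH psi v = dotH phi u) ->
  forall psi phi u v, S psi phi -> op_closure T u v -> dotH psi v = dotH phi u.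
Proof.
move=> SH ST psi phi u v s /op_closureP[hu hv H]; have [h h'] := SH _ _ s.
(* The 16 is 2 from [nsqB] times 8 from [dotH_CS]. *)
apply/eqP; rewrite -subr_eq0; apply/eqP; apply: (@nsq_small _ _ (16 * (nrmH psi + nrmH phi))) => e e0.
have [u' [v' [uv d1 d2]]] := H _ e0; have [hu' hv'] := TH uv.
have -> : dotH psi v - dotH phi u = dotH psi (v -- v') - dotH phi (u -- u').
  rewrite (dotHC (isHB hv hv') h) (dotHC (isHB hu hu') h') !dotHBl//.
  by rewrite (dotHC h) // (dotHC h hv') (dotHC h') // (dotHC h' hu') -!rmorphB/= !conjcK (ST _ _ _ _ s uv) opprB addrA subrK.
apply: (le_trans (nsqB _ _)).
have c1 := dotH_CS h (isHB hv hv'); have c2 := dotH_CS h' (isHB hu hu').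
have := ler_wpM2l (nrmH_ge0 psi) (ltW d2); have := ler_wpM2l (nrmH_ge0 phi) (ltW d1); lra.
Qed.

Hypothesis Tdense : forall psi, isH psi -> forall e : R, 0 < e -> exists u v, T u v /\ nrmH (psi -- u) < e.

(** The difference of two images is orthogonal to the dense domain, hence to itself. *)
Lemma adjoint_fun psi phi phi' : op_adjoint T psi phi -> op_adjoint T psi phi' -> eqH phi phi'.
Proof.
move=> [h k H] [_ k' H']; apply: nrmH_eq0 => //; have kk := isHB k k'.
have : forall u v, T u v -> dotH u (phi -- phi') = 0.
  move=> u v uv; have [hu hv] := TH uv.
  by rewrite (dotHC kk hu) dotHBl// -(H _ _ uv) -(H' _ _ uv) subrr rmorph0.
move: kk; move: (phi -- phi') => chi kk orth.
rewrite nrmHE//; suff -> : dotH chi chi = 0 by [].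
apply: (@nsq_small _ _ (8 * nrmH chi)) => e e0.
have [u [v [uv d]]] := Tdense kk e0; have [hu hv] := TH uv.
have -> : dotH chi chi = dotH (chi -- u) chi by rewrite dotHBl// (orth _ _ uv) subr0.
apply: (le_trans (dotH_CS (isHB kk hu) kk)).
by rewrite -mulrA ler_wpM2l// mulrC ler_wpM2l ?nrmH_ge0// ltW.
Qed.

Hypothesis Tsym : symmetric_op T.

Lemma sub_adjoint psi phi : T psi phi -> op_adjoint T psi phi.
Proof. by move=> t; have [h h'] := TH t; split=> // u v; exact: Tsym. Qed.

Lemma closure_sub_adjoint psi phi : op_closure T psi phi -> op_adjoint T psi phi.
Proof.
move=> c; have [h h' _] := c; split=> // u v uv; have [hu hv] := TH uv.
have := adjoint_closure TH (fun _ _ _ _ => @Tsym _ _ _ _) uv c.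
by rewrite (dotHC h' hu) (dotHC h hv) => /(congr1 (@conjc R)); rewrite !conjcK.
Qed.

(** The closure is contained in the adjoint, which is single-valued. This is what gives the
    conjugated closure a definite value on Schwartz spinors. *)
Lemma symmetric_closable psi phi phi' : op_closure T psi phi -> op_closure T psi phi' -> eqH phi phi'.
Proof. by move=> /closure_sub_adjoint h /closure_sub_adjoint; exact: adjoint_fun. Qed.

Hypothesis Teq : forall psi psi' phi phi', T psi phi -> eqH psi psi' -> eqH phi phi' -> T psi' phi'.
Hypothesis Tlin : forall a psi psi' phi phi', T psi phi -> T psi' phi' -> T (comb a psi psi') (comb a phi phi').

Lemma dense_densely S : (forall psi phi, T psi phi -> S psi phi) -> densely_defined S.
Proof.
move=> TS psi h e e0; have [u [v [uv d]]] := Tdense h (exprn_gt0 2 e0); have [hu _] := TH uv.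
by exists u; [exists v; exact: TS|rewrite distH_lt].
Qed.

Lemma symmetric_is_operator : is_operator T.
Proof.
split; [exact: TH|exact: Teq|exact: Tlin|].
by move=> psi phi phi' /sub_adjoint h /sub_adjoint; exact: adjoint_fun.
Qed.

(** By symmetry the closure lies in its own adjoint; that adjoint lies in the adjoint of [T], as [T]
    is part of its closure. The assumed inclusion closes the circle. *)
Lemma esa_criterion : (forall psi phi, op_adjoint T psi phi -> op_closure T psi phi) ->
  selfadjoint (op_closure T).
Proof.
move=> A; split.
- split.
  + by move=> psi phi [].
  + exact: closure_eqH.
  + by move=> a psi psi' phi phi'; apply: closure_comb; exact: Tlin.
  + exact: symmetric_closable.
- exact: (dense_densely sub_closure).
- move=> psi phi; split=> [c|[h h' H]]; last first.
    by apply: A; split=> // u v uv; apply: H; exact: sub_closure.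
  have [h h' _] := c; split=> // u v.
  apply: (adjoint_closure (S := op_closure T)) => //; first by move=> ? ? [].
  by move=> ? ? ? ? /closure_sub_adjoint[_ _]; apply.
Qed.

End Graph.
End Spinors.

(** * Dirac operators *)

Section FirstOrder.
Context (R : realType).
Notation M := (mu2s R).
Notation reo f := (@complex.Re R \o f).
Notation imo f := (@complex.Im R \o f).
Notation coef := ((R * R) * (R * R))%type.
Implicit Types (f g h : wave R) (z : R[i]) (c d : coef) (p q : R * R) (u v w : R * R -> R).

(* [((c1, c2), (c3, c4))] encodes c1 x + c2 y + c3 (-i d/dx) + c4 (-i d/dy). *)
Definition first_order c f : wave R := fun p =>
  c.1.1%:C * (p.1%:C * f p) + c.1.2%:C * (p.2%:C * f p)
  - 'i%C * (c.2.1%:C * partial_x f p + c.2.2%:C * partial_y f p).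

(** On a real function, [first_order c] is [mult_part c] minus i times [diff_part c]: the first acts
    on real and imaginary parts separately, the second exchanges them. *)
Definition mult_part c u p := c.1.1 * (p.1 * u p) + c.1.2 * (p.2 * u p).
Definition diff_part c u p := c.2.1 * px u p + c.2.2 * py u p.

Lemma reo_first_order c f : reo (first_order c f) = (fun p => mult_part c (reo f) p + diff_part c (imo f) p).
Proof.
apply/funext => p; rewrite /first_order /=; have -> : partial_x f p = px (reo f) p +i* px (imo f) p by [].
have -> : partial_y f p = py (reo f) p +i* py (imo f) p by [].
rewrite !ReImE /= /mult_part /diff_part /=.
by move: (px _ p) (px _ p) (py _ p) (py _ p) (f p) => *; ring.
Qed.

Lemma imo_first_order c f : imo (first_order c f) = (fun p => mult_part c (imo f) p - diff_part c (reo f) p).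
Proof.
apply/funext => p; rewrite /first_order /=; have -> : partial_x f p = px (reo f) p +i* px (imo f) p by [].
have -> : partial_y f p = py (reo f) p +i* py (imo f) p by [].
rewrite !ReImE /= /mult_part /diff_part /=.
by move: (px _ p) (px _ p) (py _ p) (py _ p) (f p) => *; ring.
Qed.

Lemma L2_mult_part c u : rschwartz u -> L2 M (mult_part c u).
Proof. by move=> s; apply: (L2D (mu := M)); apply: (L2Z (mu := M)); [exact: rschwartz_mulx|exact: rschwartz_muly]. Qed.

Lemma L2_diff_part c u : rschwartz u -> L2 M (diff_part c u).
Proof. by move=> s; apply: (L2D (mu := M)); apply: (L2Z (mu := M)); apply: rschwartz_L2; [exact: rschwartz_px|exact: rschwartz_py]. Qed.

Lemma sqint_first_order c f : schwartz f -> sqint (first_order c f).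
Proof.
move=> /schwartzP[s1 s2]; split; rewrite ?reo_first_order ?imo_first_order.
  by apply: (L2D (mu := M)); [exact: L2_mult_part|exact: L2_diff_part].
by apply: (L2B (mu := M)); [exact: L2_mult_part|exact: L2_diff_part].
Qed.

Lemma ip_mult_part c u v : ip M (mult_part c u) v = ip M u (mult_part c v).
Proof. by apply: eq_Rintegral => p _; rewrite /mult_part; ring. Qed.

Lemma ip_diff_part c u v : rschwartz u -> rschwartz v -> ip M (diff_part c u) v = - ip M u (diff_part c v).
Proof.
move=> su sv; have Lu := rschwartz_L2 su; have Lv := rschwartz_L2 sv.
have C w w' : rschwartz w -> L2 M w' -> ip M (diff_part c w) w' = c.2.1 * ip M (px w) w' + c.2.2 * ip M (py w) w'.
  move=> sw hw'; have wx := rschwartz_L2 (rschwartz_px sw); have wy := rschwartz_L2 (rschwartz_py sw).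
  rewrite (ipDl (mu := M) (L2Z (mu := M) c.2.1 wx) (L2Z (mu := M) c.2.2 wy) hw').
  by rewrite (ipZl (mu := M) c.2.1 wx hw') (ipZl (mu := M) c.2.2 wy hw').
have ex : ip M (px u) v = - ip M (px v) u := (etrans (ip_px su sv) (congr1 (fun t : R => - t) (ipC M u (px v)))).
have ey : ip M (py u) v = - ip M (py v) u := (etrans (ip_py su sv) (congr1 (fun t : R => - t) (ipC M u (py v)))).
rewrite (C _ _ su Lv) ex ey !mulrN -opprD; congr (- _).
by rewrite -(C _ _ sv Lu); exact: ipC.
Qed.

(** For the real scalar product [mult_part] is symmetric and [diff_part] antisymmetric; the factor
    -i compensates the second sign. *)
Lemma first_order_sym c f g : schwartz f -> schwartz g -> dotL2 (first_order c f) g = dotL2 f (first_order c g).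
Proof.
move=> sf sg; rewrite !dotL2E ?reo_first_order ?imo_first_order; try exact: sqint_first_order; try exact: schwartz_sqint.
move/schwartzP : sf => [f1 f2]; move/schwartzP : sg => [g1 g2].
have D1 u v w : rschwartz u -> rschwartz v -> rschwartz w ->
    ip M (fun p => mult_part c u p + diff_part c v p) w = ip M (mult_part c u) w + ip M (diff_part c v) w.
  move=> su sv sw; exact: (ipDl (mu := M) (L2_mult_part c su) (L2_diff_part c sv) (rschwartz_L2 sw)).
have D2 u v w : rschwartz u -> rschwartz v -> rschwartz w ->
    ip M (fun p => mult_part c u p - diff_part c v p) w = ip M (mult_part c u) w - ip M (diff_part c v) w.
  move=> su sv sw; exact: (ipBl (mu := M) (L2_mult_part c su) (L2_diff_part c sv) (rschwartz_L2 sw)).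
have D3 u v w : rschwartz u -> rschwartz v -> rschwartz w ->
    ip M u (fun p => mult_part c v p + diff_part c w p) = ip M (mult_part c u) v - ip M (diff_part c u) w.
  by move=> su sv sw; rewrite ipC D1// ![ip M _ u]ipC ip_mult_part (ip_diff_part c su sw) opprK.
have D4 u v w : rschwartz u -> rschwartz v -> rschwartz w ->
    ip M u (fun p => mult_part c v p - diff_part c w p) = ip M (mult_part c u) v + ip M (diff_part c u) w.
  by move=> su sv sw; rewrite ipC D2// ![ip M _ u]ipC ip_mult_part (ip_diff_part c su sw).
rewrite !(D1, D2, D3, D4)//.
move: (ip M _ _) (ip M _ _) (ip M _ _) (ip M _ _) (ip M _ _) (ip M _ _) (ip M _ _) (ip M _ _) => *.
by apply: complexP => /=; ring.
Qed.

Lemma rschwartz_lin3 a b u v w : rschwartz u -> rschwartz v -> rschwartz w -> rschwartz (fun p => a * u p + b * v p + w p).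
Proof.
move=> su sv sw; rewrite (_ : (fun p => _) = (fun p => 1 * (a * u p + b * v p) + 1 * w p)).
  by apply: rschwartz_comb => //; exact: rschwartz_comb.
by apply/funext => p; rewrite !mul1r.
Qed.

Lemma rpart_lin3 s a b u v w : rschwartz u -> rschwartz v -> rschwartz w ->
  rpart s (fun p => a * u p + b * v p + w p) = (fun p => a * rpart s u p + b * rpart s v p + rpart s w p).
Proof.
move=> su sv sw; rewrite (_ : (fun p => a * u p + _ + _) = (fun p => 1 * (a * u p + b * v p) + 1 * w p)).
  rewrite rpart_comb//; last exact: rschwartz_comb.
  by rewrite rpart_comb//; apply/funext => p; rewrite !mul1r.
by apply/funext => p; rewrite !mul1r.
Qed.

Lemma reo_comb z f g : reo ((z \*o f) \+ g) = (fun p => complex.Re z * reo f p + (- complex.Im z) * imo f p + reo g p).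
Proof. by apply/funext => p; rewrite /= ReD ReM; ring. Qed.

Lemma imo_comb z f g : imo ((z \*o f) \+ g) = (fun p => complex.Re z * imo f p + complex.Im z * reo f p + imo g p).
Proof. by apply/funext => p; rewrite /= ImD ImM; ring. Qed.

Lemma schwartz_comb z f g : schwartz f -> schwartz g -> schwartz ((z \*o f) \+ g).
Proof.
move=> /schwartzP[f1 f2] /schwartzP[g1 g2]; apply/schwartzP.
by rewrite reo_comb imo_comb; split; exact: rschwartz_lin3.
Qed.

Lemma partials_comb s z f g : schwartz f -> schwartz g ->
  partials s ((z \*o f) \+ g) = (z \*o partials s f) \+ partials s g.
Proof.
move=> /schwartzP[f1 f2] /schwartzP[g1 g2]; rewrite !partialsE reo_comb imo_comb !rpart_lin3//.
by apply/funext => p; apply: complexP; rewrite /= !ReImE /=; ring.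
Qed.

Lemma first_order_comb c z f g : schwartz f -> schwartz g -> first_order c ((z \*o f) \+ g) = (z \*o first_order c f) \+ first_order c g.
Proof.
move=> sf sg; have hx := partials_comb [:: false] z sf sg; have hy := partials_comb [:: true] z sf sg.
rewrite /= in hx hy; apply/funext => p; rewrite /first_order hx hy /=; ring.
Qed.

(** Zero is reached as a multiple of a known Schwartz function, which spares computing its iterated
    derivatives. *)
Lemma rschwartz_0 : rschwartz (fun=> 0 : R).
Proof.
have h : rschwartz (fun p => 0 * molker 0 (0, 0) p : R) by apply: rschwartzZ; exact: rschwartz_molker.
by rewrite (_ : (fun=> 0) = (fun p => 0 * molker 0 (0, 0) p)) //; apply/funext => p; rewrite mul0r.
Qed.

Lemma schwartz_0 : schwartz (fun=> 0 : R[i]).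
Proof. by apply/schwartzP; split; exact: rschwartz_0. Qed.

Lemma px_0 p : px (fun=> 0 : R) p = 0.
Proof. by rewrite /px derive1_cst. Qed.
Lemma py_0 p : py (fun=> 0 : R) p = 0.
Proof. by rewrite /py derive1_cst. Qed.

Lemma first_order_0 c : first_order c (fun=> 0) = (fun=> 0).
Proof.
apply/funext => p; have := congr1 (@^~ p) (reo_first_order c (fun=> 0)); have := congr1 (@^~ p) (imo_first_order c (fun=> 0)).
rewrite /mult_part /diff_part /= => h1 h2; apply: complexP; rewrite /= ?h1 ?h2.
  by rewrite (px_0 p) (py_0 p); ring.
by rewrite (px_0 p) (py_0 p); ring.
Qed.

(** * Mollifiers against first-order operators *)

Section Mollify.
Variable n : nat.

Definition cmollify f : wave R := wave_of (mollify n (reo f)) (mollify n (imo f)).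
Definition com_mult c u p := c.1.1 * comX n u p + c.1.2 * comY n u p.
Definition com_diff c u p := c.2.1 * comDx n u p + c.2.2 * comDy n u p.
(** The commutator of [first_order c] with J_n, extended to all square-integrable [f] by its
    kernel. *)
Definition com_wave c f : wave R :=
  wave_of (fun p => com_mult c (reo f) p + com_diff c (imo f) p) (fun p => com_mult c (imo f) p - com_diff c (reo f) p).
Definition test_fun p : wave R := wave_of (molker n p) (fun=> 0).

Lemma schwartz_cmollify f : sqint f -> schwartz (cmollify f).
Proof. by move=> [f1 f2]; apply/schwartzP; split; exact: rschwartz_mollify. Qed.

Lemma schwartz_test_fun p : schwartz (test_fun p).
Proof. by apply/schwartzP; split; [exact: rschwartz_molker|exact: rschwartz_0]. Qed.

(** Pairing with the real kernel J_n(p, .) evaluates J_n f at [p]; the conjugate appears since the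
    scalar product is antilinear in [f]. *)
Lemma dot_test_fun f p : sqint f -> dotL2 f (test_fun p) = conjc (cmollify f p).
Proof.
move=> hf; rewrite dotL2E//; last exact: (schwartz_sqint (schwartz_test_fun p)).
have ip0 u : ip M u (fun=> 0) = 0.
  transitivity (\int[M]_x (0 : R)); first by apply: eq_Rintegral => x _; rewrite mulr0.
  by rewrite /Rintegral integral0.
have E1 : reo (test_fun p) = molker n p by [].
have E2 : imo (test_fun p) = (fun=> 0) by [].
by rewrite E1 E2 !ip0 addr0 sub0r !(ipC M _ (molker n p)).
Qed.

Lemma ip_mult_part_molker c u p : L2 M u -> ip M u (mult_part c (molker n p)) = mult_part c (mollify n u) p - com_mult c u p.
Proof.
move=> hu; have sk : rschwartz (molker n p) by exact: rschwartz_molker.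
rewrite ipC (ipDl (mu := M) (L2Z (mu := M) c.1.1 (rschwartz_mulx sk)) (L2Z (mu := M) c.1.2 (rschwartz_muly sk)) hu).
rewrite (ipZl (mu := M) c.1.1 (rschwartz_mulx sk) hu) (ipZl (mu := M) c.1.2 (rschwartz_muly sk) hu) /mult_part /com_mult.
have -> : ip M (fun q => q.1 * molker n p q) u = p.1 * mollify n u p - comX n u p by rewrite comX_E// opprB addrC subrK.
have -> : ip M (fun q => q.2 * molker n p q) u = p.2 * mollify n u p - comY n u p by rewrite comY_E// opprB addrC subrK.
by move: (comX _ _ _) (comY _ _ _) (mollify _ _ _) => *; ring.
Qed.

Lemma ip_diff_part_molker c u p : L2 M u -> ip M u (diff_part c (molker n p)) = com_diff c u p - diff_part c (mollify n u) p.
Proof.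
move=> hu; have sk : rschwartz (molker n p) by exact: rschwartz_molker.
have kx := rschwartz_L2 (rschwartz_px sk); have ky := rschwartz_L2 (rschwartz_py sk).
rewrite ipC (ipDl (mu := M) (L2Z (mu := M) c.2.1 kx) (L2Z (mu := M) c.2.2 ky) hu).
rewrite (ipZl (mu := M) c.2.1 kx hu) (ipZl (mu := M) c.2.2 ky hu) /diff_part /com_diff.
have -> : ip M (px (molker n p)) u = comDx n u p - px (mollify n u) p by rewrite comDx_E// [px _ _ + _]addrC addrK.
have -> : ip M (py (molker n p)) u = comDy n u p - py (mollify n u) p by rewrite comDy_E// [py _ _ + _]addrC addrK.
by move: (comDx _ _ _) (comDy _ _ _) (px _ _) (py _ _) => *; ring.
Qed.

(** The weak form of J_n A f = A J_n f - [A, J_n] f, evaluated at [p]: the operator acts on the test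
    function, so [f] only has to be square-integrable. *)
Lemma dot_first_order_test_fun c f p : sqint f -> dotL2 f (first_order c (test_fun p)) = conjc (first_order c (cmollify f) p - com_wave c f p).
Proof.
move=> hf; have sk := schwartz_test_fun p.
rewrite dotL2E//; last exact: sqint_first_order.
have E1 : reo (first_order c (test_fun p)) = mult_part c (molker n p).
  rewrite reo_first_order; apply/funext => q; rewrite /diff_part (_ : imo (test_fun p) = (fun=> 0))//.
  by rewrite px_0 py_0 !mulr0 !addr0.
have E2 : imo (first_order c (test_fun p)) = (fun q => - diff_part c (molker n p) q).
  rewrite imo_first_order; apply/funext => q; rewrite /mult_part (_ : imo (test_fun p) = (fun=> 0))//.
  by rewrite !mulr0 addr0 sub0r.
have [h1 h2] := hf; have hD := L2_diff_part c (rschwartz_molker n p).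
have N w : L2 M w -> ip M w (fun q => - diff_part c (molker n p) q) = - ip M w (diff_part c (molker n p)).
  by move=> hw; rewrite ipC (ipNl (mu := M) hD hw) ipC.
rewrite E1 E2 (N _ h1) (N _ h2) (ip_mult_part_molker c p h1) (ip_mult_part_molker c p h2) (ip_diff_part_molker c p h1) (ip_diff_part_molker c p h2).
have F1 : complex.Re (first_order c (cmollify f) p) = mult_part c (mollify n (reo f)) p + diff_part c (mollify n (imo f)) p.
  exact: (congr1 (@^~ p) (reo_first_order c (cmollify f))).
have F2 : complex.Im (first_order c (cmollify f) p) = mult_part c (mollify n (imo f)) p - diff_part c (mollify n (reo f)) p.
  exact: (congr1 (@^~ p) (imo_first_order c (cmollify f))).
have G1 : complex.Re (com_wave c f p) = com_mult c (reo f) p + com_diff c (imo f) p by [].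
have G2 : complex.Im (com_wave c f p) = com_mult c (imo f) p - com_diff c (reo f) p by [].
move: (first_order c (cmollify f) p) (com_wave c f p) F1 F2 G1 G2 => z z'; clear.
move: (mult_part _ _ _) (diff_part _ _ _) (com_mult _ _ _) (com_diff _ _ _) (mult_part _ _ _) (diff_part _ _ _) (com_mult _ _ _) (com_diff _ _ _) => x1 x2 x3 x4 x5 x6 x7 x8.
by move=> F1 F2 G1 G2; apply: complexP; rewrite !ReImE ?F1 ?F2 ?G1 ?G2 /=; ring.
Qed.

Lemma com_bound2 (X Y : R * R -> R) a b e u : L2 M X -> L2 M Y -> ip M X X <= e * ip M u u -> ip M Y Y <= e * ip M u u ->
  L2 M (fun p => a * X p + b * Y p) /\
  ip M (fun p => a * X p + b * Y p) (fun p => a * X p + b * Y p) <= 2 * (a ^+ 2 + b ^+ 2) * e * ip M u u.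
Proof.
move=> hX hY bX bY; have aX := L2Z (mu := M) a hX; have bY' := L2Z (mu := M) b hY.
split; first exact: (L2D (mu := M)).
have sq k Z : L2 M Z -> ip M (fun p => k * Z p) (fun p => k * Z p) = k ^+ 2 * ip M Z Z.
  move=> hZ; have kZ := L2Z (mu := M) k hZ.
  by rewrite (ipZl (mu := M) k hZ kZ) (ipC M) (ipZl (mu := M) k hZ hZ) mulrA.
apply: (le_trans (ip_sqrD (mu := M) aX bY')); rewrite !sq//.
have := ler_wpM2l (sqr_ge0 a) bX; have := ler_wpM2l (sqr_ge0 b) bY; lra.
Qed.

Lemma com_mult_bound c u : L2 M u -> L2 M (com_mult c u) /\
  ip M (com_mult c u) (com_mult c u) <= 2 * (c.1.1 ^+ 2 + c.1.2 ^+ 2) * (4 * eps R n) * ip M u u.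
Proof. by move=> /(com_bounds n)[[h1 b1] [h2 b2] _ _]; exact: com_bound2. Qed.

Lemma com_diff_bound c u : L2 M u -> L2 M (com_diff c u) /\
  ip M (com_diff c u) (com_diff c u) <= 2 * (c.2.1 ^+ 2 + c.2.2 ^+ 2) * (4 * eps R n) * ip M u u.
Proof. by move=> /(com_bounds n)[_ _ [h1 b1] [h2 b2]]; exact: com_bound2. Qed.

Definition coef_sq c := (c.1.1 ^+ 2 + c.1.2 ^+ 2) + (c.2.1 ^+ 2 + c.2.2 ^+ 2).

Lemma com_wave_bound c f : sqint f -> sqint (com_wave c f) /\ nrm2 (com_wave c f) <= 16 * coef_sq c * eps R n * nrm2 f.
Proof.
move=> [f1 f2]; have [x1 X1] := com_mult_bound c f1; have [x2 X2] := com_mult_bound c f2.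
have [d1 D1] := com_diff_bound c f1; have [d2 D2] := com_diff_bound c f2.
split; first by split; [exact: (L2D (mu := M))|exact: (L2B (mu := M))].
have k1 := ip_sqrD (mu := M) x1 d2; have k2 := ip_sqrD (mu := M) x2 (L2N (mu := M) d1).
rewrite (ipNl (mu := M) d1 (L2N (mu := M) d1)) (ipC M (com_diff c (reo f))) (ipNl (mu := M) d1 d1) opprK in k2.
apply: (le_trans (lerD k1 k2)); rewrite /nrm2 /coef_sq.
move: X1 X2 D1 D2; move: (ip M _ _) (ip M _ _) (ip M _ _) (ip M _ _) (ip M _ _) (ip M _ _) => a1 a2 a3 a4 a5 a6.
clear k1 k2 x1 x2 d1 d2 f1 f2.
by move: (c.1.1 ^+ 2 + c.1.2 ^+ 2) (c.2.1 ^+ 2 + c.2.2 ^+ 2) (eps R n) => s1 s2 k; lra.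
Qed.

End Mollify.

Lemma cmollify_cvg f : sqint f -> forall e : R, 0 < e -> \forall n \near \oo, nrm2 (f \- cmollify n f) < e.
Proof.
move=> [f1 f2] e e0; have e2 : 0 < e / 2 by rewrite divr_gt0.
have h1 := mollify_cvg f1 e2; have h2 := mollify_cvg f2 e2.
near=> n; rewrite /nrm2 reoB imoB (splitr e).
have sw u v : ip M (fun p => u p - v p) (fun p => u p - v p) = ip M (fun p => v p - u p) (fun p => v p - u p).
  by apply: eq_Rintegral => p _; ring.
rewrite !(sw (_ \o f)); apply: ltrD; [by near: n; exact: h1|by near: n; exact: h2].
Unshelve. all: by end_near. Qed.

End FirstOrder.

(** * Essential self-adjointness of first-order Dirac operators *)

Section Dirac.
Context (R : realType).
Notation coef := ((R * R) * (R * R))%type.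
Implicit Types (f g h : wave R) (z : R[i]) (c d : coef) (p q : R * R) (psi phi u v w : spinor R) (k : R).
Notation comb a psi phi := (fun j => (a \*o psi j) \+ phi j).
Notation "psi -- phi" := (fun j => psi j \- phi j) (at level 50).

(** The nonzero entry in row [j] of [sigma2]; for [sigma1] that entry is 1. *)
Definition dirac_sign (j : 'I_2) : R[i] := if j == 0 :> nat then - 'i%C else 'i%C.

Lemma dirac_sign_rev j : dirac_sign (rev_ord j) = conjc (dirac_sign j).
Proof. by case: j => [[|[|//]] i]; apply: complexP; rewrite /= ?oppr0 ?opprK. Qed.

Lemma ord2P (j : 'I_2) : j = ord0 \/ j = lift ord0 ord0.
Proof. by case: j => [[|[|//]] i]; [left|right]; apply: val_inj. Qed.

(* Both Pauli matrices exchange the two components of a spinor. *)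
Lemma diracE k (A B : wave R -> wave R) psi j :
  dirac k A B psi j = (k%:C \*o A (psi (rev_ord j))) \+ ((k%:C * dirac_sign j) \*o B (psi (rev_ord j))).
Proof.
apply/funext => p; rewrite /dirac /tensor /= !big_ord_recl !big_ord0 /sigma1 /sigma2 !mxE /=.
have r0 : rev_ord ord0 = lift ord0 ord0 :> 'I_2 by apply: val_inj.
have r1 : rev_ord (lift ord0 ord0) = ord0 :> 'I_2 by apply: val_inj.
by case: (ord2P j) => ->; rewrite ?r0 ?r1 /dirac_sign /=; ring.
Qed.

Lemma dotL2_0r f : sqint f -> dotL2 f (fun=> 0) = 0.
Proof.
move=> hf; have := dotL2Zr 0 (sqint_0 R) hf; rewrite mul0r.
by rewrite (_ : 0 \*o (fun=> 0) = (fun=> 0)) //; apply/funext => q; rewrite /= mul0r.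
Qed.

Lemma coef_sq_ge0 c : 0 <= coef_sq c.
Proof. by rewrite /coef_sq !addr_ge0 ?sqr_ge0. Qed.

Lemma nrmH2 psi : nrmH psi = nrm2 (psi ord0) + nrm2 (psi (lift ord0 ord0)).
Proof. by rewrite /nrmH !big_ord_recl big_ord0 addr0. Qed.

Section Operator.
Variables (k : R) (c d : coef).
Notation D := (dirac k (first_order c) (first_order d)).
Notation T := (op_on (@schwartz2 R) D).

Lemma isH_schwartz u : schwartz2 u -> isH u.
Proof. by move=> s; apply/isHP => j; exact: schwartz_sqint. Qed.

Lemma isH_dirac u : schwartz2 u -> isH (D u).
Proof.
by move=> s; apply/isHP => j; rewrite diracE; apply: sqintD; apply: sqintZ; exact: sqint_first_order.
Qed.

Lemma dirac_comb z u v : schwartz2 u -> schwartz2 v -> D (comb z u v) = comb z (D u) (D v).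
Proof.
move=> su sv; apply/funext => j; rewrite !diracE !first_order_comb//; apply/funext => p /=.
by move: (first_order _ _ p) (first_order _ _ p) (first_order _ _ p) (first_order _ _ p) (dirac_sign j) => *; ring.
Qed.

Lemma dot_dirac psi u : isH psi -> schwartz2 u -> dotH psi (D u) =
  \sum_(j < 2) (k%:C * dotL2 (psi j) (first_order c (u (rev_ord j))) + k%:C * dirac_sign j * dotL2 (psi j) (first_order d (u (rev_ord j)))).
Proof.
move=> /isHP hp su; apply: eq_bigr => j _.
have h1 := sqint_first_order c (su (rev_ord j)); have h2 := sqint_first_order d (su (rev_ord j)).
by rewrite diracE dotL2Dr ?dotL2Zr//; exact: sqintZ.
Qed.

(** Symmetric operators tensored with Hermitian matrices. Reversing the order of summation matches
    the exchanged components, and [dirac_sign_rev] expresses that [sigma2] is Hermitian. *)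
Lemma dirac_sym u v : schwartz2 u -> schwartz2 v -> dotH u (D v) = dotH (D u) v.
Proof.
move=> su sv; have hu := isH_schwartz su; have hv := isH_schwartz sv; have hD := isH_dirac su.
rewrite (dotHC hv hD) !dot_dirac// rmorph_sum /= (reindex_inj rev_ord_inj) /=; apply: eq_bigr => j _.
have E c0 : dotL2 (u (rev_ord j)) (first_order c0 (v j)) = conjc (dotL2 (v j) (first_order c0 (u (rev_ord j)))).
  by rewrite -first_order_sym// dotL2C//; [exact: schwartz_sqint|exact: sqint_first_order].
rewrite rev_ordK !E dirac_sign_rev; move: (dotL2 _ _) (dotL2 _ _) (dirac_sign j) => x y t; clear.
by apply: complexP; rewrite !ReImE /=; ring.
Qed.

Definition hmollify n psi : spinor R := fun j => cmollify n (psi j).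
(** The commutator of [D] with the componentwise mollifier, as an operator on all of L2. *)
Definition com_spinor n psi : spinor R := fun j =>
  (k%:C \*o com_wave n c (psi (rev_ord j))) \+ ((k%:C * dirac_sign j) \*o com_wave n d (psi (rev_ord j))).

Lemma schwartz2_hmollify n psi : isH psi -> schwartz2 (hmollify n psi).
Proof. by move=> /isHP h j; exact: schwartz_cmollify. Qed.

Lemma isH_com_spinor n psi : isH psi -> isH (com_spinor n psi).
Proof.
move=> /isHP h; apply/isHP => j; have [h1 _] := com_wave_bound n c (h (rev_ord j)).
by have [h2 _] := com_wave_bound n d (h (rev_ord j)); apply: sqintD; exact: sqintZ.
Qed.

Lemma nsq_dirac_sign j : nsq (k%:C * dirac_sign j) = k ^+ 2.
Proof. by rewrite /nsq !ReImE /dirac_sign; case: ifP => _ /=; ring. Qed.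

Lemma com_spinor_bound n psi : isH psi ->
  nrmH (com_spinor n psi) <= 32 * k ^+ 2 * (coef_sq c + coef_sq d) * nrmH psi * eps R n.
Proof.
move=> /isHP h; rewrite /nrmH (reindex_inj rev_ord_inj) /= mulr_sumr mulr_suml; apply: ler_sum => j _.
rewrite /com_spinor rev_ordK; have [h1 b1] := com_wave_bound n c (h j); have [h2 b2] := com_wave_bound n d (h j).
apply: (le_trans (nrm2D (sqintZ k%:C h1) (sqintZ (k%:C * dirac_sign (rev_ord j)) h2))).
rewrite !nrm2Z// nsq_dirac_sign (_ : nsq k%:C = k ^+ 2); last by rewrite /nsq /=; ring.
have := ler_wpM2l (sqr_ge0 k) b1; have := ler_wpM2l (sqr_ge0 k) b2.
move: (k ^+ 2) (coef_sq c) (coef_sq d) (eps R n) (nrm2 (psi j)) (nrm2 _) (nrm2 _); clear => *; lra.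
Qed.

Lemma hmollify_cvg psi : isH psi -> forall e : R, 0 < e -> \forall n \near \oo, nrmH (psi -- hmollify n psi) < e.
Proof.
move=> /isHP h e e0; have e2 : 0 < e / 2 by rewrite divr_gt0.
have h0 := cmollify_cvg (h ord0) e2; have h1 := cmollify_cvg (h (lift ord0 ord0)) e2.
apply: filterS2 h0 h1 => n a b; rewrite nrmH2 (splitr e).
exact: ltrD a b.
Qed.

Lemma schwartz_dense psi : isH psi -> forall e : R, 0 < e -> exists u v, T u v /\ nrmH (psi -- u) < e.
Proof.
move=> h e e0; have [n _ /(_ n (leqnn n)) hn] := hmollify_cvg h e0; have sJ := schwartz2_hmollify n h.
exists (hmollify n psi), (D (hmollify n psi)); split=> //; exists (hmollify n psi) => //.
by split; apply: eqH_refl; [exact: isH_schwartz|exact: isH_dirac].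
Qed.

Lemma op_isH psi phi : T psi phi -> isH psi /\ isH phi.
Proof. by move=> [u su [/eqH_isH[h _] /eqH_isH[h' _]]]. Qed.

Lemma op_eqH psi psi' phi phi' : T psi phi -> eqH psi psi' -> eqH phi phi' -> T psi' phi'.
Proof.
move=> [u su [e1 e2]] e3 e4; exists u => //.
by split; [exact: eqH_trans (eqH_sym e3) e1|exact: eqH_trans (eqH_sym e4) e2].
Qed.

Lemma op_comb z psi psi' phi phi' : T psi phi -> T psi' phi' -> T (comb z psi psi') (comb z phi phi').
Proof.
move=> [u su [e1 e2]] [v sv [e3 e4]]; exists (comb z u v); first by move=> j; exact: schwartz_comb.
by rewrite dirac_comb//; split; exact: eqH_comb.
Qed.

Lemma op_symmetric : symmetric_op T.
Proof.
move=> psi phi u v tp [w sw [e1 e2]]; have [hp hp'] := op_isH tp; case: tp => [w' sw' [e3 e4]].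
rewrite (dotH_eqr e2 hp) (dotH_eql e3 (isH_dirac sw)) dirac_sym//.
by rewrite -(dotH_eql e4 (isH_schwartz sw)) -(dotH_eqr e1 hp').
Qed.

(* The adjoint relation is tested against the mollifier kernel at a point p, in one
   component. *)
Lemma adjoint_mollify n psi phi : op_adjoint T psi phi -> D (hmollify n psi) = (fun j => hmollify n phi j \+ com_spinor n psi j).
Proof.
move=> [h h' H]; apply/funext => j; apply/funext => p; move/isHP : (h) => hc; move/isHP : (h') => hc'.
pose u : spinor R := fun i => if i == j then test_fun n p else (fun=> 0).
have su : schwartz2 u by move=> i; rewrite /u; case: ifP => _; [exact: schwartz_test_fun|exact: schwartz_0].
(* Since [D] exchanges the components, the product of [psi] with [D u] retains only the component
   [rev_ord j], while that of [phi] with [u] retains the component [j]. *)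
have := H u (D u); rewrite dot_dirac// (bigD1 (rev_ord j)) //= big1 => [|i ij]; last first.
  have uz : u (rev_ord i) = (fun=> 0).
    by rewrite /u ifF//; apply/negP => /eqP E; move: ij; rewrite -E rev_ordK eqxx.
  by rewrite uz !first_order_0 (dotL2_0r (hc i)) !mulr0 addr0.
rewrite rev_ordK /dotH (bigD1 j) //= big1 => [|i ij]; last first.
  by rewrite /u (negbTE ij) (dotL2_0r (hc' i)).
have uj : u j = test_fun n p by rewrite /u eqxx.
rewrite uj !addr0 !dot_first_order_test_fun// dot_test_fun// => E.
have {}E := E (ex_intro2 _ _ u su (conj (eqH_refl (isH_schwartz su)) (eqH_refl (isH_dirac su)))).
rewrite diracE /hmollify /com_spinor /=; move: E; rewrite dirac_sign_rev.
move: (first_order c _ p) (first_order d _ p) (com_wave n c _ p) (com_wave n d _ p) (cmollify _ _ p) (dirac_sign j) => a b a' b' y t; clear => E.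
have E1 := congr1 (@complex.Re R) E; have E2 := congr1 (@complex.Im R) E.
rewrite /= !ReImE /= in E1 E2.
by apply: complexP; rewrite !ReImE /=; lra.
Qed.

(** The approximants are the mollified [psi] and their images, and by [adjoint_mollify] the defect
    in the second component is (phi - J_n phi) minus the commutator term. *)
Lemma adjoint_sub_closure psi phi : op_adjoint T psi phi -> op_closure T psi phi.
Proof.
move=> A; have [h h' _] := A; apply/(op_closureP op_isH); split=> // e e0.
(* Both terms of the defect are doubled by [nrmHB], giving 2 (e / 4) twice. *)
have e4 : 0 < e / 4 by rewrite divr_gt0.
have C0 : 0 <= 32 * k ^+ 2 * (coef_sq c + coef_sq d) * nrmH psi.
  apply: mulr_ge0 (nrmH_ge0 _); apply: mulr_ge0; [by rewrite mulr_ge0 ?sqr_ge0|by rewrite addr_ge0 ?coef_sq_ge0].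
have c1 := hmollify_cvg h e0; have c2 := hmollify_cvg h' e4; have c3 := eps_cvg C0 e4.
have [n [n1 n2 n3]] : exists n, [/\ nrmH (psi -- hmollify n psi) < e, nrmH (phi -- hmollify n phi) < e / 4 &
    32 * k ^+ 2 * (coef_sq c + coef_sq d) * nrmH psi * eps R n < e / 4].
  have [N _ /(_ N (leqnn N)) hN] := filterI c1 (filterI c2 c3).
  by exists N; case: hN => ? [].
have sJ := schwartz2_hmollify n h; have sJ' := schwartz2_hmollify n h'.
exists (hmollify n psi), (D (hmollify n psi)); split=> //.
  by exists (hmollify n psi) => //; split; apply: eqH_refl; [exact: isH_schwartz|exact: isH_dirac].
rewrite (adjoint_mollify n A).
suff: nrmH ((phi -- hmollify n phi) -- com_spinor n psi) < e.
  by congr (nrmH _ < e); apply/funext => j; apply/funext => p /=; ring.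
apply: (le_lt_trans (nrmHB (isHB h' (isH_schwartz sJ')) (isH_com_spinor n h))).
have := com_spinor_bound n h; move: n2 n3.
move: (nrmH _) (nrmH (com_spinor n psi)) (_ * eps R n) => x y t; clear; lra.
Qed.

Lemma dirac_esa : essentially_selfadjoint_on (@schwartz2 R) T.
Proof.
split.
- apply: symmetric_is_operator; [exact: op_isH|exact: schwartz_dense|exact: op_symmetric|exact: op_eqH|exact: op_comb].
- move=> psi; split=> [[phi [u su [e _]]]|[u su e]]; first by exists u.
  by exists (D u); exists u => //; split=> //; apply: eqH_refl; exact: isH_dirac.
- exact: (dense_densely op_isH schwartz_dense).
- exact: op_symmetric.
- apply: esa_criterion; [exact: op_isH|exact: schwartz_dense|exact: op_symmetric|exact: op_comb|exact: adjoint_sub_closure].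
Qed.

End Operator.

(** * Conjugation by the unitary on Schwartz spinors *)

Section Conjugation.
Variables (U Ud : wave R -> wave R).
Hypothesis UU : unitary_with_adjoint U Ud.
Variables (k : R) (c d c' d' : coef).

Lemma eqL2_refl f : isL2 f -> eqL2 f f.
Proof. by move=> h; split=> //; exact: (ae_eq_refl (mu2s R)). Qed.

Lemma unitary_isL2 f : isL2 f -> isL2 (U f) /\ isL2 (Ud f).
Proof.
move=> h; have [/(_ f f) H _ _ _ _] := UU.
by have [[h1 _ _] [h2 _ _]] := H (eqL2_refl h).
Qed.

Lemma unitary_lin2 z z' f g : isL2 f -> isL2 g ->
  eqL2 (U ((z \*o f) \+ (z' \*o g))) ((z \*o U f) \+ (z' \*o U g)).
Proof.
move=> hf hg; have [_ lin _ _ _] := UU.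
have h0 : isL2 (fun=> 0 : R[i]) by apply/isL2P; exact: sqint_0.
have hzg : isL2 (z' \*o g) by apply/isL2P; apply: sqintZ; exact/isL2P.
have U0 : eqL2 (U (fun=> 0)) (fun=> 0).
  (* Linearity is assumed in the form a f + g only; a = -1 with both functions zero makes U 0 equal
     to - U 0 + U 0 = 0. *)
  have := lin (-1) _ _ h0 h0.
  have -> : ((-1) \*o (fun=> 0)) \+ (fun=> 0) = (fun=> 0) :> wave R by apply/funext => p /=; rewrite mulr0 addr0.
  by have -> : ((-1) \*o U (fun=> 0)) \+ U (fun=> 0) = (fun=> 0) :> wave R by apply/funext => p /=; rewrite mulN1r addNr.
have Uzg : eqL2 (U (z' \*o g)) (z' \*o U g).
  have := lin z' _ _ hg h0.
  have -> : (z' \*o g) \+ (fun=> 0) = z' \*o g by apply/funext => p /=; rewrite addr0.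
  move=> /eqL2_trans; apply.
  have h : eqL2 ((z' \*o U g) \+ U (fun=> 0)) ((z' \*o U g) \+ (fun=> 0)).
    by apply: eqL2D U0; apply: eqL2Z; exact: eqL2_refl (unitary_isL2 hg).1.
  by rewrite (_ : (z' \*o U g) \+ (fun=> 0) = z' \*o U g) // in h; apply/funext => p /=; rewrite addr0.
apply: (eqL2_trans (lin z _ _ hf hzg)); apply: eqL2D Uzg.
by apply: eqL2Z; exact: eqL2_refl (unitary_isL2 hf).1.
Qed.

(** The Schwartz representative of U^dagger u gives one image under the closure, which the
    intertwining relations carry to the expected differential expression; closability excludes any
    other image. *)
Lemma op_conj_dirac u w : preserves_schwartz U Ud -> intertwines U Ud (first_order c) (first_order c') -> intertwines U Ud (first_order d) (first_order d') ->
  schwartz2 u ->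
  op_conj U Ud (op_closure (op_on (@schwartz2 R) (dirac k (first_order c) (first_order d)))) u w <->
  eqH w (dirac k (first_order c') (first_order d') u).
Proof.
move=> pres ic id su.
have [g sg' eg] : exists2 g : spinor R, schwartz2 g & eqH (fun j => Ud (u j)) g.
  have [g0 s0 e0] := (pres _ (su ord0)).2; have [g1 s1 e1] := (pres _ (su (lift ord0 ord0))).2.
  exists (fun j : 'I_2 => if j == ord0 then g0 else g1); first by move=> j; case: ifP.
  by move=> j; case: (ord2P j) => ->.
have T0 : op_closure (op_on (@schwartz2 R) (dirac k (first_order c) (first_order d))) (fun j => Ud (u j)) (dirac k (first_order c) (first_order d) g).
  apply: (sub_closure (@op_isH k c d)); exists g => //; split=> //.
  by apply: eqH_refl; exact: isH_dirac.
have UD : eqH (fun j => U (dirac k (first_order c) (first_order d) g j)) (dirac k (first_order c') (first_order d') u).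
  move=> j; rewrite !diracE.
  have hc := sqint_first_order c (sg' (rev_ord j)); have hd := sqint_first_order d (sg' (rev_ord j)).
  apply: (eqL2_trans (unitary_lin2 _ _ (iffRL (isL2P _) hc) (iffRL (isL2P _) hd))).
  by apply: eqL2D; apply: eqL2Z; [apply: ic|apply: id] => //; exact: eqL2_sym.
split=> [[hu [v Tv wv]]|ew]; last first.
  split; first exact: isH_schwartz.
  by exists (dirac k (first_order c) (first_order d) g) => //; apply: (eqH_trans ew); exact: eqH_sym.
apply: (eqH_trans wv); apply: eqH_trans UD => j.
have ev := symmetric_closable (@op_isH k c d) (@schwartz_dense k c d) (@op_symmetric k c d) Tv T0.
have [H _ _ _ _] := UU; exact: (H _ _ (ev j)).1.
Qed.

End Conjugation.

(** * Reduction of the concrete operators to first-order form *)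

Definition coef_lin (a : R) c (b : R) d : coef :=
  ((a * c.1.1 + b * d.1.1, a * c.1.2 + b * d.1.2), (a * c.2.1 + b * d.2.1, a * c.2.2 + b * d.2.2)).

Lemma oplin_first_order a c b d : oplin a (first_order c) b (first_order d) = first_order (coef_lin a c b d).
Proof.
apply/funext => f; apply/funext => p; rewrite /oplin /first_order /=.
by rewrite !rmorphD !rmorphM /=; ring.
Qed.

Lemma mul_x_first_order : @mul_x R = first_order ((1, 0), (0, 0)).
Proof. by apply/funext => f; apply/funext => p; rewrite /first_order /mul_x /= !rmorph0 rmorph1; ring. Qed.
Lemma mul_y_first_order : @mul_y R = first_order ((0, 1), (0, 0)).
Proof. by apply/funext => f; apply/funext => p; rewrite /first_order /mul_y /= !rmorph0 rmorph1; ring. Qed.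
Lemma mom_x_first_order (h0 : R) : mom_x h0 = first_order ((0, 0), (h0, 0)) :> (wave R -> wave R).
Proof. by apply/funext => f; apply/funext => p; rewrite /first_order /mom_x /= !rmorph0; ring. Qed.
Lemma mom_y_first_order (h0 : R) : mom_y h0 = first_order ((0, 0), (0, h0)) :> (wave R -> wave R).
Proof. by apply/funext => f; apply/funext => p; rewrite /first_order /mom_y /= !rmorph0; ring. Qed.
Lemma L_x_first_order th rho : L_x th rho = first_order ((1, 0), (0, - ((1 - rho) * th))) :> (wave R -> wave R).
Proof. by apply/funext => f; apply/funext => p; rewrite /first_order /L_x /= !rmorph0 rmorph1 rmorphN; ring. Qed.
Lemma L_y_first_order th rho : L_y th rho = first_order ((0, 1), (rho * th, 0)) :> (wave R -> wave R).
Proof. by apply/funext => f; apply/funext => p; rewrite /first_order /L_y /= !rmorph0 rmorph1; ring. Qed.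

Lemma scale_first_order k c : (fun f => k%:C \*o first_order c f) = first_order (coef_lin k c 0 c).
Proof.
rewrite -oplin_first_order; apply/funext => f; apply/funext => p.
by rewrite /oplin /= rmorph0 mul0r addr0.
Qed.

(** The prefactors move into the coefficients, so that the minimally coupled operator is again a
    single Dirac operator, with prefactor 1. *)
Lemma dirac_sub k c d k' c' d' u :
  (fun j => dirac k (first_order c) (first_order d) u j \- dirac k' (first_order c') (first_order d') u j) =
  dirac 1 (first_order (coef_lin k c (- k') c')) (first_order (coef_lin k d (- k') d')) u.
Proof.
apply/funext => j; rewrite !diracE -!oplin_first_order; apply/funext => p.
by rewrite /oplin /= rmorph1 rmorphN; ring.
Qed.

Definition is_first_order (A : wave R -> wave R) := exists c, A = first_order c.

Lemma is_first_order_oplin a A b B : is_first_order A -> is_first_order B -> is_first_order (oplin a A b B).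
Proof. by move=> [c ->] [d ->]; rewrite oplin_first_order; eexists. Qed.

Lemma is_first_order_scale k A : is_first_order A -> is_first_order (fun f => k%:C \*o A f).
Proof. by move=> [c ->]; rewrite scale_first_order; eexists. Qed.

End Dirac.

Theorem theorem4p5 (R : realType) (h0 th0 B0 e Bext rho r s : R)
    (U Ud : wave R -> wave R) :
  h0 <> 0 -> th0 <> 0 -> B0 <> 0 -> h0 - th0 * B0 <> 0 ->
  P_gauge h0 th0 B0 e Bext rho r s ->
  unitary_with_adjoint U Ud ->
  preserves_schwartz U Ud ->
  intertwines U Ud (tPi_x h0 th0 B0 r s) (@X_plus R) ->
  intertwines U Ud (tPi_y h0 th0 B0 r s) (@P_plus R) ->
  essentially_selfadjoint_on (@schwartz2 R)
    (D_infty U Ud h0 th0 B0 e Bext rho r s).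
Proof.
move=> _ _ _ _ _ UU pres ix iy.
have mx : is_first_order (@mul_x R) by rewrite mul_x_first_order; eexists.
have my : is_first_order (@mul_y R) by rewrite mul_y_first_order; eexists.
have px h : is_first_order (@mom_x R h) by rewrite mom_x_first_order; eexists.
have py h : is_first_order (@mom_y R h) by rewrite mom_y_first_order; eexists.
have lx th rh : is_first_order (@L_x R th rh) by rewrite L_x_first_order; eexists.
have ly th rh : is_first_order (@L_y R th rh) by rewrite L_y_first_order; eexists.
have [c Ec] : is_first_order (tPi_x h0 th0 B0 r s) by apply: is_first_order_scale; exact: is_first_order_oplin.
have [d Ed] : is_first_order (tPi_y h0 th0 B0 r s) by apply: is_first_order_scale; exact: is_first_order_oplin.
have [c' Ec'] : is_first_order (@X_plus R) by exact: is_first_order_oplin.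
have [d' Ed'] : is_first_order (@P_plus R) by exact: is_first_order_oplin.
have L b : is_first_order (L_lin (theta_eff h0 th0 B0) rho b) by exact: is_first_order_oplin.
have [a Ea] := L (A_x h0 th0 B0 e Bext rho); have [b Eb] := L (A_y h0 th0 B0 e Bext rho).
rewrite Ec Ec' in ix; rewrite Ed Ed' in iy.
set k := (Num.sqrt 2)^-1 : R.
(* The two graphs agree pair by pair: on a Schwartz spinor the conjugated closure has only the value
   found in [op_conj_dirac], so the difference is taken between explicit differential
   expressions. *)
have -> : D_infty U Ud h0 th0 B0 e Bext rho r s =
    op_on (@schwartz2 R) (dirac 1 (first_order (coef_lin k c' (- e) a)) (first_order (coef_lin k d' (- e) b))).
  rewrite /D_infty /D_rs Ec Ed Ea Eb -/k; apply/funext => psi; apply/funext => phi; apply/propext; split.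
    move=> [u [v [su /(op_conj_dirac UU _ _ pres ix iy su) ev eu ephi]]]; exists u => //; split=> //.
    apply: (eqH_trans ephi); rewrite -dirac_sub; apply: eqHB => //.
    by apply: eqH_refl; exact: isH_dirac.
  move=> [u su [eu ephi]]; exists u, (dirac k (first_order c') (first_order d') u); split=> //.
    by apply/(op_conj_dirac UU _ _ pres ix iy su); apply: eqH_refl; exact: isH_dirac.
  by rewrite dirac_sub.
exact: dirac_esa.
Qed.
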